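(* Let $q\in\mathbb{C}\setminus\{0\}$ be not a root of unity. The $U_q(sl(3))$-module algebra structures on the quantum plane $A_q(2)$, up to isomorphism, and their classical limits ($sl_3$-actions by differentiations on $\mathbb{C}[x_1,x_2]$), are the following four kinds, where in each kind either $i=1$, $j=2$ or $i=2$, $j=1$. (1) $k_i(x_1)=\pm x_1$, $k_i(x_2)=\pm x_2$, $k_j(x_1)=\pm x_1$, $k_j(x_2)=\pm x_2$ (all signs arbitrary), and $e_i(x_1)=e_i(x_2)=f_i(x_1)=f_i(x_2)=0$, $e_j(x_1)=e_j(x_2)=f_j(x_1)=f_j(x_2)=0$. Classical limit: $h_i,h_j,e_i,e_j,f_i,f_j$ all send $x_1$ and $x_2$ to $0$. (2) $k_i(x_1)=q^{-2}x_1$, $k_i(x_2)=q^{-1}x_2$, $k_j(x_1)=qx_1$, $k_j(x_2)=q^{-1}x_2$, $e_i(x_1)=1$, $e_i(x_2)=0$, $e_j(x_1)=0$, $e_j(x_2)=x_1$, $f_i(x_1)=-qx_1^2$, $f_i(x_2)=-qx_1x_2$, $f_j(x_1)=x_2$, $f_j(x_2)=0$. Classical limit: $h_i(x_1)=-2x_1$, $h_i(x_2)=-x_2$, $h_j(x_1)=x_1$, $h_j(x_2)=-x_2$, $e_i(x_1)=1$, $e_i(x_2)=0$, $e_j(x_1)=0$, $e_j(x_2)=x_1$, $f_i(x_1)=-x_1^2$, $f_i(x_2)=-x_1x_2$, $f_j(x_1)=x_2$, $f_j(x_2)=0$. (3) $k_i(x_1)=qx_1$, $k_i(x_2)=q^2x_2$,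 $k_j(x_1)=qx_1$, $k_j(x_2)=q^{-1}x_2$, $e_i(x_1)=-qx_1x_2$, $e_i(x_2)=-qx_2^2$, $e_j(x_1)=0$, $e_j(x_2)=x_1$, $f_i(x_1)=0$, $f_i(x_2)=1$, $f_j(x_1)=x_2$, $f_j(x_2)=0$. Classical limit: $h_i(x_1)=x_1$, $h_i(x_2)=2x_2$, $h_j(x_1)=x_1$, $h_j(x_2)=-x_2$, $e_i(x_1)=-x_1x_2$, $e_i(x_2)=-x_2^2$, $e_j(x_1)=0$, $e_j(x_2)=x_1$, $f_i(x_1)=0$, $f_i(x_2)=1$, $f_j(x_1)=x_2$, $f_j(x_2)=0$. (4) $k_i(x_1)=q^{-2}x_1$, $k_i(x_2)=q^{-1}x_2$, $k_j(x_1)=qx_1$, $k_j(x_2)=q^2x_2$, $e_i(x_1)=1$, $e_i(x_2)=0$, $e_j(x_1)=-qx_1x_2$, $e_j(x_2)=-qx_2^2$, $f_i(x_1)=-qx_1^2$, $f_i(x_2)=-qx_1x_2$, $f_j(x_1)=0$, $f_j(x_2)=1$. Classical limit: $h_i(x_1)=-2x_1$, $h_i(x_2)=-x_2$, $h_j(x_1)=x_1$, $h_j(x_2)=2x_2$, $e_i(x_1)=1$, $e_i(x_2)=0$, $e_j(x_1)=-x_1x_2$, $e_j(x_2)=-x_2^2$, $f_i(x_1)=-x_1^2$, $f_i(x_2)=-x_1x_2$, $f_j(x_1)=0$, $f_j(x_2)=1$. Moreover, there are no isomorphisms between these four kinds of module-algebra structures.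
   Context: All algebras and vector spaces are over $\mathbb{C}$. $U_q(sl(m+1))$ ($m\ge 1$) is the unital algebra generated by $e_i,f_i,k_i,k_i^{-1}$ ($1\le i\le m$) with relations $k_ik_i^{-1}=k_i^{-1}k_i=1$, $k_ik_j=k_jk_i$, $k_ie_jk_i^{-1}=q^{a_{ij}}e_j$, $k_if_jk_i^{-1}=q^{-a_{ij}}f_j$, $[e_i,f_j]=\delta_{ij}\frac{k_i-k_i^{-1}}{q-q^{-1}}$; $e_ie_j=e_je_i$ and $f_if_j=f_jf_i$ if $a_{ij}=0$; $e_i^2e_j-(q+q^{-1})e_ie_je_i+e_je_i^2=0$ and $f_i^2f_j-(q+q^{-1})f_if_jf_i+f_jf_i^2=0$ if $a_{ij}=-1$. Here $a_{ii}=2$, $a_{ij}=-1$ if $|i-j|=1$, $a_{ij}=0$ if $|i-j|>1$. Its Hopf algebra structure is $\Delta(e_i)=1\otimes e_i+e_i\otimes k_i$, $\Delta(f_i)=k_i^{-1}\otimes f_i+f_i\otimes 1$, $\Delta(k_i^{\pm1})=k_i^{\pm1}\otimes k_i^{\pm1}$, $\varepsilon(k_i^{\pm1})=1$, $\varepsilon(e_i)=\varepsilon(f_i)=0$, $S(e_i)=-e_ik_i^{-1}$, $S(f_i)=-k_if_i$, $S(k_i^{\pm1})=k_i^{\mp1}$. The quantum $n$-space $A_q(n)$ is the unital algebra generated by $x_1,\dots,x_n$ with relations $x_ix_j=qx_jx_i$ for $i>j$; $A_q(2)$ is the quantum plane. An $H$-module algebra structure (or $H$-symmetry) on a unital algebra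 $A$, for a Hopf algebra $H$, is an algebra homomorphism $\pi:H\to \mathrm{End}_{\mathbb{C}}A$ with $\pi(h)(ab)=\sum_i\pi(h_i')(a)\pi(h_i'')(b)$ (where $\Delta(h)=\sum_i h_i'\otimes h_i''$) and $\pi(h)(1)=\varepsilon(h)1$; one writes $h(a)$ for $\pi(h)(a)$. It is determined by the values of the generators of $H$ on the generators of $A$. Two structures $\pi_1,\pi_2$ are isomorphic if there is an algebra automorphism $\psi$ of $A$ with $\psi\pi_1(h)\psi^{-1}=\pi_2(h)$ for all $h\in H$. The classical limit of a $U_q(sl(3))$-action is the action by differentiations on $\mathbb{C}[x_1,x_2]$ of the Lie algebra $sl_3$ with generators $h_1,h_2,e_1,e_2,f_1,f_2$ ($[e_1,f_1]=h_1$, $[e_2,f_2]=h_2$, $[e_1,f_2]=[e_2,f_1]=0$, $[h_1,e_1]=2e_1$, $[h_1,e_2]=-e_2$, $[h_2,e_2]=2e_2$, $[h_2,e_1]=-e_1$, $[h_1,f_1]=-2f_1$, $[h_1,f_2]=f_2$, $[h_2,f_2]=-2f_2$, $[h_2,f_1]=f_1$, $[h_1,h_2]=0$) derived from the quantum action by substituting $k_1=q^{h_1}$, $k_2=q^{h_2}$ and formally passing to the limit $q\to 1$. *)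

(* Defs.v *)
From HB Require Import structures.
From mathcomp Require Import all_boot all_order all_algebra.
From mathcomp Require Import ring.
From mathcomp Require Import mpoly complex.
From mathcomp Require Import boolp classical_sets reals topology normedtype.

Set Implicit Arguments.
Unset Strict Implicit.
Unset Printing Implicit Defensive.

Import GRing.Theory Num.Theory.

Local Open Scope ring_scope.
Local Open Scope quotient_scope.

Section Expressions.
Variables (F : fieldType) (G : Type).

Inductive expr : Type :=
  | Gen of G
  | Cst of F
  | Add of expr & expr
  | Mul of expr & expr.

Fixpoint eval (B : algType F) (g : G -> B) (t : expr) : B :=
  match t with
  | Gen a => g a
  | Cst c => c%:A
  | Add t1 t2 => eval g t1 + eval g t2
  | Mul t1 t2 => eval g t1 * eval g t2
  end.

HB.instance Definition _ := gen_eqMixin expr.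
HB.instance Definition _ := gen_choiceMixin expr.

End Expressions.
Arguments Gen {F G}.
Arguments Cst {F} G.

(* A presentation of a unital F-algebra by generators and relations.  The
   relations are written directly as identities between the images of the
   generators in a variable algebra B.  As a MathComp algebra has 1 != 0, a
   presentation comes with a point, i.e. a solution of the relations in F, which
   shows that the presented algebra is not the zero ring. *)
Record presentation (F : fieldType) := Presentation {
  gens : Type;
  rels : forall B : algType F, (gens -> B) -> Prop;
  point : gens -> F^o;
  pointP : rels point
}.

(* The presented algebra: noncommutative polynomial expressions in the
   generators, two of which are identified when they agree in every algebra in
   which the relations hold. *)
Section Presented.
Variables (F : fieldType) (P : presentation F).
Local Notation expr := (expr F (gens P)).

Definition expr_equiv (s t : expr) : bool :=
  `[< forall (B : algType F) (g : gens P -> B), rels g -> eval g s = eval g t >].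

Lemma expr_equivP : equiv_class_of expr_equiv.
Proof.
split=> [s|s t|s t u]; first exact/asboolP.
  by apply/asboolP/asboolP => st B g /st.
move=> /asboolP ts /asboolP su; apply/asboolP => B g Pg.
by rewrite ts // su.
Qed.

Canonical expr_equiv_rel := EquivRelPack expr_equivP.

Definition presented := {eq_quot expr_equiv}.

HB.instance Definition _ : EqQuotient _ expr_equiv presented :=
  EqQuotient.on presented.
HB.instance Definition _ := Choice.on presented.

Definition gen (a : gens P) : presented := \pi_presented (Gen a).

Definition lift_fun (B : algType F) (g : gens P -> B) (Pg : rels g)
  (u : presented) : B := eval g (repr u).

Lemma lift_pi (B : algType F) (g : gens P -> B) (Pg : rels g) (t : expr) :
  lift_fun Pg (\pi_presented t) = eval g t.
Proof.
rewrite /lift_fun.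
by have /eqmodP/asboolP := reprK (\pi_presented t); apply.
Qed.

Lemma presented_ext (u v : presented) :
  (forall (B : algType F) (g : gens P -> B) (Pg : rels g),
     lift_fun Pg u = lift_fun Pg v) -> u = v.
Proof.
rewrite -[u]reprK -[v]reprK => uv; apply/eqmodP/asboolP => B g Pg.
by have := uv B g Pg; rewrite !lift_pi.
Qed.

Definition pzero : presented := \pi_presented (Cst _ 0).
Definition pone : presented := \pi_presented (Cst _ 1).
Definition padd (u v : presented) : presented := \pi_presented (Add (repr u) (repr v)).
Definition pmul (u v : presented) : presented := \pi_presented (Mul (repr u) (repr v)).
Definition pscale (c : F) (u : presented) : presented :=
  \pi_presented (Mul (Cst _ c) (repr u)).
Definition popp (u : presented) : presented := pscale (-1) u.

Section LiftOps.
Variables (B : algType F) (g : gens P -> B) (Pg : rels g).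
Lemma lift0 : lift_fun Pg pzero = 0. Proof. by rewrite lift_pi /= scale0r. Qed.
Lemma lift1 : lift_fun Pg pone = 1. Proof. by rewrite lift_pi /= scale1r. Qed.
Lemma liftD u v : lift_fun Pg (padd u v) = lift_fun Pg u + lift_fun Pg v.
Proof. by rewrite lift_pi. Qed.
Lemma liftM u v : lift_fun Pg (pmul u v) = lift_fun Pg u * lift_fun Pg v.
Proof. by rewrite lift_pi. Qed.
Lemma liftZ c u : lift_fun Pg (pscale c u) = c *: lift_fun Pg u.
Proof. by rewrite lift_pi /= -scalerAl mul1r. Qed.
Lemma liftN u : lift_fun Pg (popp u) = - lift_fun Pg u.
Proof. by rewrite liftZ scaleN1r. Qed.
End LiftOps.
Let liftE := (lift0, lift1, liftD, liftM, liftN, liftZ).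

Fact paddA : associative padd.
Proof. by move=> u v w; apply: presented_ext => B g Pg; rewrite !liftE addrA. Qed.
Fact paddC : commutative padd.
Proof. by move=> u v; apply: presented_ext => B g Pg; rewrite !liftE addrC. Qed.
Fact padd0 : left_id pzero padd.
Proof. by move=> u; apply: presented_ext => B g Pg; rewrite !liftE add0r. Qed.
Fact paddN : left_inverse pzero popp padd.
Proof. by move=> u; apply: presented_ext => B g Pg; rewrite !liftE addNr. Qed.
HB.instance Definition _ := GRing.isZmodule.Build presented paddA paddC padd0 paddN.

Fact pmulA : associative pmul.
Proof. by move=> u v w; apply: presented_ext => B g Pg; rewrite !liftE mulrA. Qed.
Fact pmul1l : left_id pone pmul.
Proof. by move=> u; apply: presented_ext => B g Pg; rewrite !liftE mul1r. Qed.
Fact pmul1r : right_id pone pmul.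
Proof. by move=> u; apply: presented_ext => B g Pg; rewrite !liftE mulr1. Qed.
Fact pmulDl : left_distributive pmul +%R.
Proof. by move=> u v w; apply: presented_ext => B g Pg; rewrite !liftE mulrDl. Qed.
Fact pmulDr : right_distributive pmul +%R.
Proof. by move=> u v w; apply: presented_ext => B g Pg; rewrite !liftE mulrDr. Qed.
Fact pone_neq0 : pone != 0.
Proof.
apply/eqP => /(congr1 (lift_fun (pointP P))); rewrite lift0 lift1.
by apply/eqP; exact: oner_neq0.
Qed.
HB.instance Definition _ :=
  GRing.Zmodule_isNzRing.Build presented pmulA pmul1l pmul1r pmulDl pmulDr pone_neq0.

Fact pscaleA c d u : pscale c (pscale d u) = pscale (c * d) u.
Proof. by apply: presented_ext => B g Pg; rewrite !liftE scalerA. Qed.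
Fact pscale1 : left_id 1 pscale.
Proof. by move=> u; apply: presented_ext => B g Pg; rewrite !liftE scale1r. Qed.
Fact pscaleDr : right_distributive pscale +%R.
Proof. by move=> c u v; apply: presented_ext => B g Pg; rewrite !liftE scalerDr. Qed.
Fact pscaleDl u : {morph pscale^~ u : c d / c + d}.
Proof. by move=> c d; apply: presented_ext => B g Pg; rewrite !liftE scalerDl. Qed.
HB.instance Definition _ :=
  GRing.Zmodule_isLmodule.Build F presented pscaleA pscale1 pscaleDr pscaleDl.

Fact pscaleAl c (u v : presented) : c *: (u * v) = c *: u * v.
Proof. by apply: presented_ext => B g Pg; rewrite !liftE scalerAl. Qed.
HB.instance Definition _ := GRing.Lmodule_isLalgebra.Build F presented pscaleAl.
Fact pscaleAr c (u v : presented) : c *: (u * v) = u * (c *: v).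
Proof. by apply: presented_ext => B g Pg; rewrite !liftE scalerAr. Qed.
HB.instance Definition _ := GRing.Lalgebra_isAlgebra.Build F presented pscaleAr.

(* The algebra morphism determined by images of the generators that satisfy the
   relations. *)
Definition plift (B : algType F) (g : gens P -> B) (Pg : rels g) :
  presented -> B := lift_fun Pg.

Section LiftMorphism.
Variables (B : algType F) (g : gens P -> B) (Pg : rels g).
Fact lift_zmod_morphism : zmod_morphism (plift Pg).
Proof. by move=> u v; rewrite /plift !liftE. Qed.
Fact lift_monoid_morphism : monoid_morphism (plift Pg).
Proof. by split=> [|u v]; rewrite /plift !liftE. Qed.
Fact lift_scalable : scalable (plift Pg).
Proof. by move=> c u; rewrite /plift !liftE. Qed.
HB.instance Definition _ := GRing.isZmodMorphism.Build _ _ (plift Pg) lift_zmod_morphism.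
HB.instance Definition _ := GRing.isMonoidMorphism.Build _ _ (plift Pg) lift_monoid_morphism.
HB.instance Definition _ := GRing.isScalable.Build F presented B *:%R (plift Pg) lift_scalable.
Lemma lift_gen a : plift Pg (gen a) = g a.
Proof. exact: lift_pi. Qed.
End LiftMorphism.

Lemma presentedP (u v : presented) :
  (forall (B : algType F) (g : gens P -> B) (Pg : rels g), plift Pg u = plift Pg v) ->
  u = v.
Proof. exact: presented_ext. Qed.

End Presented.

(* The tensor product of two algebras: finite lists of pairs (h, k), standing
   for the sums of the h (x) k, where two lists are identified when every
   bilinear map sums to the same value over both. *)
Section Tensor.
Variables (F : fieldType) (H K : algType F).

Definition bilinear_map (V : lmodType F) (b : H -> K -> V) : Prop :=
  (forall k, linear (b^~ k)) /\ (forall h, linear (b h)).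

Definition tsum (V : lmodType F) (b : H -> K -> V) (s : seq (H * K)) : V :=
  \sum_(p <- s) b p.1 p.2.

Definition tensor_equiv (s t : seq (H * K)) : bool :=
  `[< forall (V : lmodType F) (b : H -> K -> V),
        bilinear_map b -> tsum b s = tsum b t >].

Lemma tensor_equivP : equiv_class_of tensor_equiv.
Proof.
split=> [s|s t|s t u]; first exact/asboolP.
  by apply/asboolP/asboolP => st V b /st.
move=> /asboolP ts /asboolP su; apply/asboolP => V b bb.
by rewrite ts // su.
Qed.

Canonical tensor_equiv_rel := EquivRelPack tensor_equivP.

Definition tensor := {eq_quot tensor_equiv}.

HB.instance Definition _ : EqQuotient _ tensor_equiv tensor :=
  EqQuotient.on tensor.
HB.instance Definition _ := Choice.on tensor.

(* The linear map on the tensor product induced by a bilinear map. *)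
Definition tlift (V : lmodType F) (b : H -> K -> V) (u : tensor) : V :=
  tsum b (repr u).

Lemma tlift_pi (V : lmodType F) (b : H -> K -> V) (bb : bilinear_map b) s :
  tlift b (\pi_tensor s) = tsum b s.
Proof.
by have /eqmodP/asboolP := reprK (\pi_tensor s); apply.
Qed.

Lemma tensor_ext (u v : tensor) :
  (forall (V : lmodType F) (b : H -> K -> V), bilinear_map b ->
     tlift b u = tlift b v) -> u = v.
Proof.
rewrite -[u]reprK -[v]reprK => uv; apply/eqmodP/asboolP => V b bb.
by have := uv V b bb; rewrite !tlift_pi.
Qed.

Definition tens (h : H) (k : K) : tensor := \pi_tensor [:: (h, k)].

Definition tzero : tensor := \pi_tensor [::].
Definition tone : tensor := tens 1 1.
Definition tadd (u v : tensor) : tensor := \pi_tensor (repr u ++ repr v).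
Definition tscale (c : F) (u : tensor) : tensor :=
  \pi_tensor [seq (c *: p.1, p.2) | p <- repr u].
Definition topp (u : tensor) : tensor := tscale (-1) u.
Definition tmul (u v : tensor) : tensor :=
  \pi_tensor [seq (p.1 * r.1, p.2 * r.2) | p <- repr u, r <- repr v].

Section Bilinear.
Variables (V : lmodType F) (b : H -> K -> V) (bb : bilinear_map b).
Lemma bilinDl h h' k : b (h + h') k = b h k + b h' k.
Proof. by have := bb.1 k 1 h h'; rewrite !scale1r. Qed.
Lemma bilinDr h k k' : b h (k + k') = b h k + b h k'.
Proof. by have := bb.2 h 1 k k'; rewrite !scale1r. Qed.
Lemma bilin0l k : b 0 k = 0.
Proof. by apply: (addrI (b 0 k)); rewrite -bilinDl !addr0. Qed.
Lemma bilin0r h : b h 0 = 0.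
Proof. by apply: (addrI (b h 0)); rewrite -bilinDr !addr0. Qed.
Lemma bilinZl c h k : b (c *: h) k = c *: b h k.
Proof. by have := bb.1 k c h 0; rewrite !addr0 bilin0l addr0. Qed.
Lemma bilinZr c h k : b h (c *: k) = c *: b h k.
Proof. by have := bb.2 h c k 0; rewrite !addr0 bilin0r addr0. Qed.
Lemma bilinear_mull h k : bilinear_map (fun h' k' => b (h * h') (k * k')).
Proof.
split=> [k' c x y|h' c x y].
  by rewrite mulrDr -scalerAr bilinDl bilinZl.
by rewrite mulrDr -scalerAr bilinDr bilinZr.
Qed.
Lemma bilinear_mulr h' k' : bilinear_map (fun h k => b (h * h') (k * k')).
Proof.
split=> [k c x y|h c x y].
  by rewrite mulrDl -scalerAl bilinDl bilinZl.
by rewrite mulrDl -scalerAl bilinDr bilinZr.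
Qed.

Lemma tlift0 : tlift b tzero = 0.
Proof. by rewrite tlift_pi // /tsum big_nil. Qed.
Lemma tliftD u v : tlift b (tadd u v) = tlift b u + tlift b v.
Proof. by rewrite tlift_pi // /tsum big_cat. Qed.
Lemma tliftZ c u : tlift b (tscale c u) = c *: tlift b u.
Proof.
rewrite tlift_pi // /tsum big_map /= scaler_sumr.
by apply: eq_bigr => p _; rewrite bilinZl.
Qed.
Lemma tliftN u : tlift b (topp u) = - tlift b u.
Proof. by rewrite tliftZ scaleN1r. Qed.
Lemma tlift_tens h k : tlift b (tens h k) = b h k.
Proof. by rewrite tlift_pi // /tsum big_seq1. Qed.
Lemma tliftMl u v :
  tlift b (tmul u v) =
  \sum_(p <- repr u) tlift (fun h k => b (p.1 * h) (p.2 * k)) v.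
Proof. by rewrite tlift_pi // /tsum big_allpairs_dep. Qed.
Lemma tliftMr u v :
  tlift b (tmul u v) =
  \sum_(p <- repr v) tlift (fun h k => b (h * p.1) (k * p.2)) u.
Proof. by rewrite tlift_pi // /tsum big_allpairs_dep exchange_big. Qed.
End Bilinear.

Fact taddA : associative tadd.
Proof. by move=> u v w; apply: tensor_ext => V b bb; rewrite !tliftD // addrA. Qed.
Fact taddC : commutative tadd.
Proof. by move=> u v; apply: tensor_ext => V b bb; rewrite !tliftD // addrC. Qed.
Fact tadd0 : left_id tzero tadd.
Proof. by move=> u; apply: tensor_ext => V b bb; rewrite tliftD // tlift0 // add0r. Qed.
Fact taddN : left_inverse tzero topp tadd.
Proof.
by move=> u; apply: tensor_ext => V b bb; rewrite tliftD // tliftN // tlift0 // addNr.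
Qed.
HB.instance Definition _ := GRing.isZmodule.Build tensor taddA taddC tadd0 taddN.

Fact tmulA : associative tmul.
Proof.
move=> u v w; apply: tensor_ext => V b bb.
rewrite tliftMl // tliftMr //.
under eq_bigr => p _ do rewrite (tliftMr (bilinear_mull bb _ _)).
under [RHS]eq_bigr => p _ do rewrite (tliftMl (bilinear_mulr bb _ _)).
rewrite exchange_big /=; apply: eq_bigr => r _; apply: eq_bigr => p _.
by apply: eq_bigr => x _; rewrite !mulrA.
Qed.
Fact tmul1l : left_id tone tmul.
Proof.
move=> u; apply: tensor_ext => V b bb; rewrite tliftMr //.
rewrite [RHS]/tlift /tsum; apply: eq_bigr => p _.
by rewrite tlift_tens ?mul1r //; exact: bilinear_mulr.
Qed.
Fact tmul1r : right_id tone tmul.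
Proof.
move=> u; apply: tensor_ext => V b bb; rewrite tliftMl //.
rewrite [RHS]/tlift /tsum; apply: eq_bigr => p _.
by rewrite tlift_tens ?mulr1 //; exact: bilinear_mull.
Qed.
Fact tmulDl : left_distributive tmul +%R.
Proof.
move=> u v w; apply: tensor_ext => V b bb.
rewrite tliftD // !tliftMr // -big_split /=; apply: eq_bigr => p _.
by rewrite tliftD //; exact: bilinear_mulr.
Qed.
Fact tmulDr : right_distributive tmul +%R.
Proof.
move=> u v w; apply: tensor_ext => V b bb.
rewrite tliftD // !tliftMl // -big_split /=; apply: eq_bigr => p _.
by rewrite tliftD //; exact: bilinear_mull.
Qed.
HB.instance Definition _ :=
  GRing.Zmodule_isPzRing.Build tensor tmulA tmul1l tmul1r tmulDl tmulDr.

Fact tscaleA c d u : tscale c (tscale d u) = tscale (c * d) u.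
Proof. by apply: tensor_ext => V b bb; rewrite !tliftZ // scalerA. Qed.
Fact tscale1 : left_id 1 tscale.
Proof. by move=> u; apply: tensor_ext => V b bb; rewrite !tliftZ // scale1r. Qed.
Fact tscaleDr : right_distributive tscale +%R.
Proof.
move=> c u v; apply: tensor_ext => V b bb.
by rewrite tliftZ // !tliftD // !tliftZ // scalerDr.
Qed.
Fact tscaleDl u : {morph tscale^~ u : c d / c + d}.
Proof.
move=> c d; apply: tensor_ext => V b bb.
by rewrite tliftZ // tliftD // !tliftZ // scalerDl.
Qed.
HB.instance Definition _ :=
  GRing.Zmodule_isLmodule.Build F tensor tscaleA tscale1 tscaleDr tscaleDl.

Fact tscaleAl c (u v : tensor) : c *: (u * v) = c *: u * v.
Proof.
apply: tensor_ext => V b bb; rewrite tliftZ // !tliftMr // scaler_sumr.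
by apply: eq_bigr => p _; rewrite tliftZ //; exact: bilinear_mulr.
Qed.
Fact tscaleAr c (u v : tensor) : c *: (u * v) = u * (c *: v).
Proof.
apply: tensor_ext => V b bb; rewrite tliftZ // !tliftMl // scaler_sumr.
by apply: eq_bigr => p _; rewrite tliftZ //; exact: bilinear_mull.
Qed.

Lemma tensM h h' k k' : tens h k * tens h' k' = tens (h * h') (k * k').
Proof.
apply: tensor_ext => V b bb; rewrite tliftMr // !tlift_tens //.
under eq_bigr => p _ do rewrite (tlift_tens (bilinear_mulr bb _ _)).
exact: (tlift_tens (bilinear_mull bb h k)).
Qed.
Lemma tensDl h h' k : tens (h + h') k = tens h k + tens h' k.
Proof.
by apply: tensor_ext => V b bb; rewrite tliftD // !tlift_tens // bilinDl.
Qed.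
Lemma tensDr h k k' : tens h (k + k') = tens h k + tens h k'.
Proof.
by apply: tensor_ext => V b bb; rewrite tliftD // !tlift_tens // bilinDr.
Qed.
Lemma tensZl c h k : tens (c *: h) k = c *: tens h k.
Proof.
by apply: tensor_ext => V b bb; rewrite tliftZ // !tlift_tens // bilinZl.
Qed.
Lemma tensZr c h k : tens h (c *: k) = c *: tens h k.
Proof.
by apply: tensor_ext => V b bb; rewrite tliftZ // !tlift_tens // bilinZr.
Qed.
Lemma tensBl h h' k : tens (h - h') k = tens h k - tens h' k.
Proof. by rewrite tensDl -scaleN1r tensZl scaleN1r. Qed.
Lemma tensBr h k k' : tens h (k - k') = tens h k - tens h k'.
Proof. by rewrite tensDr -scaleN1r tensZr scaleN1r. Qed.
Lemma tens0l k : tens 0 k = 0.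
Proof. by rewrite -(scale0r 0) tensZl scale0r. Qed.
Lemma tens0r h : tens h 0 = 0.
Proof. by rewrite -(scale0r 0) tensZr scale0r. Qed.

End Tensor.

Section TensorPresented.
Variables (F : fieldType) (P Q : presentation F).
Local Notation T := (tensor (presented P) (presented Q)).

Definition point_prod (h : presented P) (k : presented Q) : F^o :=
  plift (pointP P) h * plift (pointP Q) k.

Lemma point_prod_bilinear : bilinear_map point_prod.
Proof.
split=> [k c x y|h c x y]; rewrite /point_prod linearP /=.
  by rewrite mulrDl -scalerAl.
by rewrite mulrDr -scalerAr.
Qed.

Fact tensor_one_neq0 : (1 : T) != 0.
Proof.
apply/eqP => /(congr1 (tlift point_prod)).
rewrite (tlift_tens point_prod_bilinear) (tlift0 point_prod_bilinear).
rewrite /point_prod !rmorph1 mulr1.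
by apply/eqP; exact: oner_neq0.
Qed.

HB.instance Definition _ := GRing.PzSemiRing_isNonZero.Build T tensor_one_neq0.
HB.instance Definition _ := GRing.Lmodule_isLalgebra.Build F T (@tscaleAl _ _ _).
HB.instance Definition _ := GRing.Lalgebra_isAlgebra.Build F T (@tscaleAr _ _ _).
End TensorPresented.

(* U_q(sl(m+1)); the index i : 'I_m stands for i + 1 in {1, ..., m}. *)
Section QuantumGroup.
Variables (F : fieldType) (m : nat).

Inductive uq_gen : Type :=
  | Egen of 'I_m
  | Fgen of 'I_m
  | Kgen of 'I_m
  | Kinvgen of 'I_m.

Definition cartan (i j : 'I_m) : int :=
  if i == j then 2
  else if ((i.+1 == j :> nat) || (j.+1 == i :> nat)) then -1 else 0.

Lemma cartan_sym i j : cartan i j = cartan j i.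
Proof. by rewrite /cartan eq_sym orbC. Qed.

Definition qserre (q : F) (B : algType F) (x y : B) : B :=
  x ^+ 2 * y - (q + q^-1) *: (x * y * x) + y * x ^+ 2.

Record uq_rels (q : F) (B : algType F) (g : uq_gen -> B) : Prop := UqRels {
  uq_KKinv : forall i, g (Kgen i) * g (Kinvgen i) = 1;
  uq_KinvK : forall i, g (Kinvgen i) * g (Kgen i) = 1;
  uq_KK : forall i j, g (Kgen i) * g (Kgen j) = g (Kgen j) * g (Kgen i);
  uq_KE : forall i j,
    g (Kgen i) * g (Egen j) * g (Kinvgen i) = q ^ cartan i j *: g (Egen j);
  uq_KF : forall i j,
    g (Kgen i) * g (Fgen j) * g (Kinvgen i) = q ^ (- cartan i j) *: g (Fgen j);
  uq_EF : forall i j,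
    g (Egen i) * g (Fgen j) - g (Fgen j) * g (Egen i) =
    if i == j then (q - q^-1)^-1 *: (g (Kgen i) - g (Kinvgen i)) else 0;
  uq_EE : forall i j, cartan i j = 0 ->
    g (Egen i) * g (Egen j) = g (Egen j) * g (Egen i);
  uq_FF : forall i j, cartan i j = 0 ->
    g (Fgen i) * g (Fgen j) = g (Fgen j) * g (Fgen i);
  uq_Eserre : forall i j, cartan i j = -1 ->
    qserre q (g (Egen i)) (g (Egen j)) = 0;
  uq_Fserre : forall i j, cartan i j = -1 ->
    qserre q (g (Fgen i)) (g (Fgen j)) = 0
}.

Definition uq_counit_gen (x : uq_gen) : F^o :=
  match x with
  | Egen _ | Fgen _ => 0
  | Kgen _ | Kinvgen _ => 1
  end.

Lemma uq_counit_rels q : uq_rels q uq_counit_gen.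
Proof.
have serre0 : qserre q (0 : F^o) (0 : F^o) = 0.
  by rewrite /qserre expr0n !mul0r scaler0 subrr addr0.
split=> //= *; rewrite ?mulr0 ?mul0r ?mulr1 ?scaler0 ?subrr //.
by case: ifP => _; rewrite ?scaler0.
Qed.

Definition uq_pres (q : F) : presentation F := Presentation (uq_counit_rels q).

Definition Uq (q : F) := presented (uq_pres q).
HB.instance Definition _ q := GRing.Algebra.on (Uq q).

Definition uq_e q i : Uq q := @gen F (uq_pres q) (Egen i).
Definition uq_f q i : Uq q := @gen F (uq_pres q) (Fgen i).
Definition uq_k q i : Uq q := @gen F (uq_pres q) (Kgen i).
Definition uq_kinv q i : Uq q := @gen F (uq_pres q) (Kinvgen i).

Lemma Uq_rels q : uq_rels q (@gen F (uq_pres q)).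
Proof.
split=> [i|i|i j|i j|i j|i j|i j c|i j c|i j c|i j c];
  apply: presentedP => B g Pg.
- by rewrite rmorphM rmorph1 /= !lift_gen (uq_KKinv Pg).
- by rewrite rmorphM rmorph1 /= !lift_gen (uq_KinvK Pg).
- by rewrite !rmorphM /= !lift_gen (uq_KK Pg).
- by rewrite linearZ /= !rmorphM /= !lift_gen (uq_KE Pg).
- by rewrite linearZ /= !rmorphM /= !lift_gen (uq_KF Pg).
- rewrite raddfB /= !rmorphM /= !lift_gen (uq_EF Pg).
  by case: ifP => _; rewrite ?rmorph0 // linearZ /= (raddfB (plift Pg)) /= !lift_gen.
- by rewrite !rmorphM /= !lift_gen (uq_EE Pg).
- by rewrite !rmorphM /= !lift_gen (uq_FF Pg).
- rewrite /qserre raddfD /= raddfB /= linearZ /= !rmorphM /= !lift_gen.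
  rewrite rmorph0; exact: (uq_Eserre Pg).
- rewrite /qserre raddfD /= raddfB /= linearZ /= !rmorphM /= !lift_gen.
  rewrite rmorph0; exact: (uq_Fserre Pg).
Qed.

Variables (q : F) (q0 : q != 0).
Local Notation U := (Uq q).
Local Notation T := (tensor (presented (uq_pres q)) (presented (uq_pres q))).
Local Notation e := (uq_e q).
Local Notation f := (uq_f q).
Local Notation k := (uq_k q).
Local Notation k' := (uq_kinv q).

Definition uq_comul_gen (x : uq_gen) : T :=
  match x with
  | Egen i => tens 1 (e i) + tens (e i) (k i)
  | Fgen i => tens (k' i) (f i) + tens (f i) 1
  | Kgen i => tens (k i) (k i)
  | Kinvgen i => tens (k' i) (k' i)
  end.

Lemma qserreD (B : algType F) (x y x' y' : B) :
  y * x = q ^+ 2 *: (x * y) -> y * x' = q^-1 *: (x' * y) ->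
  y' * x = q^-1 *: (x * y') ->
  qserre q x x' = 0 -> qserre q y y' = 0 -> qserre q (x + y) (x' + y') = 0.
Proof.
move=> yx yx' y'x sx sy.
pose S (a b c : B) := a * b * c - (q + q^-1) *: (a * c * b) + c * a * b.
have S1 a a' b c : S (a + a') b c = S a b c + S a' b c.
  by rewrite /S !(mulrDl, mulrDr) scalerDr opprD [X in X + _]addrACA [LHS]addrACA.
have S2 a b b' c : S a (b + b') c = S a b c + S a b' c.
  by rewrite /S !(mulrDl, mulrDr) scalerDr opprD [X in X + _]addrACA [LHS]addrACA.
have S3 a b c c' : S a b (c + c') = S a b c + S a b c'.
  by rewrite /S !(mulrDl, mulrDr) scalerDr opprD [X in X + _]addrACA [LHS]addrACA.
have SE a b : qserre q a b = S a a b by rewrite /qserre /S !expr2 !mulrA.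
rewrite SE !(S1, S2, S3) -!SE sx sy add0r addr0.
have h1 w : w * y * x = q ^+ 2 *: (w * x * y).
  by rewrite -mulrA yx -scalerAr mulrA.
have h2 w : w * y * x' = q^-1 *: (w * x' * y).
  by rewrite -mulrA yx' -scalerAr mulrA.
have h3 w : w * y' * x = q^-1 *: (w * x * y').
  by rewrite -mulrA y'x -scalerAr mulrA.
have z (c : F) (v : B) : c = 0 -> c *: v = 0.
  by move=> ->; rewrite scale0r.
have SA : S x x y' = 0.
  rewrite /S y'x h3 -!scalerAl h3 !scalerA -scaleNr -[X in X + _ + _]scale1r.
  by rewrite -!scalerDl (_ : _ + _ = 0) ?scale0r //; field.
have SD : S y y x' = 0.
  rewrite /S yx' h2 -!scalerAl yx' -!scalerAl !scalerA -scaleNr.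
  rewrite -[X in _ + X]scale1r.
  by rewrite -!scalerDl (_ : _ + _ = 0) ?scale0r //; field.
have SB : S x y x' + S y x x' = 0.
  rewrite /S h2 yx yx' h1 -!scalerAl h1 h2 !scalerA -!scaleNr.
  rewrite -[X in _ + X + _]scale1r.
  rewrite (AC (3*3) ((1*2*4)*(3*5*6))) /= -!scalerDl.
  by rewrite !z ?addr0 //; field.
have SC : S x y y' + S y x y' = 0.
  rewrite /S !(yx, y'x, h1, h3) -!scalerAl ?(yx, y'x, h1, h3) -?scalerAl.
  rewrite !scalerA -!scaleNr -[X in X + _ + _ + (_ + _ + _)]scale1r.
  rewrite (AC (3*3) ((1*4*5)*(2*3*6))) /= -!scalerDl.
  by rewrite !z ?addr0 //; field.
by rewrite !SE SA SD add0r addr0 addrACA SB SC addr0.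
Qed.

Lemma uq_comul_rels : uq_rels q uq_comul_gen.
Proof.
have [KK' K'K KKC KE KF EF EE FF ES FS] := Uq_rels q.
have ek i j : k i * e j = q ^ cartan i j *: (e j * k i).
  by rewrite scalerAl -KE -!mulrA K'K mulr1.
have fk i j : k i * f j = q ^ (- cartan i j) *: (f j * k i).
  by rewrite scalerAl -KF -!mulrA K'K mulr1.
have fk' i j : k' i * f j = q ^ cartan i j *: (f j * k' i).
  have -> : f j * k' i = q ^ (- cartan i j) *: (k' i * f j).
    rewrite -[f j in LHS]mul1r -(K'K i) -[k' i * k i * f j]mulrA fk.
    by rewrite -scalerAr -scalerAl -!mulrA KK' mulr1.
  by rewrite scalerA -expfzDr // addrN expr0z scale1r.
have ek' i j : e j * k' i = q ^ cartan i j *: (k' i * e j).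
  rewrite -[e j in LHS]mul1r -(K'K i) -[k' i * k i * e j]mulrA ek.
  by rewrite -scalerAr -scalerAl -!mulrA KK' mulr1.
have kk' i j : k i * k j * k' i = k j by rewrite KKC -mulrA KK' mulr1.
have kk'C i j : k' j * k i = k i * k' j.
  rewrite -[k i in LHS]mulr1 -(KK' j) [k i * (_ * _)]mulrA KKC.
  by rewrite !mulrA K'K mul1r.
have kk'' i j : k i * k' j * k' i = k' j by rewrite -kk'C -mulrA KK' mulr1.
have k'C i j : k' i * k' j = k' j * k' i.
  rewrite -[k' j in LHS]mulr1 -[in LHS](KK' i) [k' j * (_ * _)]mulrA kk'C.
  by rewrite !mulrA K'K mul1r.
have T1 : tens 1 1 = 1 :> T by [].
have cii i : cartan i i = 2 by rewrite /cartan eqxx.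
split=> [i|i|i j|i j|i j|i j|i j c|i j c|i j c|i j c] /=.
- by rewrite tensM KK'.
- by rewrite tensM K'K.
- by rewrite !tensM KKC.
- by rewrite mulrDr mulrDl !tensM mulr1 KK' KE kk' tensZr tensZl scalerDr.
- by rewrite mulrDr mulrDl !tensM mulr1 KK' KF kk'' tensZr tensZl scalerDr.
- rewrite !(mulrDl, mulrDr) !tensM !(mulr1, mul1r).
  have -> : tens (e i * k' j) (k i * f j) = tens (k' j * e i) (f j * k i) :> T.
    rewrite ek' fk tensZl tensZr scalerA cartan_sym -expfzDr //.
    by rewrite addrN expr0z scale1r.
  have -> (u b v w u' w' : T) :
      u + b + (v + w) - (u' + v + (b + w')) = (u - u') + (w - w').
    rewrite !opprD (AC ((2*2)*(2*2)) ((1*5)*(4*8)*((2*7)*(3*6)))) /=.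
    by rewrite !subrr !addr0.
  rewrite -!(tensBl, tensBr) EF; case: eqP => [->|_]; last first.
    by rewrite tens0l tens0r addr0.
  rewrite tensZl tensZr -scalerDr !(tensBl, tensBr); congr (_ *: _).
  by rewrite addrC addrA subrK.
- have c' : cartan j i = 0 by rewrite cartan_sym.
  rewrite !(mulrDl, mulrDr) !tensM !(mulr1, mul1r) EE // KKC.
  rewrite [k i * e j]ek [k j * e i]ek c c' expr0z !scale1r EE //.
  by rewrite -!addrA; congr (_ + _); rewrite addrCA.
- have c' : cartan j i = 0 by rewrite cartan_sym.
  rewrite !(mulrDl, mulrDr) !tensM !(mulr1, mul1r).
  rewrite [k' i * f j]fk' [k' j * f i]fk' c c' expr0z !scale1r [f i * f j]FF // [k' i * k' j]k'C.
  by rewrite -!addrA; congr (_ + _); rewrite addrCA.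
- have c' : cartan j i = -1 by rewrite cartan_sym.
  apply: qserreD; rewrite ?tensM ?(mul1r, mulr1).
  + by rewrite ek cii tensZr.
  + by rewrite ek c tensZr exprN1.
  + by rewrite ek c' tensZr exprN1.
  + rewrite -[RHS](tens0r _ 1) -(ES _ _ c) /qserre !expr2 !tensM !mul1r.
    by rewrite tensDr tensBr tensZr.
  + rewrite -[RHS](tens0l _ (k i * k i * k j)) -(ES _ _ c) /qserre !expr2 !tensM.
    rewrite tensDl tensBl tensZl -[k i * k j * k i]mulrA [k j * (k i * k i)]mulrA.
    by rewrite [k j * k i]KKC -[k i * k j * k i]mulrA [k j * k i]KKC !mulrA.
- have c' : cartan j i = -1 by rewrite cartan_sym.
  rewrite addrC [X in qserre _ _ X]addrC.
  apply: qserreD; rewrite ?tensM ?(mul1r, mulr1).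
  + by rewrite fk' cii tensZl.
  + by rewrite fk' c tensZl exprN1.
  + by rewrite fk' c' tensZl exprN1.
  + rewrite -[RHS](tens0l _ 1) -(FS _ _ c) /qserre !expr2 !tensM !mul1r.
    by rewrite tensDl tensBl tensZl.
  + rewrite -[RHS](tens0r _ (k' i * k' i * k' j)) -(FS _ _ c) /qserre !expr2 !tensM.
    rewrite tensDr tensBr tensZr -[k' i * k' j * k' i]mulrA.
    rewrite [k' j * (k' i * k' i)]mulrA [k' j * k' i]k'C.
    by rewrite -[k' i * k' j * k' i]mulrA [k' j * k' i]k'C !mulrA.
Qed.

Definition uq_comul : {lrmorphism Uq q -> T} :=
  @plift F (uq_pres q) T uq_comul_gen uq_comul_rels.

End QuantumGroup.

Definition uq_counit (F : fieldType) (m : nat) (q : F) :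
    {lrmorphism Uq m q -> F^o} :=
  @plift F (uq_pres m q) F^o (@uq_counit_gen F m) (uq_counit_rels m q).

Section QuantumSpace.
Variables (F : fieldType) (n : nat) (q : F).

Definition qspace_rels (B : algType F) (x : 'I_n -> B) : Prop :=
  forall i j : 'I_n, (j < i)%N -> x i * x j = q *: (x j * x i).

Lemma qspace_rels0 : qspace_rels (fun=> 0 : F^o).
Proof. by move=> i j _; rewrite mul0r scaler0. Qed.

Definition qspace_pres : presentation F := Presentation qspace_rels0.

Definition qspace := presented qspace_pres.
HB.instance Definition _ := GRing.Algebra.on qspace.

Definition qvar (i : 'I_n) : qspace := @gen F qspace_pres i.

Lemma qvarC (i j : 'I_n) : (j < i)%N -> qvar i * qvar j = q *: (qvar j * qvar i).
Proof.
move=> ij; apply: presentedP => B g Pg.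
by rewrite linearZ /= !rmorphM /= !lift_gen; exact: Pg.
Qed.
End QuantumSpace.

(* Module algebra structures on A over an algebra H with comultiplication D and
   counit eps; act_comul is stated for every way of writing D h as a finite sum
   of pure tensors.  The antipode plays no role in this notion. *)
Record module_algebra (F : fieldType) (P : presentation F)
    (D : presented P -> tensor (presented P) (presented P))
    (eps : presented P -> F^o) (A : algType F) := ModuleAlgebra {
  act :> presented P -> A -> A;
  act_linear : forall h, linear (act h);
  act_linearl : forall a, linear (act^~ a);
  act1 : forall a, act 1 a = a;
  actM : forall g h a, act (g * h) a = act g (act h a);
  act_comul : forall h (s : seq (presented P * presented P)),
    D h = \sum_(p <- s) tens p.1 p.2 ->
    forall a b, act h (a * b) = \sum_(p <- s) act p.1 a * act p.2 b;
  act_counit : forall h, act h 1 = eps h *: 1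
}.

Definition module_algebra_isom (F : fieldType) (P : presentation F) D eps
    (A : algType F) (pi1 pi2 : @module_algebra F P D eps A) : Prop :=
  exists psi : {lrmorphism A -> A},
    bijective psi /\ forall h a, psi (pi1 h a) = pi2 h (psi a).

Record qparam (F : fieldType) := QParam {
  qval :> F;
  qval_neq0 : qval != 0;
  qval_not_root : forall n, (0 < n)%N -> qval ^+ n != 1
}.

Section QuantumPlane.
Variable F : fieldType.

Definition uq_symmetry (m n : nat) (q : qparam F) :=
  module_algebra (@uq_comul F m q (qval_neq0 q)) (uq_counit m q) (qspace n q).

Inductive kind : Type :=
  | Kind1 of bool & bool & bool & bool
  | Kind2
  | Kind3
  | Kind4.

Definition kind_number (c : kind) : nat :=
  match c with Kind1 _ _ _ _ => 1 | Kind2 => 2 | Kind3 => 3 | Kind4 => 4 end.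

Definition of_kind (p : qparam F) (c : kind) (i j : 'I_2)
    (pi : uq_symmetry 2 2 p) : Prop :=
  let q := qval p in
  let x1 := qvar q (ord0 : 'I_2) in
  let x2 := qvar q (ord_max : 'I_2) in
  let e i := pi (uq_e q i) in
  let f i := pi (uq_f q i) in
  let k i := pi (uq_k q i) in
  match c with
  | Kind1 si1 si2 sj1 sj2 =>
      [/\ [/\ k i x1 = (-1) ^+ si1 *: x1, k i x2 = (-1) ^+ si2 *: x2,
              k j x1 = (-1) ^+ sj1 *: x1 & k j x2 = (-1) ^+ sj2 *: x2],
          [/\ e i x1 = 0, e i x2 = 0, f i x1 = 0 & f i x2 = 0] &
          [/\ e j x1 = 0, e j x2 = 0, f j x1 = 0 & f j x2 = 0]]
  | Kind2 =>
      [/\ [/\ k i x1 = q ^- 2 *: x1, k i x2 = q^-1 *: x2,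
              k j x1 = q *: x1 & k j x2 = q^-1 *: x2],
          [/\ e i x1 = 1, e i x2 = 0, e j x1 = 0 & e j x2 = x1] &
          [/\ f i x1 = - q *: x1 ^+ 2, f i x2 = - q *: (x1 * x2),
              f j x1 = x2 & f j x2 = 0]]
  | Kind3 =>
      [/\ [/\ k i x1 = q *: x1, k i x2 = q ^+ 2 *: x2,
              k j x1 = q *: x1 & k j x2 = q^-1 *: x2],
          [/\ e i x1 = - q *: (x1 * x2), e i x2 = - q *: x2 ^+ 2,
              e j x1 = 0 & e j x2 = x1] &
          [/\ f i x1 = 0, f i x2 = 1, f j x1 = x2 & f j x2 = 0]]
  | Kind4 =>
      [/\ [/\ k i x1 = q ^- 2 *: x1, k i x2 = q^-1 *: x2,
              k j x1 = q *: x1 & k j x2 = q ^+ 2 *: x2],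
          [/\ e i x1 = 1, e i x2 = 0,
              e j x1 = - q *: (x1 * x2) & e j x2 = - q *: x2 ^+ 2] &
          [/\ f i x1 = - q *: x1 ^+ 2, f i x2 = - q *: (x1 * x2),
              f j x1 = 0 & f j x2 = 1]]
  end.
End QuantumPlane.

(* sl_3 is the Lie algebra of traceless 3 x 3 matrices with its standard
   Chevalley generators. *)
Section SpecialLinear.
Variable F : fieldType.

Definition lie_bracket (X Y : 'M[F]_3) : 'M[F]_3 := X *m Y - Y *m X.

Definition sl3_lo (i : 'I_2) : 'I_3 := widen_ord (leqnSn 2) i.
Definition sl3_hi (i : 'I_2) : 'I_3 := lift ord0 i.

Definition sl3_e (i : 'I_2) : 'M[F]_3 := delta_mx (sl3_lo i) (sl3_hi i).
Definition sl3_f (i : 'I_2) : 'M[F]_3 := delta_mx (sl3_hi i) (sl3_lo i).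
Definition sl3_h (i : 'I_2) : 'M[F]_3 :=
  delta_mx (sl3_lo i) (sl3_lo i) - delta_mx (sl3_hi i) (sl3_hi i).

Lemma sl3_generators (i j : 'I_2) :
  [/\ lie_bracket (sl3_e i) (sl3_f j) = (i == j)%:R *: sl3_h i,
      lie_bracket (sl3_h i) (sl3_e j) = (cartan i j)%:~R *: sl3_e j,
      lie_bracket (sl3_h i) (sl3_f j) = - (cartan i j)%:~R *: sl3_f j &
      lie_bracket (sl3_h i) (sl3_h j) = 0].
Proof.
rewrite /lie_bracket /sl3_h /sl3_e /sl3_f /cartan !(mulmxBl, mulmxBr) !mul_delta_mx_cond.
by split; apply/matrixP=> a b; rewrite !mxE;
  case: i => -[|[|[]]] //= ?; case: j => -[|[|[]]] //= ?;
  case: a => -[|[|[|[]]]] //= ?; case: b => -[|[|[|[]]]] //= ?;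
  rewrite ?mxE -?val_eqE /= ?mxE -?val_eqE /=; ring.
Qed.

(* An action of sl_3 by derivations of F[x_1, x_2]; the values of rho outside
   the traceless matrices are irrelevant. *)
Record sl3_derivation_action (rho : 'M[F]_3 -> {mpoly F[2]} -> {mpoly F[2]}) :
    Prop := Sl3DerivationAction {
  rho_linear : forall X, \tr X = 0 -> linear (rho X);
  rho_leibniz : forall X, \tr X = 0 ->
    forall u v, rho X (u * v) = rho X u * v + u * rho X v;
  rho_linearl : forall c X Y, \tr X = 0 -> \tr Y = 0 ->
    forall u, rho (c *: X + Y) u = c *: rho X u + rho Y u;
  rho_bracket : forall X Y, \tr X = 0 -> \tr Y = 0 ->
    forall u, rho (lie_bracket X Y) u = rho X (rho Y u) - rho Y (rho X u)
}.

Definition classical_of_kind (c : kind) (i j : 'I_2)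
    (rho : 'M[F]_3 -> {mpoly F[2]} -> {mpoly F[2]}) : Prop :=
  let x1 := 'X_(ord0 : 'I_2) : {mpoly F[2]} in
  let x2 := 'X_(ord_max : 'I_2) : {mpoly F[2]} in
  let e i := rho (sl3_e i) in
  let f i := rho (sl3_f i) in
  let h i := rho (sl3_h i) in
  match c with
  | Kind1 _ _ _ _ =>
      [/\ [/\ h i x1 = 0, h i x2 = 0, h j x1 = 0 & h j x2 = 0],
          [/\ e i x1 = 0, e i x2 = 0, e j x1 = 0 & e j x2 = 0] &
          [/\ f i x1 = 0, f i x2 = 0, f j x1 = 0 & f j x2 = 0]]
  | Kind2 =>
      [/\ [/\ h i x1 = - 2 *: x1, h i x2 = - x2, h j x1 = x1 & h j x2 = - x2],
          [/\ e i x1 = 1, e i x2 = 0, e j x1 = 0 & e j x2 = x1] &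
          [/\ f i x1 = - x1 ^+ 2, f i x2 = - (x1 * x2),
              f j x1 = x2 & f j x2 = 0]]
  | Kind3 =>
      [/\ [/\ h i x1 = x1, h i x2 = 2 *: x2, h j x1 = x1 & h j x2 = - x2],
          [/\ e i x1 = - (x1 * x2), e i x2 = - x2 ^+ 2,
              e j x1 = 0 & e j x2 = x1] &
          [/\ f i x1 = 0, f i x2 = 1, f j x1 = x2 & f j x2 = 0]]
  | Kind4 =>
      [/\ [/\ h i x1 = - 2 *: x1, h i x2 = - x2, h j x1 = x1 & h j x2 = 2 *: x2],
          [/\ e i x1 = 1, e i x2 = 0,
              e j x1 = - (x1 * x2) & e j x2 = - x2 ^+ 2] &
          [/\ f i x1 = - x1 ^+ 2, f i x2 = - (x1 * x2),
              f j x1 = 0 & f j x2 = 1]]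
  end.
End SpecialLinear.

Section ClassicalLimit.
Import numFieldNormedType.Exports.
Local Open Scope classical_set_scope.
Variable C : numFieldType.

Definition not_root_of_unity (q : C) : Prop :=
  q != 0 /\ forall n, (0 < n)%N -> q ^+ n != 1.

(* Limits as q -> 1 are taken coefficientwise, through the bases of monomials
   x_1^a x_2^b of A_q(2) and of C[x_1, x_2], with supports bounded uniformly in
   q. *)
Definition tends_to (u : forall q : qparam C, qspace 2 q) (p : {mpoly C[2]}) :
    Prop :=
  exists (N : nat) (c : C -> 'I_N -> 'I_N -> C) (l : 'I_N -> 'I_N -> C),
    [/\ forall q : qparam C,
          u q = \sum_(a < N) \sum_(b < N)
            c (qval q) a b *: (qvar q ord0 ^+ a * qvar q ord_max ^+ b),
        p = \sum_(a < N) \sum_(b < N) l a b *: ('X_ord0 ^+ a * 'X_ord_max ^+ b) &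
        forall a b, c q a b @[q --> within not_root_of_unity (nbhs (1 : C))]
                      --> l a b].

(* Since k_i = q^{h_i} gives (k_i - k_i^-1) / (q - q^-1) -> h_i as q -> 1, the
   limit of the left-hand side is the meaning given to h_i; it also makes sense
   when k_i has an eigenvalue -1. *)
Definition uq_h (q : qparam C) (i : 'I_2) : Uq 2 q :=
  (qval q - (qval q)^-1)^-1 *: (uq_k q i - uq_kinv q i).

Definition classical_limit (pi : forall q : qparam C, uq_symmetry 2 2 q)
    (rho : 'M[C]_3 -> {mpoly C[2]} -> {mpoly C[2]}) : Prop :=
  forall (i : 'I_2) (a b : nat),
    let mon (q : qparam C) := qvar q ord0 ^+ a * qvar q ord_max ^+ b in
    let cmon : {mpoly C[2]} := 'X_ord0 ^+ a * 'X_ord_max ^+ b in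
    [/\ tends_to (fun q => pi q (uq_e q i) (mon q)) (rho (sl3_e C i) cmon),
        tends_to (fun q => pi q (uq_f q i) (mon q)) (rho (sl3_f C i) cmon) &
        tends_to (fun q => pi q (uq_h q i) (mon q)) (rho (sl3_h C i) cmon)].
End ClassicalLimit.

(* Main.v *)
Require Import Defs.
From HB Require Import structures.
From mathcomp Require Import all_boot all_order all_algebra.
From mathcomp Require Import ring zify.
From mathcomp Require Import mpoly complex.
From mathcomp Require Import boolp classical_sets functions reals topology normedtype.

Set Implicit Arguments.
Unset Strict Implicit.
Unset Printing Implicit Defensive.

Import GRing.Theory Num.Theory.
Local Open Scope ring_scope.

(** A symmetry of the quantum plane A = A_q(2) is a representation of
    U_q(sl_3) on A in which k_i acts by an algebra automorphism and e_i, f_i by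
    skew derivations. It is therefore determined by its values on x_1 and x_2,
    and the whole classification is a matter of weights.

    _Automorphisms._ As q is not a root of unity, every automorphism of A is
    x_1 -> a x_1, x_2 -> b x_2 ([aut_diagonal]): the element x_1 x_2 generates
    the ideal of the commutators, so an automorphism with images X, Y of x_1,
    x_2 satisfies X V Y = x_1 x_2 for some V; leading monomials multiply, so X
    and Y have degree one, and Y X = q X Y leaves the diagonal case only.

    _Existence._ A node of the Dynkin diagram can act in four ways: trivially up
    to signs, by the linear action on the span of x_1 and x_2, or with one of
    e, f a q-derivative in one variable and the other a quadratic operator.
    On monomials these operators are weighted shifts, whose weights are
    q-integers times powers of q; the relations and the product rules become
    identities between rational functions in q and in powers q^m, q^n
    ([sl2_ok_der1], [sl3_ok_der1_lin], [op_e_mul] and their companions). Such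
    operators give a module algebra structure ([construct_sym]), because the
    product rule for the generators propagates through the comultiplication.

    _Classification._ Each k_i is diagonal, so it gives the coefficients of
    e_j(x_s) and f_j(x_s) a weight, and comparing coefficients in
    e_j(x_2 x_1) = q e_j(x_1 x_2) determines an eigenvalue of k_j as soon as a
    coefficient on an edge of the quadrant does not vanish. If a constant term
    is nonzero this fixes both eigenvalues; if all constant terms vanish, the
    relation between e_j, f_j and k_j in degree one does it ([node_linear]).
    Hence a node has one of six profiles ([profile_ex]). The eigenvalues of the
    other node must match too, which leaves three pairs of nontrivial profiles
    ([profile_pair]); in these the two weights of a monomial determine it, so
    e_j(x_s) and f_j(x_s) are multiples of known monomials, and a rescaling of
    x_1 and x_2 brings the structure to one of the four kinds
    ([classification]).

    _Non-isomorphism._ An isomorphism is diagonal, hence preserves the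
    eigenvalues of k_1 and k_2, up to sign powers of q that distinguish the
    kinds ([kinds_not_isom]).

    _Classical limits._ The q-integer [n] tends to n, which gives the limits on
    monomials of the e_i, f_i, h_i ([e_limit], [f_limit], [h_limit]). That the
    limit operators come from an action of sl_3 is seen geometrically: they are
    the vector fields of the projective action on an affine chart of the plane,
    for the standard representation or its dual ([kind_field_action],
    [kind_field_values]). *)

(** * Presented algebras and algebras of endomorphisms *)
Section PresentedInduction.
Local Open Scope quotient_scope.
Variables (F : fieldType) (P : presentation F).

Lemma presented_ind (Q : presented P -> Prop) :
  Q 1 -> (forall a, Q (gen a)) -> (forall c u, Q u -> Q (c *: u)) ->
  (forall u v, Q u -> Q v -> Q (u + v)) ->
  (forall u v, Q u -> Q v -> Q (u * v)) -> forall u, Q u.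
Proof.
move=> Q1 Qg QZ QD QM u; rewrite -[u]reprK; elim: (repr u) => [a|c|s Qs t Qt|s Qs t Qt].
- exact: Qg.
- suff -> : \pi_(presented P) (Cst (gens P) c) = c *: 1 by apply: QZ.
  apply: presentedP => B g Pg; rewrite linearZ /= rmorph1.
  exact: (lift_pi Pg).
- suff -> : \pi_(presented P) (Add s t) = \pi_(presented P) s + \pi_(presented P) t by apply: QD.
  apply: presentedP => B g Pg; rewrite raddfD /=.
  by rewrite /plift !lift_pi.
- suff -> : \pi_(presented P) (Mul s t) = \pi_(presented P) s * \pi_(presented P) t by apply: QM.
  apply: presentedP => B g Pg; rewrite rmorphM /=.
  by rewrite /plift !lift_pi.
Qed.

End PresentedInduction.

Section Endomorphisms.
Variables (F : fieldType) (V : lmodType F) (v0 : V).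

(** The type takes a proof that V is nonzero because an algebra must satisfy
    1 != 0. *)
Record endo (nz : v0 != 0) := Endo { endo_fun :> V -> V; endo_linear : linear endo_fun }.

Variable nz : v0 != 0.
Local Notation E := (endo nz).

HB.instance Definition _ := gen_eqMixin E.
HB.instance Definition _ := gen_choiceMixin E.

Lemma endoP (f g : E) : f =1 g -> f = g.
Proof.
case: f g => [f lf] [g lg] /= /funext fg; subst g.
by congr Endo; exact: Prop_irrelevance.
Qed.

Lemma endoD (f : E) u v : f (u + v) = f u + f v.
Proof. by have := endo_linear f 1 u v; rewrite !scale1r. Qed.
Lemma endo0 (f : E) : f 0 = 0.
Proof. by apply: (addrI (f 0)); rewrite -endoD !addr0. Qed.
Lemma endoZ (f : E) c u : f (c *: u) = c *: f u.
Proof. by have := endo_linear f c u 0; rewrite !addr0 endo0 addr0. Qed.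

Fact endo_zero_linear : linear (fun _ : V => 0 : V).
Proof. by move=> c u v; rewrite scaler0 addr0. Qed.
Fact endo_add_linear (f g : E) : linear (fun u => f u + g u).
Proof. by move=> c u v; rewrite !endo_linear scalerDr addrACA. Qed.
Fact endo_scale_linear (d : F) (f : E) : linear (fun u => d *: f u).
Proof. by move=> c u v; rewrite endo_linear scalerDr !scalerA mulrC. Qed.
Fact endo_opp_linear (f : E) : linear (fun u => - f u).
Proof. by move=> c u v; rewrite endo_linear opprD scalerN. Qed.
Fact endo_one_linear : linear (fun u : V => u).
Proof. by []. Qed.
Fact endo_mul_linear (f g : E) : linear (fun u => f (g u)).
Proof. by move=> c u v; rewrite !endo_linear. Qed.

Definition endo_zero : E := Endo _ endo_zero_linear.
Definition endo_add (f g : E) : E := Endo _ (endo_add_linear f g).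
Definition endo_opp (f : E) : E := Endo _ (endo_opp_linear f).
Definition endo_scale (c : F) (f : E) : E := Endo _ (endo_scale_linear c f).
Definition endo_one : E := Endo _ endo_one_linear.
Definition endo_mul (f g : E) : E := Endo _ (endo_mul_linear f g).

Fact endo_addA : associative endo_add.
Proof. by move=> f g h; apply: endoP => u /=; rewrite addrA. Qed.
Fact endo_addC : commutative endo_add.
Proof. by move=> f g; apply: endoP => u /=; rewrite addrC. Qed.
Fact endo_add0 : left_id endo_zero endo_add.
Proof. by move=> f; apply: endoP => u /=; rewrite add0r. Qed.
Fact endo_addN : left_inverse endo_zero endo_opp endo_add.
Proof. by move=> f; apply: endoP => u /=; rewrite addNr. Qed.
HB.instance Definition _ :=
  GRing.isZmodule.Build E endo_addA endo_addC endo_add0 endo_addN.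

Fact endo_mulA : associative endo_mul.
Proof. by move=> f g h; apply: endoP. Qed.
Fact endo_mul1 : left_id endo_one endo_mul.
Proof. by move=> f; apply: endoP. Qed.
Fact endo_mulr1 : right_id endo_one endo_mul.
Proof. by move=> f; apply: endoP. Qed.
Fact endo_mulDl : left_distributive endo_mul +%R.
Proof. by move=> f g h; apply: endoP. Qed.
Fact endo_mulDr : right_distributive endo_mul +%R.
Proof. by move=> f g h; apply: endoP => u /=; rewrite endoD. Qed.
Fact endo_one_neq0 : endo_one != 0.
Proof. by apply: contra nz => /eqP/(congr1 (fun f : E => f v0))/= ->. Qed.
HB.instance Definition _ := GRing.Zmodule_isNzRing.Build E
  endo_mulA endo_mul1 endo_mulr1 endo_mulDl endo_mulDr endo_one_neq0.

Fact endo_scaleA c d f : endo_scale c (endo_scale d f) = endo_scale (c * d) f.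
Proof. by apply: endoP => u /=; rewrite scalerA. Qed.
Fact endo_scale1 : left_id 1 endo_scale.
Proof. by move=> f; apply: endoP => u /=; rewrite scale1r. Qed.
Fact endo_scaleDr : right_distributive endo_scale +%R.
Proof. by move=> c f g; apply: endoP => u /=; rewrite scalerDr. Qed.
Fact endo_scaleDl f : {morph endo_scale^~ f : c d / c + d}.
Proof. by move=> c d; apply: endoP => u /=; rewrite scalerDl. Qed.
HB.instance Definition _ := GRing.Zmodule_isLmodule.Build F E
  endo_scaleA endo_scale1 endo_scaleDr endo_scaleDl.

Fact endo_scaleAl c (f g : E) : c *: (f * g) = c *: f * g.
Proof. exact: endoP. Qed.
HB.instance Definition _ := GRing.Lmodule_isLalgebra.Build F E endo_scaleAl.
Fact endo_scaleAr c (f g : E) : c *: (f * g) = f * (c *: g).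
Proof. by apply: endoP => u /=; rewrite endoZ. Qed.
HB.instance Definition _ := GRing.Lalgebra_isAlgebra.Build F E endo_scaleAr.

Lemma endoDE (f g : E) u : (f + g) u = f u + g u. Proof. by []. Qed.
Lemma endoNE (f : E) u : (- f) u = - f u. Proof. by []. Qed.
Lemma endo0E u : (0 : E) u = 0. Proof. by []. Qed.
Lemma endo1E u : (1 : E) u = u. Proof. by []. Qed.
Lemma endoME (f g : E) u : (f * g) u = f (g u). Proof. by []. Qed.
Lemma endoZE c (f : E) u : (c *: f) u = c *: f u. Proof. by []. Qed.
Definition endoE := (endoDE, endoNE, endo0E, endo1E, endoME, endoZE).

End Endomorphisms.

(** * The monomial basis of the quantum plane *)
Lemma qcommXX (F : fieldType) (B : algType F) (q : F) (x y : B) (b c : nat) :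
  y * x = q *: (x * y) -> y ^+ b * x ^+ c = q ^+ (b * c) *: (x ^+ c * y ^+ b).
Proof.
move=> yx; have yxc d : y * x ^+ d = q ^+ d *: (x ^+ d * y).
  elim: d => [|d IH]; first by rewrite mulr1 mul1r scale1r.
  rewrite [x ^+ _]exprSr mulrA IH -scalerAl -[x ^+ d * y * x]mulrA yx.
  by rewrite -scalerAr scalerA -[q ^+ d * q]exprSr mulrA.
elim: b => [|b IH]; first by rewrite mulr1 mul1r scale1r.
rewrite [y ^+ b.+1]exprS -[LHS]mulrA IH -scalerAr [y * (_ * _)]mulrA yxc.
by rewrite -scalerAl scalerA -[_ * y * _]mulrA -exprD addnC.
Qed.

Section Coordinates.
Variables (F : fieldType) (q : F).
Local Notation A := (qspace 2 q).
Local Notation V := (nat -> nat -> F^o).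

Definition x1 : A := qvar q ord0.
Definition x2 : A := qvar q ord_max.
Definition qmon (m n : nat) : A := x1 ^+ m * x2 ^+ n.

Lemma x2x1 : x2 * x1 = q *: (x1 * x2).
Proof. exact: qvarC. Qed.

Lemma qmonM a b c d : qmon a b * qmon c d = q ^+ (b * c) *: qmon (a + c) (b + d).
Proof.
rewrite /qmon [x1 ^+ (a + c)]exprD [x2 ^+ (b + d)]exprD.
rewrite -[LHS]mulrA [x2 ^+ b * (_ * _)]mulrA (qcommXX _ _ x2x1).
by rewrite -scalerAl -scalerAr !mulrA.
Qed.

Lemma qmon00 : qmon 0 0 = 1. Proof. by rewrite /qmon mulr1. Qed.
Lemma qmon10 : qmon 1 0 = x1. Proof. by rewrite /qmon mulr1. Qed.
Lemma qmon01 : qmon 0 1 = x2. Proof. by rewrite /qmon mul1r. Qed.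

Lemma qplane_ind (Q : A -> Prop) :
  Q 1 -> Q x1 -> Q x2 -> (forall c u, Q u -> Q (c *: u)) ->
  (forall u v, Q u -> Q v -> Q (u + v)) ->
  (forall u v, Q u -> Q v -> Q (u * v)) -> forall u, Q u.
Proof.
move=> Q1 Qx Qy QZ QD QM; apply: presented_ind => //.
by case=> -[|[]] // lt; [have -> : Ordinal lt = ord0 by exact: val_inj
 | have -> : Ordinal lt = ord_max by exact: val_inj].
Qed.

(** The span of the monomials is closed under products, hence is everything: a
    linear statement needs to be checked on monomials only. *)
Lemma qmon_ind (Q : A -> Prop) :
  (forall m n, Q (qmon m n)) -> (forall c u, Q u -> Q (c *: u)) ->
  (forall u v, Q u -> Q v -> Q (u + v)) -> forall u, Q u.
Proof.
pose closed (R : A -> Prop) :=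
  (forall c u, R u -> R (c *: u)) /\ (forall u v, R u -> R v -> R (u + v)).
pose span u := forall R, closed R -> (forall m n, R (qmon m n)) -> R u.
move=> Qm QZ QD u; suff /(_ Q) : span u by apply.
move: u; apply: qplane_ind => [R|R|R|c u su R|u v su sv R|u v su sv R] cR Rm.
- by rewrite -qmon00.
- by rewrite -qmon10.
- by rewrite -qmon01.
- by apply: cR.1; exact: su.
- by apply: cR.2; [exact: su | exact: sv].
- apply: (su (fun u => R (u * v))) => [|a b].
    split=> [c w|w w']; first by rewrite -scalerAl; exact: cR.1.
    by rewrite mulrDl; exact: cR.2.
  apply: (sv (fun v => R (qmon a b * v))) => [|c d].
    split=> [c w|w w']; first by rewrite -scalerAr; exact: cR.1.
    by rewrite mulrDr; exact: cR.2.
  by rewrite qmonM; exact: cR.1.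
Qed.

(** The monomials are linearly independent because A acts on arrays of
   coefficients as left multiplication should: applied to the array of 1, the
   monomial x_1^m x_2^n gives the array with a single entry at (m, n). *)
Definition unit_coefs : V := fun m n => ((m == 0%N) && (n == 0%N))%:R.

Lemma unit_coefs_neq0 : unit_coefs != 0.
Proof.
apply/eqP => /(congr1 (fun f : V => f 0%N 0%N)); rewrite /unit_coefs /= => /eqP.
by rewrite oner_eq0.
Qed.

Fact cfunE (c : F) (f g : V) m n : (c *: f + g) m n = c * f m n + g m n.
Proof. by []. Qed.

Fact cfunZ (c : F) (f : V) m n : (c *: f) m n = c * f m n.
Proof. by []. Qed.
Fact cfunD (f g : V) m n : (f + g) m n = f m n + g m n.
Proof. by []. Qed.

Fact shift1_linear :
  linear (fun (f : V) m n => if m is m'.+1 then f m' n else 0 : F^o).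
Proof.
move=> c f g; apply/funext => m; apply/funext => n; rewrite cfunE.
by case: m => [|m]; rewrite ?cfunE // mulr0 addr0.
Qed.
Fact shift2_linear :
  linear (fun (f : V) m n => if n is n'.+1 then q ^+ m * f m n' else 0 : F^o).
Proof.
move=> c f g; apply/funext => m; apply/funext => n; rewrite cfunE.
by case: n => [|n]; rewrite ?mulr0 ?addr0 // cfunE mulrDr mulrCA.
Qed.

Local Notation E := (endo unit_coefs_neq0).

Definition shift_gen (i : 'I_2) : E :=
  if val i == 0%N then Endo _ shift1_linear else Endo _ shift2_linear.

Lemma shift_rels : @qspace_rels F 2 q E shift_gen.
Proof.
move=> [[|[|i]] li] // [[|[|j]] lj] // _; apply: endoP => f; rewrite endoZE !endoME.
apply/funext => m; apply/funext => n; rewrite -[q *: _]addr0 cfunE addr0.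
by case: m n => [|m] [|n] /=; rewrite ?mulr0 // exprS mulrA.
Qed.

Definition shift_rep : {lrmorphism A -> E} :=
  @plift F (qspace_pres 2 q) E shift_gen shift_rels.
Definition qcoef (u : A) (m n : nat) : F := shift_rep u unit_coefs m n.

Lemma shift_repP : (forall u v, shift_rep (u + v) = shift_rep u + shift_rep v) /\
  (forall c u, shift_rep (c *: u) = c *: shift_rep u) /\
  (forall u v, shift_rep (u * v) = shift_rep u * shift_rep v) /\ shift_rep 1 = 1.
Proof.
split; first exact: raddfD.
split; first exact: (linearZZ shift_rep).
split; first exact: rmorphM.
exact: rmorph1.
Qed.
Lemma qcoefD u v m n : qcoef (u + v) m n = qcoef u m n + qcoef v m n.
Proof. by rewrite /qcoef shift_repP.1 endoDE cfunD. Qed.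
Lemma qcoefZ c u m n : qcoef (c *: u) m n = c * qcoef u m n.
Proof. by rewrite /qcoef shift_repP.2.1 endoZE cfunZ. Qed.
Lemma shift_rep1 : shift_rep x1 = Endo _ shift1_linear.
Proof. exact: (@lift_gen F (qspace_pres 2 q) E shift_gen shift_rels ord0). Qed.
Lemma shift_rep2 : shift_rep x2 = Endo _ shift2_linear.
Proof. exact: (@lift_gen F (qspace_pres 2 q) E shift_gen shift_rels ord_max). Qed.
Lemma qcoef0 m n : qcoef 0 m n = 0.
Proof. by rewrite -(scale0r 0) qcoefZ mul0r. Qed.
Lemma qcoefN u m n : qcoef (- u) m n = - qcoef u m n.
Proof. by rewrite -scaleN1r qcoefZ mulN1r. Qed.
Lemma qcoefB u v m n : qcoef (u - v) m n = qcoef u m n - qcoef v m n.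
Proof. by rewrite qcoefD qcoefN. Qed.
Lemma qcoef_x1M u m n : qcoef (x1 * u) m n = if m is m'.+1 then qcoef u m' n else 0.
Proof. by rewrite /qcoef shift_repP.2.2.1 endoME shift_rep1; case: m. Qed.
Lemma qcoef_x2M u m n :
  qcoef (x2 * u) m n = if n is n'.+1 then q ^+ m * qcoef u m n' else 0.
Proof. by rewrite /qcoef shift_repP.2.2.1 endoME shift_rep2; case: n. Qed.
Lemma qcoef1 m n : qcoef 1 m n = ((m == 0%N) && (n == 0%N))%:R.
Proof. by rewrite /qcoef shift_repP.2.2.2 endo1E. Qed.

Lemma qcoef_mon a b m n : qcoef (qmon a b) m n = ((m == a) && (n == b))%:R.
Proof.
elim: a m => [|a IH] m.
  rewrite /qmon mul1r; elim: b m n => [|b IH] m n; first exact: qcoef1.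
  rewrite exprS qcoef_x2M; case: n => [|n]; first by rewrite andbF.
  by rewrite IH; case: m => [|m] //=; rewrite ?mul1r ?mulr0.
rewrite /qmon exprS -mulrA qcoef_x1M; case: m => [|m] //.
Qed.

Lemma qcoef_monM a b v m n : qcoef (qmon a b * v) m n =
  if (a <= m)%N && (b <= n)%N then q ^+ (b * (m - a)) * qcoef v (m - a) (n - b) else 0.
Proof.
elim/qmon_ind: v => [c d|c u IH|u v IHu IHv].
- rewrite qmonM qcoefZ !qcoef_mon.
  case: (boolP ((m == (a + c)%N) && (n == (b + d)%N))) => [/andP[/eqP-> /eqP->]|node_e].
    by rewrite !leq_addr /= !addKn !eqxx !mulr1.
  rewrite mulr0; case: ifP => // /andP[am bn].
  rewrite (_ : _ && _ = false) ?mulr0 //.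
  by apply: contraNF node_e => /andP[/eqP<- /eqP<-]; rewrite !subnKC ?eqxx.
- by rewrite -scalerAr !qcoefZ IH; case: ifP; rewrite ?mulr0 // mulrCA.
- by rewrite mulrDr !qcoefD IHu IHv; case: ifP; rewrite ?addr0 // mulrDr.
Qed.

(** The commutation of x_2^b with x_1^(m - a) is the source of the power of q. *)
Lemma qcoef_mul u v m n : qcoef (u * v) m n =
  \sum_(a < m.+1) \sum_(b < n.+1)
     q ^+ (b * (m - a)) * qcoef u a b * qcoef v (m - a) (n - b).
Proof.
elim/qmon_ind: u => [c d|c u IH|u w IHu IHw].
- rewrite qcoef_monM; case: ifP => [/andP[cm dn]|ncd].
    rewrite (bigD1 (Ordinal (n := m.+1) cm)) //= [X in _ + X]big1 ?addr0; last first.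
      move=> a; rewrite -val_eqE /= => /negbTE ac.
      by rewrite big1 // => b _; rewrite qcoef_mon ac mulr0 mul0r.
    rewrite (bigD1 (Ordinal (n := n.+1) dn)) //= [X in _ + X]big1 ?addr0; last first.
      move=> b; rewrite -val_eqE /= => /negbTE bd.
      by rewrite qcoef_mon bd andbF mulr0 mul0r.
    by rewrite qcoef_mon !eqxx mulr1.
  rewrite big1 // => a _; rewrite big1 // => b _; rewrite qcoef_mon.
  case: (boolP (_ && _)) => [/andP[/eqP ac /eqP bd]|]; last by rewrite mulr0 mul0r.
  by have := ltn_ord a; have := ltn_ord b; lia.
- rewrite -scalerAl qcoefZ IH mulr_sumr; apply: eq_bigr => a _.
  by rewrite mulr_sumr; apply: eq_bigr => b _; rewrite qcoefZ; ring.
- rewrite mulrDl qcoefD IHu IHw -big_split; apply: eq_bigr => a _ /=.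
  by rewrite -big_split; apply: eq_bigr => b _ /=; rewrite qcoefD; ring.
Qed.

Definition supp_le (N : nat) (u : A) :=
  forall m n, (N <= m)%N || (N <= n)%N -> qcoef u m n = 0.

Lemma supp_leW N M u : (N <= M)%N -> supp_le N u -> supp_le M u.
Proof.
move=> NM sN m n /orP[] le; apply: sN; first by rewrite (leq_trans NM le).
by rewrite (leq_trans NM le) orbT.
Qed.

Lemma qmon_expansion u : exists N, supp_le N u /\ forall M, (N <= M)%N ->
  u = \sum_(a < M) \sum_(b < M) qcoef u a b *: qmon a b.
Proof.
elim/qmon_ind: u => [a b|c u [N [sN eN]]|u v [N [sN eN]] [M [sM eM]]].
- exists (maxn a b).+1; split=> [m n|M]; rewrite ?geq_max.
    move=> le; rewrite qcoef_mon (_ : _ && _ = false) //.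
    by apply/negbTE; apply: contraL le => /andP[/eqP-> /eqP->]; lia.
  rewrite gtn_max => /andP[aM bM].
  rewrite (bigD1 (Ordinal aM)) //= [X in _ + X]big1 ?addr0; last first.
    move=> c; rewrite -val_eqE /= => /negbTE ac.
    by rewrite big1 // => d _; rewrite qcoef_mon ac scale0r.
  rewrite (bigD1 (Ordinal bM)) //= [X in _ + X]big1 ?addr0; last first.
    move=> d; rewrite -val_eqE /= => /negbTE bd.
    by rewrite qcoef_mon bd andbF scale0r.
  by rewrite qcoef_mon !eqxx scale1r.
- exists N; split=> [m n /sN e|M /eN e]; first by rewrite qcoefZ e mulr0.
  rewrite {1}e scaler_sumr; apply: eq_bigr => a _.
  by rewrite scaler_sumr; apply: eq_bigr => b _; rewrite qcoefZ scalerA.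
- exists (maxn N M); split=> [m n le|K].
    rewrite qcoefD (supp_leW (leq_maxl N M) sN) // (supp_leW (leq_maxr N M) sM) //.
    exact: addr0.
  rewrite geq_max => /andP[/eN e1 /eM e2].
  rewrite {1}e1 {1}e2 -big_split; apply: eq_bigr => a _ /=.
  by rewrite -big_split; apply: eq_bigr => b _ /=; rewrite qcoefD scalerDl.
Qed.

Lemma qcoef_inj u v : (forall m n, qcoef u m n = qcoef v m n) -> u = v.
Proof.
move=> uv; have [N [_ eN]] := qmon_expansion u; have [M [_ eM]] := qmon_expansion v.
rewrite (eN _ (leq_maxl N M)) (eM _ (leq_maxr N M)).
by apply: eq_bigr => a _; apply: eq_bigr => b _; rewrite uv.
Qed.

(** A linear extension is computed with the coefficients below any bound of the
    support; that the choice of the bound does not matter gives linearity. *)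
Lemma linear_extension (phi : nat -> nat -> A) : exists f : A -> A,
  linear f /\ forall m n, f (qmon m n) = phi m n.
Proof.
pose bnd u := xget 0%N [set N | supp_le N u].
have bndP u : supp_le (bnd u) u.
  by have [N [sN _]] := qmon_expansion u; apply: (@xgetPex _ 0%N [set N | supp_le N u]); exists N.
pose S N u := \sum_(a < N) \sum_(b < N) qcoef u a b *: phi a b.
have SE N M u : supp_le N u -> (N <= M)%N -> S N u = S M u.
  move=> sN NM; rewrite /S.
  have inner a : \sum_(b < N) qcoef u a b *: phi a b = \sum_(b < M) qcoef u a b *: phi a b.
    rewrite (big_ord_widen M (fun b => qcoef u a b *: phi a b) NM) big_mkcond.
    apply: eq_bigr => b _; case: ifP => // /negbT; rewrite -leqNgt => le.
    by rewrite sN ?le ?orbT // scale0r.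
  under eq_bigr do rewrite inner.
  rewrite (big_ord_widen M (fun a => \sum_(b < M) qcoef u a b *: phi a b) NM) big_mkcond.
  apply: eq_bigr => a _; case: ifP => // /negbT; rewrite -leqNgt => le.
  by rewrite big1 // => b _; rewrite sN ?le // scale0r.
have SE' N u : supp_le N u -> S (bnd u) u = S N u.
  move=> sN; rewrite (SE (bnd u) (maxn (bnd u) N)) ?leq_maxl //.
  by rewrite [RHS](SE N (maxn (bnd u) N)) ?leq_maxr.
exists (fun u => S (bnd u) u); split=> [c u v|m n].
  pose N := maxn (bnd (c *: u + v)) (maxn (bnd u) (bnd v)).
  rewrite (SE _ N (c *: u + v)) ?(SE _ N u) ?(SE _ N v) //; rewrite /N; try lia.
  rewrite /S scaler_sumr -big_split; apply: eq_bigr => a _ /=.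
  rewrite scaler_sumr -big_split; apply: eq_bigr => b _ /=.
  by rewrite qcoefD qcoefZ scalerDl scalerA.
rewrite (SE' (maxn m n).+1); last first.
  move=> a b le; rewrite qcoef_mon (_ : _ && _ = false) //.
  by apply/negbTE; apply: contraL le => /andP[/eqP-> /eqP->]; lia.
have mM : (m < (maxn m n).+1)%N by lia.
have nM : (n < (maxn m n).+1)%N by lia.
rewrite /S (bigD1 (Ordinal mM)) //= [X in _ + X]big1 ?addr0; last first.
  move=> c; rewrite -val_eqE /= => /negbTE ac.
  by rewrite big1 // => d _; rewrite qcoef_mon ac scale0r.
rewrite (bigD1 (Ordinal nM)) //= [X in _ + X]big1 ?addr0; last first.
  move=> d; rewrite -val_eqE /= => /negbTE bd.
  by rewrite qcoef_mon bd andbF scale0r.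
by rewrite qcoef_mon !eqxx scale1r.
Qed.

End Coordinates.

(** * Automorphisms of the quantum plane *)
Section Automorphisms.
Variables (F : fieldType) (q : F).
Hypotheses (q0 : q != 0) (q1 : q != 1) (q2 : q ^+ 2 != 1).
Local Notation A := (qspace 2 q).
Local Notation x1 := (x1 q).
Local Notation x2 := (x2 q).
Local Notation qmon := (qmon q).

(** The monomials are ordered by total degree, ties being broken by the
    exponent of x_1. *)
Definition leading (u : A) (m n : nat) := qcoef u m n != 0 /\
  forall a b, qcoef u a b != 0 -> (a + b < m + n)%N || (a + b == m + n)%N && (a <= m)%N.

Lemma leading_ex (u : A) : u != 0 -> exists m n, leading u m n.
Proof.
move=> u0; have [N [sN eN]] := qmon_expansion u.
have [m [n c0]] : exists m n, qcoef u m n != 0.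
  apply: contrapT => nex; case/eqP: u0; apply: qcoef_inj => m n; rewrite qcoef0.
  by apply: contrapT => /eqP c0; apply: nex; exists m, n.
have bnd a b : qcoef u a b != 0 -> (a < N)%N /\ (b < N)%N.
  move=> c; split; rewrite ltnNge; apply: contra c => le; rewrite sN ?le ?orbT //.
have [mN nN] := bnd _ _ c0.
pose w (p : 'I_N * 'I_N) := ((p.1 + p.2) * N + p.1)%N.
have c0' : qcoef u (Ordinal mN, Ordinal nN).1 (Ordinal mN, Ordinal nN).2 != 0 by [].
have [p cp mx] := @arg_maxnP _ (Ordinal mN, Ordinal nN)
  (fun p : 'I_N * 'I_N => qcoef u p.1 p.2 != 0) w c0'.
exists p.1, p.2; split=> // a b cab; have [aN bN] := bnd _ _ cab.
have := mx (Ordinal aN, Ordinal bN) cab; rewrite /w /=.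
have := ltn_ord p.1; move: (p.1 : nat) (p.2 : nat) => r s rN le.
have [lt|gt|eq] := ltngtP (a + b)%N (r + s)%N => //=; last by move: le; rewrite eq leq_add2l.
have : ((r + s).+1 * N <= (a + b) * N)%N by rewrite leq_mul2r gt orbT.
by rewrite mulSn; move: ((a + b) * N)%N ((r + s) * N)%N le rN => *; lia.
Qed.

Lemma leading_uniq (u : A) m n a b : leading u m n -> leading u a b -> m = a /\ n = b.
Proof. by move=> [cu lu] [cu' lu']; have := lu _ _ cu'; have := lu' _ _ cu; lia. Qed.

(** Only one term of the convolution survives at the sum of the leading
    exponents, and its power of q is invertible. *)
Lemma leading_mul (u v : A) m n a b : leading u m n -> leading v a b ->
  leading (u * v) (m + a) (n + b).
Proof.
move=> [cu lu] [cv lv]; split.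
  have mM : (m < (m + a).+1)%N by lia.
  have nM : (n < (n + b).+1)%N by lia.
  rewrite qcoef_mul (bigD1 (Ordinal mM)) //= [X in _ + X]big1 ?addr0; last first.
    move=> c; rewrite -val_eqE /= => /eqP cm; rewrite big1 // => d _.
    apply: contrapT => /eqP; rewrite !mulf_eq0 !negb_or => /andP[/andP[_ /lu h]] /lv.
    by have := ltn_ord c; have := ltn_ord d; lia.
  rewrite (bigD1 (Ordinal nM)) //= [X in _ + X]big1 ?addr0; last first.
    move=> d; rewrite -val_eqE /= => /eqP dn.
    apply: contrapT => /eqP; rewrite !mulf_eq0 !negb_or => /andP[/andP[_ /lu h]] /lv.
    by have := ltn_ord d; lia.
  by rewrite !addKn !mulf_neq0 // expf_neq0.
move=> c d; rewrite qcoef_mul => /eqP node_e.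
have [i [j /eqP]] : exists (i : 'I_c.+1) (j : 'I_d.+1),
    q ^+ (j * (c - i)) * qcoef u i j * qcoef v (c - i) (d - j) <> 0.
  apply: contrapT => nex; apply: node_e; rewrite big1 // => i _; rewrite big1 // => j _.
  by apply: contrapT => h; apply: nex; exists i, j.
rewrite !mulf_eq0 !negb_or => /andP[/andP[_ /lu h]] /lv.
by have := ltn_ord i; have := ltn_ord j; lia.
Qed.

Lemma leading_mon a b : leading (qmon a b) a b.
Proof.
split=> [|c d]; first by rewrite qcoef_mon !eqxx oner_eq0.
rewrite qcoef_mon; case: (boolP (_ && _)) => [/andP[/eqP-> /eqP->] _|]; first by lia.
by rewrite eqxx.
Qed.

(** On the edges of the quadrant the convolution involves no power of q, since
    A / (x_2) and A / (x_1) are commutative. *)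
Lemma commutator_edge (u v : A) m n : (m == 0)%N || (n == 0)%N ->
  qcoef (u * v) m n = qcoef (v * u) m n.
Proof.
case/orP => /eqP->; rewrite !qcoef_mul.
  rewrite !big_ord1 (reindex_inj rev_ord_inj) /=; apply: eq_bigr => i _.
  have lei : (i <= n)%N by rewrite -ltnS.
  by rewrite !muln0 subSS subKn // !mul1r mulrC.
rewrite [LHS](reindex_inj rev_ord_inj) /=; apply: eq_bigr => i _.
have lei : (i <= m)%N by rewrite -ltnS.
by rewrite !big_ord1 !mul0n subSS subKn // !mul1r mulrC.
Qed.

(** With commutator_edge, this says that commutators lie in the ideal of
    x_1 x_2. *)
Lemma interior_factor (w : A) :
  (forall m n, (m == 0)%N || (n == 0)%N -> qcoef w m n = 0) ->
  exists v, w = x1 * v * x2.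
Proof.
move=> h; have [N [sN eN]] := qmon_expansion w.
exists (\sum_(a < N) \sum_(b < N) qcoef w a.+1 b.+1 *: qmon a b).
rewrite {1}(eN N.+1) // big_ord_recl big1 ?add0r; last first.
  by move=> b _; rewrite h ?scale0r.
rewrite mulr_sumr mulr_suml; apply: eq_bigr => a _.
rewrite big_ord_recl h ?orbT // scale0r add0r mulr_sumr mulr_suml.
apply: eq_bigr => b _; rewrite -scalerAr -scalerAl; congr (_ *: _).
by rewrite /qmon mulrA -exprS -mulrA -exprSr.
Qed.

(** The inverse image of x_1 x_2 is a multiple of a commutator, hence of the form
    x_1 v x_2, so that X V Y = x_1 x_2 for the images X, Y of x_1, x_2 and the
    image V of v. Neither X nor Y is constant, so comparison of total degrees
    leaves X and Y of degree one; then Y X = q X Y is a system of equations for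
    six coefficients. *)
Lemma aut_diagonal (psi : A -> A) :
  linear psi -> psi 1 = 1 -> {morph psi : u v / u * v} -> bijective psi ->
  exists a b, [/\ a != 0, b != 0, psi x1 = a *: x1 & psi x2 = b *: x2].
Proof.
move=> lin p1 pM bij.
have inj := bij_inj bij; have [phi phiK psiK] := bij.
have pD u v : psi (u + v) = psi u + psi v by have := lin 1 u v; rewrite !scale1r.
have p0 : psi 0 = 0 by apply: (addrI (psi 0)); rewrite -pD !addr0.
have pZ c u : psi (c *: u) = c *: psi u by have := lin c u 0; rewrite !addr0 p0 addr0.
have phM u v : phi (u * v) = phi u * phi v by apply: inj; rewrite pM !psiK.
have phZ c u : phi (c *: u) = c *: phi u by apply: inj; rewrite pZ !psiK.
set X := psi x1; set Y := psi x2.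
have YX : Y * X = q *: (X * Y) by rewrite /X /Y -!pM -pZ x2x1.
have [v wv] : exists v, phi (x1 * x2) = x1 * v * x2.
  apply: interior_factor => m n e.
  have := commutator_edge (phi x2) (phi x1) e.
  rewrite -!phM x2x1 phZ qcoefZ => /eqP; rewrite -subr_eq0 -{2}[qcoef _ m n]mul1r -mulrBl.
  by rewrite mulf_eq0 subr_eq0 (negbTE q1) => /eqP.
have XVY : X * psi v * Y = qmon 1 1 by rewrite -!pM -wv psiK.
have nz (u w : A) : qmon 1 1 = u * w -> u != 0 /\ w != 0.
  move=> e; split; apply/eqP => z; have := qcoef_mon q 1 1 1 1;
    rewrite e z ?mul0r ?mulr0 qcoef0 /= => /esym/eqP; by rewrite oner_eq0.
have [XV0 Y0] := nz _ _ (esym XVY).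
have X0 : X != 0 by apply: contra XV0 => /eqP->; rewrite mul0r.
have V0 : psi v != 0 by apply: contra XV0 => /eqP->; rewrite mulr0.
have [mx [nx lX]] := leading_ex X0; have [my [ny lY]] := leading_ex Y0.
have [mv [nv lV]] := leading_ex V0.
have := leading_mul (leading_mul lX lV) lY; rewrite XVY => /(leading_uniq (leading_mon 1 1)) [e1 e2].
(* If psi u were constant, injectivity would make u constant too. *)
have noncst u m n c d : leading (psi u) m n -> u = qmon c d -> (c + d)%N = 1%N -> (m + n > 0)%N.
  move=> [_ lu] ue cd; rewrite lt0n; apply/eqP => mn0.
  have uc : psi u = psi (qcoef (psi u) 0 0 *: 1).
    rewrite pZ p1; apply: qcoef_inj => a b; rewrite qcoefZ qcoef1.
    case: (boolP (_ && _)) => [/andP[/eqP-> /eqP->]|ab]; first by rewrite mulr1.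
    rewrite mulr0; apply: contrapT => /eqP/lu; move: ab mn0; lia.
  have := congr1 (fun z => qcoef z c d) (inj _ _ uc).
  rewrite ue qcoef_mon !eqxx /= qcoefZ qcoef1 (_ : _ && _ = false) ?mulr0.
    by move=> /= /eqP; rewrite oner_eq0.
  by move: cd; case: c {ue} => [|c]; case: d => [|d].
have degX := noncst _ _ _ 1%N 0%N lX (esym (qmon10 q)) erefl.
have degY := noncst _ _ _ 0%N 1%N lY (esym (qmon01 q)) erefl.
have smallX m n : (m + n > 1)%N -> qcoef X m n = 0.
  by move=> mn; apply: contrapT => /eqP/lX.2; lia.
have smallY m n : (m + n > 1)%N -> qcoef Y m n = 0.
  by move=> mn; apply: contrapT => /eqP/lY.2; lia.
pose lin3 (u : A) : A := qcoef u 0 0 *: 1 + qcoef u 1 0 *: x1 + qcoef u 0 1 *: x2.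
have lin3E u : (forall m n, (m + n > 1)%N -> qcoef u m n = 0) -> u = lin3 u.
  move=> su; apply: qcoef_inj => m n; rewrite /lin3 !qcoefD !qcoefZ qcoef1 -qmon10 -qmon01 !qcoef_mon.
  by case: m n => [|[|m]] [|[|n]] /=; rewrite ?mulr0 ?mulr1 ?addr0 ?add0r // su //; lia.
have eX := lin3E _ smallX; have eY := lin3E _ smallY.
(* From here on X = a x_1 + b x_2 + c and Y = a' x_1 + b' x_2 + c'. *)
have cmp m n : qcoef (Y * X) m n = q * qcoef (X * Y) m n by rewrite YX qcoefZ.
have := (cmp 2 0, cmp 0 2, cmp 1 1, cmp 0 0, cmp 1 0, cmp 0 1)%N.
rewrite !qcoef_mul !big_ord_recr !big_ord0 /= !(smallX 2 0)%N // !(smallY 2 0)%N //.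
rewrite !(smallX 0 2)%N // !(smallY 0 2)%N // !(smallX 1 1)%N // !(smallY 1 1)%N //.
have nzX : (qcoef X 1 0 != 0) || (qcoef X 0 1 != 0).
  have : (mx = 1 /\ nx = 0 \/ mx = 0 /\ nx = 1)%N by move: e1 e2 degX degY; clear; lia.
  by have := lX.1; move=> h [] [<- <-]; rewrite h ?orbT.
have nzY : (qcoef Y 1 0 != 0) || (qcoef Y 0 1 != 0).
  have : (my = 1 /\ ny = 0 \/ my = 0 /\ ny = 1)%N by move: e1 e2 degX degY; clear; lia.
  by have := lY.1; move=> h [] [<- <-]; rewrite h ?orbT.
move: eX eY nzX nzY; rewrite /lin3.
move: (qcoef X 0 0) (qcoef X 1 0) (qcoef X 0 1) (qcoef Y 0 0) (qcoef Y 1 0) (qcoef Y 0 1) => c a b c' a' b'.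
rewrite ?(subn0, muln0, mul0n, subnn, muln1, mulr0, mul0r, add0r, addr0, mul1r, expr1, expr0).
move=> eX eY nzX nzY [[[[[aa bb] ab] cc] ca] cb].
have q1' : 1 - q != 0 by rewrite subr_eq0 eq_sym.
have q2' : 1 - q ^+ 2 != 0 by rewrite subr_eq0 eq_sym.
have cancel (r x : F) : r != 0 -> r * x = 0 -> x = 0.
  by move=> r0 /eqP; rewrite mulf_eq0 (negbTE r0) => /eqP.
have {}aa : a' * a = 0 by apply: (cancel _ _ q1'); rewrite mulrBl {1}aa; ring.
have {}bb : b' * b = 0 by apply: (cancel _ _ q1'); rewrite mulrBl {1}bb; ring.
have {}ab : a' * b = 0.
  apply: (cancel _ _ q2').
  have -> : (1 - q ^+ 2) * (a' * b) = q * b' * a + a' * b - q * (q * b * a' + a * b') by ring.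
  by rewrite ab subrr.
have {}ca : c' * a + a' * c = 0.
  apply: (cancel _ _ q1').
  have -> : (1 - q) * (c' * a + a' * c) = c' * a + a' * c - q * (c * a' + a * c') by ring.
  by rewrite ca subrr.
have {}cb : c' * b + b' * c = 0.
  apply: (cancel _ _ q1').
  have -> : (1 - q) * (c' * b + b' * c) = c' * b + b' * c - q * (c * b' + b * c') by ring.
  by rewrite cb subrr.
have mul0 (x y : F) : x * y = 0 -> y != 0 -> x = 0.
  by move=> /eqP; rewrite mulf_eq0 => /orP[/eqP//|/eqP->]; rewrite eqxx.
have [a0|a0] := eqVneq a 0.
  have b0 : b != 0 by move: nzX; rewrite a0 eqxx.
  by move: nzY; rewrite (mul0 _ _ bb b0) (mul0 _ _ ab b0) eqxx.
have za := mul0 _ _ aa a0; have b'0 : b' != 0 by move: nzY; rewrite za eqxx.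
have zb : b = 0 by apply: (mul0 _ b'); rewrite // mulrC.
have zc' : c' = 0 by apply: (mul0 _ a); rewrite // -ca za mul0r addr0.
have zc : c = 0 by apply: (mul0 _ b'); rewrite // mulrC -cb zb mulr0 add0r.
exists a, b'; split=> //.
  by rewrite eX zb zc !scale0r add0r addr0.
by rewrite eY za zc' !scale0r !add0r.
Qed.

End Automorphisms.

(** * Module algebra structures over the quantum group *)
Section ModuleAlgebras.
Variables (F : fieldType) (m : nat) (q : F) (q0 : q != 0) (A : algType F).
Local Notation U := (Uq m q).
Local Notation D := (uq_comul m q0).
Local Notation sym := (module_algebra (uq_comul m q0) (uq_counit m q) A).

Section Values.
Variable pi : sym.

Lemma actD h a b : pi h (a + b) = pi h a + pi h b.
Proof. by have := act_linear pi h 1 a b; rewrite !scale1r. Qed.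
Lemma act0 h : pi h 0 = 0.
Proof. by apply: (addrI (pi h 0)); rewrite -actD !addr0. Qed.
Lemma actZ h c a : pi h (c *: a) = c *: pi h a.
Proof. by have := act_linear pi h c a 0; rewrite !addr0 act0 addr0. Qed.
Lemma actDl h k a : pi (h + k) a = pi h a + pi k a.
Proof. by have := act_linearl pi a 1 h k; rewrite !scale1r. Qed.
Lemma act0l a : pi 0 a = 0.
Proof. by apply: (addrI (pi 0 a)); rewrite -actDl !addr0. Qed.
Lemma actZl c h a : pi (c *: h) a = c *: pi h a.
Proof. by have := act_linearl pi a c h 0; rewrite !addr0 act0l addr0. Qed.
Lemma actBl h k a : pi (h - k) a = pi h a - pi k a.
Proof. by rewrite actDl -scaleN1r actZl scaleN1r. Qed.

Lemma act_eM i a b : pi (uq_e q i) (a * b) =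
  a * pi (uq_e q i) b + pi (uq_e q i) a * pi (uq_k q i) b.
Proof.
rewrite (@act_comul _ _ _ _ _ pi _ [:: (1, uq_e q i); (uq_e q i, uq_k q i)]).
  by rewrite !big_cons big_nil addr0 /= act1.
rewrite !big_cons big_nil addr0 /=; exact: lift_gen.
Qed.
Lemma act_fM i a b : pi (uq_f q i) (a * b) =
  pi (uq_kinv q i) a * pi (uq_f q i) b + pi (uq_f q i) a * b.
Proof.
rewrite (@act_comul _ _ _ _ _ pi _ [:: (uq_kinv q i, uq_f q i); (uq_f q i, 1)]).
  by rewrite !big_cons big_nil addr0 /= act1.
rewrite !big_cons big_nil addr0 /=; exact: lift_gen.
Qed.
Lemma act_kM i a b : pi (uq_k q i) (a * b) = pi (uq_k q i) a * pi (uq_k q i) b.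
Proof.
rewrite (@act_comul _ _ _ _ _ pi _ [:: (uq_k q i, uq_k q i)]); first by rewrite big_seq1.
by rewrite big_seq1; exact: lift_gen.
Qed.
Lemma act_e1 i : pi (uq_e q i) 1 = 0.
Proof. by rewrite act_counit [uq_counit _ _ _]lift_gen scale0r. Qed.
Lemma act_f1 i : pi (uq_f q i) 1 = 0.
Proof. by rewrite act_counit [uq_counit _ _ _]lift_gen scale0r. Qed.
Lemma act_k1 i : pi (uq_k q i) 1 = 1.
Proof. by rewrite act_counit [uq_counit _ _ _]lift_gen scale1r. Qed.
Lemma act_kK i : cancel (pi (uq_k q i)) (pi (uq_kinv q i)).
Proof. by move=> a; rewrite -actM (uq_KinvK (Uq_rels m q)) act1. Qed.
Lemma act_kinvK i : cancel (pi (uq_kinv q i)) (pi (uq_k q i)).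
Proof. by move=> a; rewrite -actM (uq_KKinv (Uq_rels m q)) act1. Qed.

Lemma act_ke i j a : pi (uq_k q i) (pi (uq_e q j) a) =
  q ^ cartan i j *: pi (uq_e q j) (pi (uq_k q i) a).
Proof.
by rewrite -{1}[a](act_kK i) -actZl -(uq_KE (Uq_rels m q)) !actM.
Qed.
Lemma act_kf i j a : pi (uq_k q i) (pi (uq_f q j) a) =
  q ^ (- cartan i j) *: pi (uq_f q j) (pi (uq_k q i) a).
Proof.
by rewrite -{1}[a](act_kK i) -actZl -(uq_KF (Uq_rels m q)) !actM.
Qed.
Lemma act_ef i j a :
  pi (uq_e q i) (pi (uq_f q j) a) - pi (uq_f q j) (pi (uq_e q i) a) =
  if i == j then (q - q^-1)^-1 *: (pi (uq_k q i) a - pi (uq_kinv q i) a) else 0.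
Proof.
rewrite -!actM -actBl (uq_EF (Uq_rels m q)).
by case: ifP => _; rewrite ?act0l // actZl actBl.
Qed.

End Values.

(** The action of k_i^-1 is the inverse of that of k_i, hence is determined by
    it. *)
Lemma sym_ext (pi pi' : sym) :
  (forall i a, [/\ pi (uq_e q i) a = pi' (uq_e q i) a,
    pi (uq_f q i) a = pi' (uq_f q i) a & pi (uq_k q i) a = pi' (uq_k q i) a]) ->
  pi =2 pi'.
Proof.
move=> ag h; elim/presented_ind: h => [a|[i|i|i|i] a|c u IH a|u v IHu IHv a|u v IHu IHv a].
- by rewrite !act1.
- by have [] := ag i a.
- by have [] := ag i a.
- by have [] := ag i a.
- rewrite -[a in LHS](act_kinvK pi' i).
  have [_ _ <-] := ag i (pi' (uq_kinv q i) a); exact: act_kK.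
- by rewrite !actZl IH.
- by rewrite !actDl IHu IHv.
- by rewrite !actM IHv IHu.
Qed.

Section Construction.
Local Notation E := (endo (oner_neq0 A)).
Variable g : uq_gen m -> E.
Hypothesis gr : uq_rels q g.
Hypothesis gE : forall i a b,
  g (Egen i) (a * b) = a * g (Egen i) b + g (Egen i) a * g (Kgen i) b.
Hypothesis gF : forall i a b,
  g (Fgen i) (a * b) = g (Kinvgen i) a * g (Fgen i) b + g (Fgen i) a * b.
Hypothesis gK : forall i a b, g (Kgen i) (a * b) = g (Kgen i) a * g (Kgen i) b.
Hypothesis gK1 : forall i, g (Kgen i) 1 = 1.

Let rep : {lrmorphism U -> E} := @plift F (uq_pres m q) E g gr.

Let repP : (forall u v, rep (u + v) = rep u + rep v) /\
  (forall c u, rep (c *: u) = c *: rep u) /\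
  (forall u v, rep (u * v) = rep u * rep v) /\ rep 1 = 1.
Proof.
split; first exact: raddfD.
split; first exact: (linearZZ rep).
split; first exact: rmorphM.
exact: rmorph1.
Qed.
Let rep_gen x : rep (gen x) = g x.
Proof. exact: lift_gen. Qed.
Let repM u v a : rep (u * v) a = rep u (rep v a).
Proof. by rewrite repP.2.2.1. Qed.

Let gKK i a : g (Kgen i) (g (Kinvgen i) a) = a.
Proof. by rewrite -endoME (uq_KKinv gr). Qed.
Let gKK' i a : g (Kinvgen i) (g (Kgen i) a) = a.
Proof. by rewrite -endoME (uq_KinvK gr). Qed.
Let gK' i a b : g (Kinvgen i) (a * b) = g (Kinvgen i) a * g (Kinvgen i) b.
Proof. by rewrite -{1}[a](gKK i) -{1}[b](gKK i) -gK gKK'. Qed.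
Let gK1' i : g (Kinvgen i) 1 = 1.
Proof. by have := gKK' i 1; rewrite gK1. Qed.
Let gE1 i : g (Egen i) 1 = 0.
Proof.
have := gE i 1 1; rewrite !mulr1 mul1r gK1 mulr1 => e.
by apply: (addrI (g (Egen i) 1)); rewrite addr0 -e.
Qed.
Let gF1 i : g (Fgen i) 1 = 0.
Proof.
have := gF i 1 1; rewrite !mulr1 gK1' mul1r => e.
by apply: (addrI (g (Fgen i) 1)); rewrite addr0 -e.
Qed.

(** The product rule for h is the statement that h acts on a b through the
   bilinear map (h', h'') -> h'(a) h''(b) evaluated at the comultiplication; in
   this form it is multiplicative in h, and needs to be checked on
   generators. *)
Let bil a b (h k : U) : A := rep h a * rep k b.
Let bilP a b : bilinear_map (bil a b).
Proof.
split=> [k c x y|h c x y]; rewrite /bil repP.1 repP.2.1 endoDE endoZE.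
  by rewrite mulrDl scalerAl.
by rewrite mulrDr scalerAr.
Qed.

Let DP : (forall u v, D (u + v) = tadd (D u) (D v)) /\
  (forall c u, D (c *: u) = tscale c (D u)) /\
  (forall u v, D (u * v) = tmul (D u) (D v)) /\ D 1 = tens 1 1.
Proof.
split; first exact: raddfD.
split; first exact: (linearZZ D).
split; first exact: rmorphM.
exact: rmorph1.
Qed.

Let rep_comul h : forall a b, rep h (a * b) = tlift (bil a b) (D h).
Proof.
elim/presented_ind: h => [a b|x a b|c u IH a b|u v IHu IHv a b|u v IHu IHv a b].
- rewrite DP.2.2.2 (tlift_tens (bilP a b)).
  by rewrite /bil repP.2.2.2.
- rewrite rep_gen [D _]lift_gen; case: x => i /=.
  + rewrite (tliftD (bilP a b)) !(tlift_tens (bilP a b)) /bil repP.2.2.2.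
    by rewrite !rep_gen gE.
  + rewrite (tliftD (bilP a b)) !(tlift_tens (bilP a b)) /bil repP.2.2.2.
    by rewrite !rep_gen gF.
  + by rewrite (tlift_tens (bilP a b)) /bil !rep_gen gK.
  + by rewrite (tlift_tens (bilP a b)) /bil !rep_gen gK'.
- by rewrite DP.2.1 repP.2.1 endoZE IH (tliftZ (bilP a b)).
- by rewrite DP.1 repP.1 endoDE IHu IHv (tliftD (bilP a b)).
- rewrite DP.2.2.1 (tliftMr (bilP a b)) repM IHv {1}/tlift /tsum.
  elim: (repr _) => [|p s IHs]; first by rewrite !big_nil endo0.
  rewrite !big_cons endoD IHs; congr (_ + _).
  rewrite {1}/bil IHu /tlift /tsum; apply: eq_bigr => r _.
  by rewrite /bil !repM.
Qed.

(** Operators that satisfy the defining relations and act on products as the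
    comultiplication prescribes give a module algebra structure. *)
Lemma construct_sym : exists pi : sym, forall i a,
  [/\ pi (uq_e q i) a = g (Egen i) a, pi (uq_f q i) a = g (Fgen i) a &
      pi (uq_k q i) a = g (Kgen i) a].
Proof.
have rcounit h : rep h 1 = uq_counit m q h *: 1.
  elim/presented_ind: h => [|x|c u IH|u v IHu IHv|u v IHu IHv].
  - by rewrite repP.2.2.2 [uq_counit m q 1]rmorph1 scale1r.
  - rewrite rep_gen [uq_counit _ _ _]lift_gen; case: x => i /=.
    + by rewrite scale0r.
    + by rewrite scale0r.
    + by rewrite scale1r.
    + by rewrite scale1r.
  - by rewrite [uq_counit m q _]linearZ repP.2.1 endoZE IH scalerA.
  - by rewrite [uq_counit m q _]raddfD repP.1 endoDE IHu IHv scalerDl.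
  - by rewrite [uq_counit m q _]rmorphM repM IHv endoZ IHu scalerA mulrC.
have rcomul h (s : seq (U * U)) : D h = \sum_(p <- s) tens p.1 p.2 ->
    forall a b, rep h (a * b) = \sum_(p <- s) rep p.1 a * rep p.2 b.
  move=> Dh a b; rewrite rep_comul Dh; elim: s {Dh} => [|p s IH].
    by rewrite !big_nil (tlift0 (bilP a b)).
  by rewrite !big_cons (tliftD (bilP a b)) IH (tlift_tens (bilP a b)).
have rl h : linear (rep h) by exact: endo_linear.
have rll a : linear (fun h => rep h a).
  by move=> c h k; rewrite repP.1 repP.2.1 endoDE endoZE.
have r1 a : rep 1 a = a by rewrite repP.2.2.2.
exists (ModuleAlgebra rl rll r1 repM rcomul rcounit) => i a /=.
by rewrite !rep_gen.
Qed.

End Construction.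

Lemma transport_sym (pi : sym) (psi phi : A -> A) :
  linear psi -> psi 1 = 1 -> {morph psi : u v / u * v} ->
  cancel psi phi -> cancel phi psi ->
  exists pi' : sym, forall h a, pi' h a = psi (pi h (phi a)).
Proof.
move=> lin p1 pM K K'; have inj := can_inj K.
have pD u v : psi (u + v) = psi u + psi v by have := lin 1 u v; rewrite !scale1r.
have p0 : psi 0 = 0 by apply: (addrI (psi 0)); rewrite -pD !addr0.
have pZ c u : psi (c *: u) = c *: psi u by have := lin c u 0; rewrite !addr0 p0 addr0.
have phM u v : phi (u * v) = phi u * phi v by apply: inj; rewrite pM !K'.
have phl c u v : phi (c *: u + v) = c *: phi u + phi v by apply: inj; rewrite lin !K'.
have ph1 : phi 1 = 1 by rewrite -{1}p1 K.
pose act h a := psi (pi h (phi a)).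
have al h : linear (act h) by move=> c u v; rewrite /act phl actD actZ lin.
have all a : linear (act^~ a) by move=> c u v; rewrite /act actDl actZl lin.
have a1 a : act 1 a = a by rewrite /act act1 K'.
have aM h k a : act (h * k) a = act h (act k a) by rewrite /act actM K.
have ac h (s : seq (U * U)) : D h = \sum_(p <- s) tens p.1 p.2 ->
    forall a b, act h (a * b) = \sum_(p <- s) act p.1 a * act p.2 b.
  move=> Dh a b; rewrite /act phM (act_comul pi Dh).
  elim: s {Dh} => [|p s IH]; first by rewrite !big_nil.
  by rewrite !big_cons pD IH pM.
have aeps h : act h 1 = uq_counit m q h *: 1 by rewrite /act ph1 act_counit pZ p1.
by exists (ModuleAlgebra al all a1 aM ac aeps).
Qed.

End ModuleAlgebras.

(** * The four ways in which a node can act *)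
Section Nodes.
Variables (F : fieldType) (q : F).
Hypotheses (q0 : q != 0) (q2 : q ^+ 2 != 1).
Local Notation A := (qspace 2 q).
Local Notation x1 := (x1 q).
Local Notation x2 := (x2 q).
Local Notation qmon := (qmon q).
Local Notation E := (endo (oner_neq0 A)).

(** The q-integer [m]. *)
Definition qint (m : nat) : F := (q ^+ m - (q ^+ m)^-1) / (q - q^-1).

(** The action of one triple e, f, k. NSign: e = f = 0 and k changes signs.
    NLin: the two-dimensional representation on the span of x_1 and x_2. NDer1:
    e is a q-derivative in x_1 and f is quadratic. NDer2: f is a q-derivative in
    x_2 and e is quadratic. A kind is a pair of such actions. *)
Inductive node := NSign of bool & bool | NDer1 | NDer2 | NLin.

(** The eigenvalue of k on x_1^m x_2^n; node_e and node_f are the values of e and f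
    on that monomial. *)
Definition node_k (t : node) (m n : nat) : F :=
  match t with
  | NSign s1 s2 => ((-1) ^+ s1) ^+ m * ((-1) ^+ s2) ^+ n
  | NDer1 => ((q ^+ m) ^+ 2 * q ^+ n)^-1
  | NDer2 => q ^+ m * (q ^+ n) ^+ 2
  | NLin => q ^+ m / q ^+ n
  end.

Definition node_e (t : node) (m n : nat) : A :=
  match t with
  | NSign _ _ => 0
  | NDer1 => (q / q ^+ (m + n) * qint m) *: qmon m.-1 n
  | NDer2 => - (q ^+ (m + n) * qint (m + n)) *: qmon m n.+1
  | NLin => qint n *: qmon m.+1 n.-1
  end.

Definition node_f (t : node) (m n : nat) : A :=
  match t with
  | NSign _ _ => 0
  | NDer1 => - (q ^+ (m + n) * qint (m + n)) *: qmon m.+1 n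
  | NDer2 => (q / q ^+ (m + n) * qint n) *: qmon m n.-1
  | NLin => qint m *: qmon m.-1 n.+1
  end.

Definition lin_ext (phi : nat -> nat -> A) : E :=
  Endo (oner_neq0 A) (projT2 (cid (linear_extension phi))).1.

Lemma lin_extE phi m n : lin_ext phi (qmon m n) = phi m n.
Proof. exact: (projT2 (cid (linear_extension phi))).2. Qed.

Lemma endo_mon_ext (f g : E) : (forall m n, f (qmon m n) = g (qmon m n)) -> f = g.
Proof.
move=> fg; apply: endoP; apply: qmon_ind => // [c u e|u v eu ev].
  by rewrite !endoZ e.
by rewrite !endoD eu ev.
Qed.

Definition op_e t : E := lin_ext (node_e t).
Definition op_f t : E := lin_ext (node_f t).
Definition op_k t : E := lin_ext (fun m n => node_k t m n *: qmon m n).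
Definition op_kinv t : E := lin_ext (fun m n => (node_k t m n)^-1 *: qmon m n).

Lemma op_eE t m n : op_e t (qmon m n) = node_e t m n. Proof. exact: lin_extE. Qed.
Lemma op_fE t m n : op_f t (qmon m n) = node_f t m n. Proof. exact: lin_extE. Qed.
Lemma op_kE t m n : op_k t (qmon m n) = node_k t m n *: qmon m n.
Proof. exact: lin_extE. Qed.
Lemma op_kinvE t m n : op_kinv t (qmon m n) = (node_k t m n)^-1 *: qmon m n.
Proof. exact: lin_extE. Qed.

Lemma node_k_neq0 t m n : node_k t m n != 0.
Proof.
have qm k : q ^+ k != 0 by exact: expf_neq0.
case: t => [s1 s2|||] /=.
- by rewrite mulf_neq0 // expf_neq0 // signr_eq0.
- by rewrite invr_neq0 // mulf_neq0 // expf_neq0.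
- by rewrite mulf_neq0 // expf_neq0.
- by rewrite mulf_neq0 // invr_neq0.
Qed.

Lemma qint0 : qint 0 = 0. Proof. by rewrite /qint invr1 subrr mul0r. Qed.

Lemma sqr_sub1_neq0 : q ^+ 2 - 1 != 0. Proof. by rewrite subr_eq0. Qed.

Lemma inv_qdenom : (q - q^-1)^-1 = q / (q ^+ 2 - 1).
Proof. have h := sqr_sub1_neq0; field; rewrite h q0 //. Qed.

(** The relations of U_q(sl_3) that involve one simple root, and those that
    involve two, as identities between operators; the relations
    k e k^-1 = q^a e are multiplied by k on the right, so that no inverse
    is left. *)
Definition sl2_ok t :=
  [/\ op_k t * op_e t = q ^+ 2 *: (op_e t * op_k t),
      op_k t * op_f t = q ^- 2 *: (op_f t * op_k t) &
      op_e t * op_f t - op_f t * op_e t = (q - q^-1)^-1 *: (op_k t - op_kinv t)].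

Definition sl3_ok t t' :=
  [/\ op_k t * op_e t' = q^-1 *: (op_e t' * op_k t),
      op_k t * op_f t' = q *: (op_f t' * op_k t),
      op_e t * op_f t' = op_f t' * op_e t,
      qserre q (op_e t) (op_e t') = 0 &
      qserre q (op_f t) (op_f t') = 0].

Lemma scale_eq0 (c : F) (u : A) : c = 0 -> c *: u = 0.
Proof. by move=> ->; rewrite scale0r. Qed.
Lemma scale_eq (c d : F) (u : A) : c = d -> c *: u = d *: u.
Proof. by move=> ->. Qed.
Lemma scale_0eq (c : F) (u : A) : c = 0 -> 0 = c *: u.
Proof. by move=> ->; rewrite scale0r. Qed.
Lemma mul_sub1_neq0 : q * q - 1 != 0. Proof. by rewrite -expr2 sqr_sub1_neq0. Qed.

Lemma op_e_sign s1 s2 c m n : op_e (NSign s1 s2) (c *: qmon m n) = 0.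
Proof. by rewrite endoZ op_eE scaler0. Qed.
Lemma op_e_der1 c m n : op_e NDer1 (c *: qmon m n) =
  (c * (q / q ^+ (m + n) * qint m)) *: qmon m.-1 n.
Proof. by rewrite endoZ op_eE /= scalerA. Qed.
Lemma op_e_der2 c m n : op_e NDer2 (c *: qmon m n) =
  (c * - (q ^+ (m + n) * qint (m + n))) *: qmon m n.+1.
Proof. by rewrite endoZ op_eE /= scalerA. Qed.
Lemma op_e_lin c m n : op_e NLin (c *: qmon m n) = (c * qint n) *: qmon m.+1 n.-1.
Proof. by rewrite endoZ op_eE /= scalerA. Qed.
Lemma op_f_sign s1 s2 c m n : op_f (NSign s1 s2) (c *: qmon m n) = 0.
Proof. by rewrite endoZ op_fE scaler0. Qed.
Lemma op_f_der1 c m n : op_f NDer1 (c *: qmon m n) =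
  (c * - (q ^+ (m + n) * qint (m + n))) *: qmon m.+1 n.
Proof. by rewrite endoZ op_fE /= scalerA. Qed.
Lemma op_f_der2 c m n : op_f NDer2 (c *: qmon m n) =
  (c * (q / q ^+ (m + n) * qint n)) *: qmon m n.-1.
Proof. by rewrite endoZ op_fE /= scalerA. Qed.
Lemma op_f_lin c m n : op_f NLin (c *: qmon m n) = (c * qint m) *: qmon m.-1 n.+1.
Proof. by rewrite endoZ op_fE /= scalerA. Qed.
Lemma op_k_scaled t c m n : op_k t (c *: qmon m n) = (c * node_k t m n) *: qmon m n.
Proof. by rewrite endoZ op_kE scalerA. Qed.
Lemma op_kinv_scaled t c m n :
  op_kinv t (c *: qmon m n) = (c / node_k t m n) *: qmon m n.
Proof. by rewrite endoZ op_kinvE scalerA. Qed.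

Lemma scaled_qmonM c d m n a b : (c *: qmon m n) * (d *: qmon a b) =
  (c * d * q ^+ (n * a)) *: qmon (m + a) (n + b).
Proof. by rewrite -scalerAl -scalerAr qmonM !scalerA. Qed.

Definition opsE := (op_e_sign, op_e_der1, op_e_der2, op_e_lin, op_f_sign, op_f_der1,
  op_f_der2, op_f_lin, op_k_scaled, op_kinv_scaled).

(** Writing every vector as a scalar multiple of a monomial lets the rules
    opsE compute any composite of the operators without leaving this form. *)
Lemma endo_scaled_ext (f g : E) :
  (forall m n, f (1 *: qmon m n) = g (1 *: qmon m n)) -> f = g.
Proof. by move=> h; apply: endo_mon_ext => m n; have := h m n; rewrite !scale1r. Qed.

Lemma endo_serre_ext (f g : E) :
  (forall m n, f (f (g (1 *: qmon m n))) + g (f (f (1 *: qmon m n))) =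
    (q + q^-1) *: f (g (f (1 *: qmon m n)))) -> qserre q f g = 0.
Proof.
move=> h; apply: endo_mon_ext => m n; rewrite /qserre !expr2 !endoE.
by have := h m n; rewrite !scale1r addrAC => ->; rewrite subrr.
Qed.

(* An identity between multiples of one monomial becomes an identity between
   rational functions of q and of the powers of q by the exponents. The
   boundary exponents are split off before, because a lowering operator has
   the exponent m.-1: its coefficient [0] = 0 makes the truncation harmless,
   but only m = m'.+1 gives a polynomial identity. *)
Ltac collect :=
  rewrite ?(addnS, addSn, addn0, add0n, mulnS, mulSn, muln0, mul0n);
  rewrite ?(scalerDr, scalerBr, scalerN, scaleNr, opprK, opprD, scalerA);
  rewrite -?scaleNr -?scalerDl;
  first [apply: scale_eq | apply: scale_eq0 | apply: scale_0eq].
Ltac genpow := repeat match goal with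
  |- context [@GRing.exp _ q ?k] =>
     first [is_var k | match k with (_ * _)%N => idtac end];
     have := expf_neq0 k q0; move: (q ^+ k) => ? ?
  end.
Ltac coefficients :=
  rewrite /qint ?inv_qdenom ?(exprD, exprS, expr0, mulr1); have ? := mul_sub1_neq0;
  genpow; field; do ?[apply/andP; split]; first [assumption | exact: oner_neq0].
Ltac crunch :=
  rewrite ?endoE ?opsE /= ?(qint0, mul0r, mulr0, oppr0, scale0r, scaler0, addr0, add0r, subr0, sub0r);
  try done; collect; coefficients.
Ltac crunch_product :=
  rewrite scaled_qmonM ?opsE /= ?scaled_qmonM
    ?(addnS, addSn, addn0, add0n, qint0, mul0r, mulr0, oppr0, scale0r, addr0, add0r);
  try done; collect; coefficients.

Lemma sl2_ok_sign s1 s2 : sl2_ok (NSign s1 s2).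
Proof.
have e0 : op_e (NSign s1 s2) = 0.
  by apply: endo_scaled_ext => m n; rewrite op_e_sign.
have f0 : op_f (NSign s1 s2) = 0.
  by apply: endo_scaled_ext => m n; rewrite op_f_sign.
split; rewrite ?e0 ?f0 ?mulr0 ?mul0r ?scaler0 // subrr.
apply: endo_mon_ext => m n; rewrite !endoE op_kE op_kinvE /=.
have sgn (s : bool) k : (((-1) ^+ s) ^+ k)^-1 = ((-1) ^+ s) ^+ k :> F.
  by rewrite -exprVn invr_sign.
by rewrite invfM !sgn subrr scaler0.
Qed.

Lemma sl2_ok_der1 : sl2_ok NDer1.
Proof.
split; apply: endo_scaled_ext => m n.
- by case: m => [|m]; crunch.
- crunch.
- by case: m => [|m]; crunch.
Qed.

Lemma sl2_ok_der2 : sl2_ok NDer2.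
Proof.
split; apply: endo_scaled_ext => m n.
- crunch.
- by case: n => [|n]; crunch.
- by case: n => [|n]; crunch.
Qed.

Lemma sl2_ok_lin : sl2_ok NLin.
Proof.
split; apply: endo_scaled_ext => m n.
- by case: n => [|n]; crunch.
- by case: m => [|m]; crunch.
- by case: m n => [|m] [|n]; crunch.
Qed.

Lemma sl3_ok_sign s1 s2 s1' s2' : sl3_ok (NSign s1 s2) (NSign s1' s2').
Proof.
have e0 s t : op_e (NSign s t) = 0.
  by apply: endo_scaled_ext => m n; rewrite op_e_sign.
have f0 s t : op_f (NSign s t) = 0.
  by apply: endo_scaled_ext => m n; rewrite op_f_sign.
by split; rewrite /qserre ?e0 ?f0 ?expr2 ?(mulr0, mul0r, scaler0, subr0, addr0).
Qed.

Lemma sl3_ok_der1_lin : sl3_ok NDer1 NLin.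
Proof.
split.
- apply: endo_scaled_ext => m n; case: n => [|n]; crunch.
- apply: endo_scaled_ext => m n; case: m => [|m]; crunch.
- apply: endo_scaled_ext => m n; case: m => [|[|m]]; crunch.
- apply: endo_serre_ext => m n; case: m n => [|[|m]] [|n]; crunch.
- apply: endo_serre_ext => m n; case: m => [|m]; crunch.
Qed.

Lemma sl3_ok_lin_der1 : sl3_ok NLin NDer1.
Proof.
split.
- apply: endo_scaled_ext => m n; case: m => [|m]; crunch.
- apply: endo_scaled_ext => m n; crunch.
- apply: endo_scaled_ext => m n; case: n => [|n]; crunch.
- apply: endo_serre_ext => m n; case: m n => [|m] [|[|n]]; crunch.
- apply: endo_serre_ext => m n; case: m => [|[|m]]; crunch.
Qed.

Lemma sl3_ok_der2_lin : sl3_ok NDer2 NLin.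
Proof.
split.
- apply: endo_scaled_ext => m n; case: n => [|n]; crunch.
- apply: endo_scaled_ext => m n; case: m => [|m]; crunch.
- apply: endo_scaled_ext => m n; case: m => [|m]; crunch.
- apply: endo_serre_ext => m n; case: n => [|n]; crunch.
- apply: endo_serre_ext => m n; case: m n => [|m] [|[|n]]; crunch.
Qed.

Lemma sl3_ok_lin_der2 : sl3_ok NLin NDer2.
Proof.
split.
- apply: endo_scaled_ext => m n; crunch.
- apply: endo_scaled_ext => m n; case: n => [|n]; crunch.
- apply: endo_scaled_ext => m n; case: n => [|[|n]]; crunch.
- apply: endo_serre_ext => m n; case: n => [|[|n]]; crunch.
- apply: endo_serre_ext => m n; case: m n => [|[|m]] [|n]; crunch.
Qed.

Lemma sl3_ok_der1_der2 : sl3_ok NDer1 NDer2.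
Proof.
split.
- apply: endo_scaled_ext => m n; crunch.
- apply: endo_scaled_ext => m n; case: n => [|n]; crunch.
- apply: endo_scaled_ext => m n; case: m n => [|m] [|n]; crunch.
- apply: endo_serre_ext => m n; case: m => [|[|m]]; crunch.
- apply: endo_serre_ext => m n; case: n => [|n]; crunch.
Qed.

Lemma sl3_ok_der2_der1 : sl3_ok NDer2 NDer1.
Proof.
split.
- apply: endo_scaled_ext => m n; case: m => [|m]; crunch.
- apply: endo_scaled_ext => m n; crunch.
- apply: endo_scaled_ext => m n; crunch.
- apply: endo_serre_ext => m n; case: m => [|m]; crunch.
- apply: endo_serre_ext => m n; case: n => [|[|n]]; crunch.
Qed.

Lemma qmon_ind2 (B : A -> A -> A) (C : A -> A -> A) :
  (forall c u v w, B (c *: u + v) w = c *: B u w + B v w) ->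
  (forall c u v w, B u (c *: v + w) = c *: B u v + B u w) ->
  (forall c u v w, C (c *: u + v) w = c *: C u w + C v w) ->
  (forall c u v w, C u (c *: v + w) = c *: C u v + C u w) ->
  (forall a b c d, B (qmon a b) (qmon c d) = C (qmon a b) (qmon c d)) ->
  forall u v, B u v = C u v.
Proof.
move=> Bl Br Cl Cr BC.
have lin0 (f : A -> A) : (forall c u v, f (c *: u + v) = c *: f u + f v) -> f 0 = 0.
  by move=> fl; have := fl 1 0 0; rewrite !scale1r addr0 => e; apply: (addrI (f 0)); rewrite addr0 -e.
have ext (f g : A -> A) : (forall c u v, f (c *: u + v) = c *: f u + f v) ->
    (forall c u v, g (c *: u + v) = c *: g u + g v) ->
    (forall m n, f (qmon m n) = g (qmon m n)) -> forall u, f u = g u.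
  move=> fl gl fg; apply: qmon_ind => // [c u e|u v eu ev].
    by have := fl c u 0; have := gl c u 0; rewrite !addr0 (lin0 f) // (lin0 g) // !addr0 e => -> ->.
  by have := fl 1 u v; have := gl 1 u v; rewrite !scale1r eu ev => -> ->.
move=> u v; apply: (ext (B^~ v) (C^~ v)) => [? ? ?|? ? ?|a b]; rewrite ?Bl ?Cl //.
by apply: (ext (B (qmon a b)) (C (qmon a b))) => [? ? ?|? ? ?|c d]; rewrite ?Br ?Cr.
Qed.

Lemma skew_mon (f g h : E) :
  (forall a b c d, f (qmon a b * qmon c d) =
     g (qmon a b) * f (qmon c d) + f (qmon a b) * h (qmon c d)) ->
  forall u v, f (u * v) = g u * f v + f u * h v.
Proof.
move=> H; apply: qmon_ind2 => // c u v w; rewrite ?endo_linear.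
- by rewrite mulrDl -scalerAl endo_linear.
- by rewrite mulrDr -scalerAr endo_linear.
- by rewrite !mulrDl -!scalerAl scalerDr addrACA.
- by rewrite !mulrDr -!scalerAr scalerDr addrACA.
Qed.

(** Unlike e and f, the operator k is multiplicative because its eigenvalue is a
    character of the group of exponents. *)
Lemma op_k_mul (t : node) : forall u v, op_k t (u * v) = op_k t u * op_k t v.
Proof.
apply: qmon_ind2 => [c u v w|c u v w|c u v w|c u v w|a b c d]; rewrite ?endo_linear.
- by rewrite mulrDl -scalerAl endo_linear.
- by rewrite mulrDr -scalerAr endo_linear.
- by rewrite mulrDl -scalerAl.
- by rewrite mulrDr -scalerAr.
rewrite !op_kE qmonM endoZ op_kE -scalerAr -scalerAl qmonM !scalerA; congr (_ *: _).
rewrite mulrC; congr (_ * _).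
have qm k : q ^+ k != 0 by exact: expf_neq0.
case: t => [s1 s2|||] /=; rewrite ?exprD; first by ring.
- by field; rewrite !qm.
- by ring.
- by field; rewrite !qm.
Qed.

(** The two skew product rules hold on monomials by a rational identity, where
    only the power of q from the reordering involves a product of exponents. *)
Lemma op_e_mul (t : node) u v :
  op_e t (u * v) = u * op_e t v + op_e t u * op_k t v.
Proof.
apply: (@skew_mon (op_e t) (1 : E) (op_k t)) => a b c d; rewrite endo1E.
rewrite -[qmon a b]scale1r -[qmon c d]scale1r; case: t => [s1 s2|||].
- by rewrite scaled_qmonM !op_e_sign mulr0 mul0r addr0.
- by case: a c => [|a] [|c]; crunch_product.
- crunch_product.
- by case: b d => [|b] [|d]; crunch_product.
Qed.

Lemma op_f_mul (t : node) u v :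
  op_f t (u * v) = op_kinv t u * op_f t v + op_f t u * v.
Proof.
apply: (@skew_mon (op_f t) (op_kinv t) (1 : E)) => a b c d; rewrite endo1E.
rewrite -[qmon a b]scale1r -[qmon c d]scale1r; case: t => [s1 s2|||].
- by rewrite scaled_qmonM !op_f_sign mulr0 mul0r addr0.
- crunch_product.
- by case: b d => [|b] [|d]; crunch_product.
- by case: a c => [|a] [|c]; crunch_product.
Qed.

Lemma op_k_kinv t : op_k t * op_kinv t = 1.
Proof.
apply: endo_mon_ext => m n.
by rewrite endoME op_kinvE endoZ op_kE scalerA mulVf ?scale1r ?node_k_neq0.
Qed.
Lemma op_kinv_k t : op_kinv t * op_k t = 1.
Proof.
apply: endo_mon_ext => m n.
by rewrite endoME op_kE endoZ op_kinvE scalerA divff ?scale1r ?node_k_neq0.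
Qed.
Lemma op_kC t t' : op_k t * op_k t' = op_k t' * op_k t.
Proof.
apply: endo_mon_ext => m n.
by rewrite !endoME !op_kE !endoZ !op_kE !scalerA mulrC.
Qed.

Lemma ord2_neq (i j k : 'I_2) : i != j -> (k == j) = (k != i).
Proof. by case: i j k => [[|[|?]] ?] [[|[|?]] ?] [[|[|?]] ?]. Qed.

Lemma cartan2 (i j : 'I_2) : cartan i j = if i == j then 2 else -1.
Proof. by case: i j => [[|[|?]] ?] [[|[|?]] ?]. Qed.

Variable nd : 'I_2 -> node.
Hypothesis nd_self : forall i, sl2_ok (nd i).
Hypothesis nd_cross : forall i j, i != j -> sl3_ok (nd i) (nd j).

Definition node_gen (x : uq_gen 2) : E :=
  match x with
  | Egen i => op_e (nd i)
  | Fgen i => op_f (nd i)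
  | Kgen i => op_k (nd i)
  | Kinvgen i => op_kinv (nd i)
  end.

Lemma node_rels : uq_rels q node_gen.
Proof.
split=> /= [i|i|i j|i j|i j|i j|i j|i j|i j|i j]; rewrite ?cartan2.
- exact: op_k_kinv.
- exact: op_kinv_k.
- exact: op_kC.
- case: eqVneq => [<-|/nd_cross[e _ _ _ _]].
    have [e _ _] := nd_self i.
    by rewrite e -scalerAl -mulrA op_k_kinv mulr1.
  by rewrite e -scalerAl -mulrA op_k_kinv mulr1.
- case: eqVneq => [<-|/nd_cross[_ e _ _ _]].
    have [_ e _] := nd_self i.
    by rewrite e -scalerAl -mulrA op_k_kinv mulr1.
  by rewrite e -scalerAl -mulrA op_k_kinv mulr1.
- case: eqVneq => [<-|/nd_cross[_ _ e _ _]]; first by have [] := nd_self i.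
  by rewrite e subrr.
- by case: ifP.
- by case: ifP.
- by case: eqVneq => // /nd_cross[].
- by case: eqVneq => // /nd_cross[].
Qed.

(** Two nodes whose actions satisfy sl2_ok and sl3_ok form a symmetry. *)
Lemma node_symmetry :
  exists pi : module_algebra (uq_comul 2 q0) (uq_counit 2 q) A, forall i a,
  [/\ pi (uq_e q i) a = op_e (nd i) a, pi (uq_f q i) a = op_f (nd i) a &
      pi (uq_k q i) a = op_k (nd i) a].
Proof.
apply: (construct_sym q0 node_rels) => [i|i|i|i].
- exact: op_e_mul.
- exact: op_f_mul.
- exact: op_k_mul.
- rewrite -[node_gen _]/(op_k (nd i)).
  have := op_kE (nd i) 0 0; rewrite qmon00 => ->; rewrite /node_k; case: (nd i) => [s1 s2|||];
  by rewrite ?expr1n ?mulr1 ?invr1 ?expr0 ?scale1r ?mul1r ?invr1 ?scale1r.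
Qed.

End Nodes.

(** * The structures of each kind *)
Section PlaneExtensionality.
Variables (F : fieldType) (m : nat) (q : F) (q0 : q != 0).
Local Notation A := (qspace 2 q).
Local Notation sym := (module_algebra (uq_comul m q0) (uq_counit m q) A).

Lemma sym_plane_ext (pi pi' : sym) :
  (forall i (x : A), x = x1 q \/ x = x2 q ->
    [/\ pi (uq_e q i) x = pi' (uq_e q i) x,
    pi (uq_f q i) x = pi' (uq_f q i) x & pi (uq_k q i) x = pi' (uq_k q i) x]) ->
  pi =2 pi'.
Proof.
move=> ag; apply: sym_ext => i a.
have ag1 := ag i _ (or_introl erefl); have ag2 := ag i _ (or_intror erefl).
have kk b : pi (uq_k q i) b = pi' (uq_k q i) b.
  elim/qplane_ind: b => [|||c u e|u v eu ev|u v eu ev].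
  - by rewrite !act_k1.
  - by case: ag1.
  - by case: ag2.
  - by rewrite !actZ e.
  - by rewrite !actD eu ev.
  - by rewrite !act_kM eu ev.
have kk' b : pi (uq_kinv q i) b = pi' (uq_kinv q i) b.
  by rewrite -{1}[b](act_kinvK pi' i) -kk act_kK.
split=> //.
- elim/qplane_ind: a => [|||c u e|u v eu ev|u v eu ev].
  - by rewrite !act_e1.
  - by case: ag1.
  - by case: ag2.
  - by rewrite !actZ e.
  - by rewrite !actD eu ev.
  - by rewrite !act_eM eu ev kk.
- elim/qplane_ind: a => [|||c u e|u v eu ev|u v eu ev].
  - by rewrite !act_f1.
  - by case: ag1.
  - by case: ag2.
  - by rewrite !actZ e.
  - by rewrite !actD eu ev.
  - by rewrite !act_fM eu ev kk'.
Qed.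
End PlaneExtensionality.

Section Kinds.
Variables (F : fieldType) (q : qparam F).
Local Notation A := (qspace 2 q).
Local Notation x1 := (x1 q).
Local Notation x2 := (x2 q).
Let q0 : qval q != 0 := qval_neq0 q.
Let q2 : qval q ^+ 2 != 1.
Proof. exact: qval_not_root. Qed.

Definition kind_nodes (c : kind) : node * node :=
  match c with
  | Kind1 si1 si2 sj1 sj2 => (NSign si1 si2, NSign sj1 sj2)
  | Kind2 => (NDer1, NLin)
  | Kind3 => (NDer2, NLin)
  | Kind4 => (NDer1, NDer2)
  end.

Definition node_at (pi : uq_symmetry 2 2 q) (k : 'I_2) (t : node) :=
  [/\ pi (uq_k q k) x1 = node_k q t 1 0 *: x1, pi (uq_k q k) x2 = node_k q t 0 1 *: x2,
      pi (uq_e q k) x1 = node_e q t 1 0 /\ pi (uq_e q k) x2 = node_e q t 0 1 &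
      pi (uq_f q k) x1 = node_f q t 1 0 /\ pi (uq_f q k) x2 = node_f q t 0 1].

Lemma qint1 : qint (qval q) 1 = 1.
Proof.
rewrite /qint expr1 divff //.
have -> : qval q - (qval q)^-1 = (qval q ^+ 2 - 1) / qval q by field.
by rewrite mulf_neq0 ?invr_neq0 // sqr_sub1_neq0.
Qed.

Lemma qmon20 : qmon (qval q) 2 0 = x1 ^+ 2. Proof. by rewrite /qmon mulr1. Qed.
Lemma qmon02 : qmon (qval q) 0 2 = x2 ^+ 2. Proof. by rewrite /qmon mul1r. Qed.
Lemma qmon11 : qmon (qval q) 1 1 = x1 * x2. Proof. by rewrite /qmon !expr1. Qed.

(** Each kind prescribes, node by node, the values on x_1 and x_2 of one of the
    four actions. *)
Lemma of_kindE (c : kind) (i j : 'I_2) (pi : uq_symmetry 2 2 q) :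
  of_kind c i j pi <-> node_at pi i (kind_nodes c).1 /\ node_at pi j (kind_nodes c).2.
Proof.
have E := (addn0, add0n, qint0, qint1, mulr0, mulr1, mul1r, expr0, expr1, oppr0, scale0r,
  scale1r, qmon00, qmon10, qmon01, qmon20, qmon02, qmon11, invr1, divff q0, expr1n).
rewrite /node_at /of_kind.
case: c => [si1 si2 sj1 sj2|||] /=; rewrite ?E; split.
- by move=> [[? ? ? ?] [? ? ? ?] [? ? ? ?]].
- by move=> [[? ? [? ?] [? ?]] [? ? [? ?] [? ?]]].
- by move=> [[? ? ? ?] [? ? ? ?] [? ? ? ?]].
- by move=> [[? ? [? ?] [? ?]] [? ? [? ?] [? ?]]].
- by move=> [[? ? ? ?] [? ? ? ?] [? ? ? ?]].
- by move=> [[? ? [? ?] [? ?]] [? ? [? ?] [? ?]]].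
- by move=> [[? ? ? ?] [? ? ? ?] [? ? ? ?]].
- by move=> [[? ? [? ?] [? ?]] [? ? [? ?] [? ?]]].
Qed.

Lemma kind_unique (c : kind) (i j : 'I_2) (pi pi' : uq_symmetry 2 2 q) :
  i != j -> of_kind c i j pi -> of_kind c i j pi' -> pi =2 pi'.
Proof.
move=> ij /of_kindE[ni nj] /of_kindE[ni' nj']; apply: sym_plane_ext => k x.
have nd : exists t, node_at pi k t /\ node_at pi' k t.
  have [->|ki] := eqVneq k i; first by exists (kind_nodes c).1.
  have -> : k = j by apply/eqP; rewrite (ord2_neq k ij).
  by exists (kind_nodes c).2.
have [t [[k1 k2 [e1 e2] [f1 f2]] [k1' k2' [e1' e2'] [f1' f2']]]] := nd.
by case=> ->; rewrite ?(k1, k2, e1, e2, f1, f2, k1', k2', e1', e2', f1', f2').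
Qed.

Lemma kind_exists (c : kind) (i j : 'I_2) : i != j ->
  exists pi : uq_symmetry 2 2 q, of_kind c i j pi /\
    forall k a, let t := if k == i then (kind_nodes c).1 else (kind_nodes c).2 in
    [/\ pi (uq_e q k) a = op_e q t a, pi (uq_f q k) a = op_f q t a &
        pi (uq_k q k) a = op_k q t a].
Proof.
move=> ij; pose nd k := if k == i then (kind_nodes c).1 else (kind_nodes c).2.
have self k : sl2_ok q (nd k).
  rewrite /nd; case: ifP => _; case: c {nd} => [? ? ? ?|||] /=;
  first [exact: sl2_ok_sign|exact: sl2_ok_der1|exact: sl2_ok_der2|exact: sl2_ok_lin].
have cross k l : k != l -> sl3_ok q (nd k) (nd l).
  move=> kl; rewrite /nd; have [ki|ki] := eqVneq k i.
    rewrite -ki eq_sym (negbTE kl); case: c {nd self} => [? ? ? ?|||] /=.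
    - exact: sl3_ok_sign.
    - exact: sl3_ok_der1_lin.
    - exact: sl3_ok_der2_lin.
    - exact: sl3_ok_der1_der2.
  have -> : l == i by move: ki kl ij {nd self}; case: i j k l => [[|[|?]] ?] [[|[|?]] ?] [[|[|?]] ?] [[|[|?]] ?].
  case: c {nd self} => [? ? ? ?|||] /=.
  - exact: sl3_ok_sign.
  - exact: sl3_ok_lin_der1.
  - exact: sl3_ok_lin_der2.
  - exact: sl3_ok_der2_der1.
have [pi piE] := node_symmetry q0 q2 self cross.
exists pi; split=> //; apply/of_kindE.
have at_ k : node_at pi k (nd k).
  rewrite /node_at -qmon10 -qmon01; have p a := piE k a.
  split.
  - by have [_ _ ->] := p (qmon (qval q) 1 0); rewrite op_kE.
  - by have [_ _ ->] := p (qmon (qval q) 0 1); rewrite op_kE.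
  - by split; [have [-> _ _] := p (qmon (qval q) 1 0) | have [-> _ _] := p (qmon (qval q) 0 1)]; rewrite op_eE.
  - by split; [have [_ -> _] := p (qmon (qval q) 1 0) | have [_ -> _] := p (qmon (qval q) 0 1)]; rewrite op_fE.
split; first by have := at_ i; rewrite /nd eqxx.
by have := at_ j; rewrite /nd eq_sym (negbTE ij).
Qed.

(** By uniqueness, the values on all monomials are those of the constructed
    structure. *)
Lemma kind_mon (c : kind) (i j : 'I_2) (pi : uq_symmetry 2 2 q) :
  i != j -> of_kind c i j pi -> forall k m n,
    let t := if k == i then (kind_nodes c).1 else (kind_nodes c).2 in
    [/\ pi (uq_e q k) (qmon (qval q) m n) = node_e q t m n,
        pi (uq_f q k) (qmon (qval q) m n) = node_f q t m n,
        pi (uq_k q k) (qmon (qval q) m n) = node_k q t m n *: qmon (qval q) m n &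
        pi (uq_kinv q k) (qmon (qval q) m n) = (node_k q t m n)^-1 *: qmon (qval q) m n].
Proof.
move=> ij ofk k m n t; have [pi' [ofk' piE]] := kind_exists c ij.
have e := kind_unique ij ofk ofk'; rewrite !e.
have [-> -> kE] := piE k (qmon (qval q) m n).
rewrite op_eE op_fE kE op_kE; split=> //.
rewrite -{1}[qmon _ m n](scalerK (node_k_neq0 q0 t m n)) -/t.
rewrite -[node_k q t m n *: _](op_kE q t) -kE.
by rewrite actZ act_kK.
Qed.

End Kinds.

(** * Eigenvalues and non-isomorphism *)
Section Weights.
Variables (F : fieldType) (q : qparam F).
Local Notation A := (qspace 2 q).
Local Notation x1 := (x1 (qval q)).
Local Notation x2 := (x2 (qval q)).

Lemma qexp_inj (a b : int) : qval q ^ a = qval q ^ b -> a = b.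
Proof.
have q0 := qval_neq0 q.
have pos (n : nat) : qval q ^ (n.+1%:Z) != 1 by rewrite -exprnP; exact: qval_not_root.
move=> e; have e1 : qval q ^ (a - b) = 1.
  by rewrite expfzDr // -invr_expz e mulfV // expfz_neq0.
apply/eqP; rewrite -subr_eq0; move: e1; case: (a - b) => [[|n]|n] // e1.
  by have := pos n; rewrite e1 eqxx.
by have := pos n; move: e1; rewrite NegzE -invr_expz => /(canRL (@invrK _)); rewrite invr1 => ->; rewrite eqxx.
Qed.

(** The exponents of q in the eigenvalues of k on x_1 and x_2, up to sign; squares
    are taken below so as to ignore the sign. *)
Definition node_weight (t : node) : int * int :=
  match t with NSign _ _ => (0, 0) | NDer1 => (-2, -1) | NDer2 => (1, 2) | NLin => (1, -1) end.

Lemma node_k_sqr t : (node_k (qval q) t 1 0) ^+ 2 = qval q ^ (2 * (node_weight t).1) /\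
  (node_k (qval q) t 0 1) ^+ 2 = qval q ^ (2 * (node_weight t).2).
Proof.
have q0 := qval_neq0 q.
case: t => [s1 s2|||] /=; rewrite ?expr0 ?expr1 ?mulr1 ?mul1r ?expr1n ?invr1 ?mul1r ?mulr1.
- by rewrite -!exprM ![(_ * 2)%N]mulnC !exprM sqrrN !expr1n.
- by split; rewrite ?exprVn -?exprM.
- by split; rewrite ?exprVn -?exprM.
- by split; rewrite ?exprVn -?exprM.
Qed.

(** An isomorphism is an automorphism of A, hence maps x_1 and x_2 to multiples of
    themselves; it intertwines the actions of k, so the eigenvalues agree. *)
Lemma isom_weights (pi pi' : uq_symmetry 2 2 q) k t t' :
  module_algebra_isom pi pi' -> node_at pi k t -> node_at pi' k t' -> node_weight t = node_weight t'.
Proof.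
move=> [psi [bij comm]] [k1 k2 _ _] [k1' k2' _ _].
have [a [b [a0 b0 pa pb]]] : exists a b, [/\ a != 0, b != 0,
    psi x1 = a *: x1 & psi x2 = b *: x2].
  apply: aut_diagonal => //.
  - exact: qval_neq0.
  - by rewrite -[qval q]expr1 qval_not_root.
  - exact: qval_not_root.
  - exact: linearP.
  - exact: rmorph1.
  - exact: rmorphM.
have pZ c u : psi (c *: u) = c *: psi u by exact: (linearZZ psi).
have eig (x : A) al al' c m n : x = qmon (qval q) m n -> c != 0 -> psi x = c *: x ->
    pi (uq_k q k) x = al *: x -> pi' (uq_k q k) x = al' *: x -> al = al'.
  move=> xm c0 px kx kx'; have := comm (uq_k q k) x.
  rewrite kx pZ px actZ kx' !scalerA => /(congr1 (fun u => qcoef u m n)).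
  rewrite !qcoefZ xm qcoef_mon !eqxx !mulr1 mulrC => /eqP.
  by rewrite (inj_eq (mulfI c0)) => /eqP.
have e1 := eig _ _ _ _ _ _ (esym (qmon10 _)) a0 pa k1 k1'.
have e2 := eig _ _ _ _ _ _ (esym (qmon01 _)) b0 pb k2 k2'.
have [s1 s2] := node_k_sqr t; have [s1' s2'] := node_k_sqr t'.
move: s1 s2; rewrite e1 e2 s1' s2' => /qexp_inj h1 /qexp_inj h2.
rewrite [LHS]surjective_pairing [RHS]surjective_pairing; congr pair; lia.
Qed.

Lemma kinds_not_isom (c c' : kind) (i j i' j' : 'I_2) (pi pi' : uq_symmetry 2 2 q) :
  i != j -> i' != j' -> kind_number c != kind_number c' ->
  of_kind c i j pi -> of_kind c' i' j' pi' -> ~ module_algebra_isom pi pi'.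
Proof.
move=> ij ij' cc' /of_kindE[ni nj] /of_kindE[ni' nj'] iso.
have [ii'|ii'] := eqVneq i i'.
  have jj' : j = j' by apply/eqP; rewrite (ord2_neq _ ij') -ii' eq_sym.
  move: ni' nj'; rewrite -ii' -jj' => ni' nj'.
  have := isom_weights iso ni ni'; have := isom_weights iso nj nj'.
  by move: cc'; case: c {ni nj} => [? ? ? ?|||]; case: c' {ni' nj'} => [? ? ? ?|||].
have ij'' : i = j' by apply/eqP; rewrite (ord2_neq _ ij').
have ji : j = i'.
  by apply/eqP; rewrite eq_sym; rewrite (ord2_neq _ ij) eq_sym.
move: ni' nj'; rewrite -ij'' -ji => ni' nj'.
have := isom_weights iso ni nj'; have := isom_weights iso nj ni'.
by move: cc'; case: c {ni nj} => [? ? ? ?|||]; case: c' {ni' nj'} => [? ? ? ?|||].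
Qed.

End Weights.

(** * The action of one node in an arbitrary symmetry *)
Section OneNode.
Variables (F : fieldType) (q : qparam F).
Local Notation A := (qspace 2 q).
Local Notation x1 := (x1 (qval q)).
Local Notation x2 := (x2 (qval q)).
Local Notation qmon := (qmon (qval q)).
Let q0 : qval q != 0 := qval_neq0 q.
Let q2 : qval q ^+ 2 != 1.
Proof. exact: qval_not_root. Qed.
Variable pi : uq_symmetry 2 2 q.

Lemma qcoef_Mx1 (u : A) m n :
  qcoef (u * x1) m n = if m is m'.+1 then qval q ^+ n * qcoef u m' n else 0.
Proof.
elim/qmon_ind: u => [a b|c u e|u v eu ev].
- rewrite -qmon10 qmonM qcoefZ addn1 addn0 muln1 qcoef_mon; case: m => [|m]; first by rewrite mulr0.
  by rewrite qcoef_mon eqSS; case: eqVneq => [|_]; rewrite ?mulr0 //= => _; case: eqVneq => [->|]; rewrite ?mulr0.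
- by rewrite -scalerAl !qcoefZ e; case: m {e} => [|m]; rewrite ?mulr0 // qcoefZ mulrCA.
- by rewrite mulrDl !qcoefD eu ev; case: m {eu ev} => [|m]; rewrite ?addr0 // qcoefD mulrDr.
Qed.

Lemma qcoef_Mx2 (u : A) m n :
  qcoef (u * x2) m n = if n is n'.+1 then qcoef u m n' else 0.
Proof.
elim/qmon_ind: u => [a b|c u e|u v eu ev].
- rewrite -qmon01 qmonM qcoefZ addn1 addn0 muln0 mul1r qcoef_mon; case: n => [|n]; first by rewrite andbF.
  by rewrite qcoef_mon eqSS.
- by rewrite -scalerAl !qcoefZ e; case: n {e} => [|n]; rewrite ?mulr0 // qcoefZ.
- by rewrite mulrDl !qcoefD eu ev; case: n {eu ev} => [|n]; rewrite ?addr0 // qcoefD.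
Qed.

Lemma k_diagonal k : exists al be, [/\ al != 0, be != 0,
  pi (uq_k q k) x1 = al *: x1 & pi (uq_k q k) x2 = be *: x2].
Proof.
apply: aut_diagonal => //.
- by rewrite -[qval q]expr1 qval_not_root.
- exact: act_linear.
- exact: act_k1.
- exact: act_kM.
- by exists (pi (uq_kinv q k)); [exact: act_kK | exact: act_kinvK].
Qed.

Section Weight.
Variables (k : 'I_2) (al be : F).
Hypotheses (k1 : pi (uq_k q k) x1 = al *: x1) (k2 : pi (uq_k q k) x2 = be *: x2).
Hypotheses (al0 : al != 0) (be0 : be != 0).

Lemma act_k_mon m n : pi (uq_k q k) (qmon m n) = (al ^+ m * be ^+ n) *: qmon m n.
Proof.
have p1 : pi (uq_k q k) (x1 ^+ m) = al ^+ m *: x1 ^+ m.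
  elim: m => [|m IH]; first by rewrite act_k1 scale1r.
  by rewrite !exprS act_kM IH k1 -scalerAl -scalerAr scalerA.
have p2 : pi (uq_k q k) (x2 ^+ n) = be ^+ n *: x2 ^+ n.
  elim: n => [|n IH]; first by rewrite act_k1 scale1r.
  by rewrite !exprS act_kM IH k2 -scalerAl -scalerAr scalerA.
by rewrite /qmon act_kM p1 p2 -scalerAl -scalerAr scalerA.
Qed.

Lemma qcoef_k u m n : qcoef (pi (uq_k q k) u) m n = al ^+ m * be ^+ n * qcoef u m n.
Proof.
elim/qmon_ind: u => [a b|c u e|u v eu ev].
- rewrite act_k_mon qcoefZ qcoef_mon; case: (boolP (_ && _)) => [/andP[/eqP-> /eqP->] //|_].
  by rewrite !mulr0.
- by rewrite actZ !qcoefZ e mulrCA.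
- by rewrite actD !qcoefD eu ev mulrDr.
Qed.

(** The eigenvalue w of x under k_k is multiplied by a power of q under e_l, and
    every monomial that occurs in e_l(x) has the resulting eigenvalue. *)
Lemma weight_e l x w m n : pi (uq_k q k) x = w *: x ->
  qcoef (pi (uq_e q l) x) m n != 0 -> al ^+ m * be ^+ n = qval q ^ cartan k l * w.
Proof.
move=> kx cn0; apply: (mulIf cn0); rewrite -qcoef_k act_ke kx actZ scalerA qcoefZ.
by [].
Qed.
Lemma weight_f l x w m n : pi (uq_k q k) x = w *: x ->
  qcoef (pi (uq_f q l) x) m n != 0 -> al ^+ m * be ^+ n = qval q ^ (- cartan k l) * w.
Proof.
move=> kx cn0; apply: (mulIf cn0); rewrite -qcoef_k act_kf kx actZ scalerA qcoefZ.
by [].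
Qed.

Lemma act_kinv_x1 : pi (uq_kinv q k) x1 = al^-1 *: x1.
Proof. by rewrite -{1}[x1](scalerK al0) -k1 actZ act_kK. Qed.
Lemma act_kinv_x2 : pi (uq_kinv q k) x2 = be^-1 *: x2.
Proof. by rewrite -{1}[x2](scalerK be0) -k2 actZ act_kK. Qed.

Let cancel1 (r x : F) : x = r * x -> x != 0 -> r = 1.
Proof. by move=> e x0; apply: (mulIf x0); rewrite mul1r -e. Qed.

(** In e(x_2 x_1) = q e(x_1 x_2) the coefficient of x_2^(n+1) involves e(x_1)
    only, that of x_1^(m+1) involves e(x_2) only. Likewise for f. *)
Lemma edge_e1 n : qcoef (pi (uq_e q k) x1) 0 n != 0 -> be = (qval q)^-1.
Proof.
move=> cn0; have := congr1 (fun u => qcoef (pi (uq_e q k) u) 0 n.+1) (x2x1 (qval q)).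
rewrite /= actZ !act_eM k1 k2 qcoefZ !qcoefD -!scalerAr !qcoefZ
  qcoef_x2M !qcoef_Mx1 qcoef_x1M qcoef_Mx2 /=.
rewrite expr0 mul1r mulr0 addr0 add0r mulrA => /cancel1 /(_ cn0) e.
by apply: (mulfI q0); rewrite e divff.
Qed.
Lemma edge_e2 m : qcoef (pi (uq_e q k) x2) m 0 != 0 -> al = qval q.
Proof.
move=> cn0; have := congr1 (fun u => qcoef (pi (uq_e q k) u) m.+1 0) (x2x1 (qval q)).
rewrite /= actZ !act_eM k1 k2 qcoefZ !qcoefD -!scalerAr !qcoefZ
  qcoef_x2M !qcoef_Mx1 qcoef_x1M qcoef_Mx2 /=.
by rewrite expr0 mul1r mulr0 addr0 add0r => /(mulIf cn0).
Qed.
Lemma edge_f1 n : qcoef (pi (uq_f q k) x1) 0 n != 0 -> be = (qval q)^-1.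
Proof.
move=> cn0; have := congr1 (fun u => qcoef (pi (uq_f q k) u) 0 n.+1) (x2x1 (qval q)).
rewrite /= actZ !act_fM act_kinv_x1 act_kinv_x2 
  qcoefZ !qcoefD -!scalerAl !qcoefZ qcoef_x2M !qcoef_Mx1 qcoef_x1M qcoef_Mx2 /=.
rewrite expr0 mul1r mulr0 addr0 add0r => /(mulIf cn0) e.
by rewrite -[be]invrK e.
Qed.
Lemma edge_f2 m : qcoef (pi (uq_f q k) x2) m 0 != 0 -> al = qval q.
Proof.
move=> cn0; have := congr1 (fun u => qcoef (pi (uq_f q k) u) m.+1 0) (x2x1 (qval q)).
rewrite /= actZ !act_fM act_kinv_x1 act_kinv_x2 
  qcoefZ !qcoefD -!scalerAl !qcoefZ qcoef_x2M !qcoef_Mx1 qcoef_x1M qcoef_Mx2 /=.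
rewrite expr0 mul1r mulr0 addr0 add0r mulrA => /cancel1 /(_ cn0) e.
by apply: (mulIf (invr_neq0 al0)); rewrite e divff.
Qed.

Lemma qcoef_mul00 (u v : A) : qcoef (u * v) 0 0 = qcoef u 0 0 * qcoef v 0 0.
Proof. by rewrite qcoef_mul !big_ord1 mul0n mul1r. Qed.
Lemma qcoef_mul10 (u v : A) : qcoef (u * v) 1 0 =
  qcoef u 1 0 * qcoef v 0 0 + qcoef u 0 0 * qcoef v 1 0.
Proof. by rewrite qcoef_mul !big_ord_recl !big_ord0 /= !mul0n !mul1r !addr0 addrC. Qed.
Lemma qcoef_mul01 (u v : A) : qcoef (u * v) 0 1 =
  qcoef u 0 1 * qcoef v 0 0 + qcoef u 0 0 * qcoef v 0 1.
Proof. by rewrite qcoef_mul !big_ord_recl !big_ord0 /= !muln0 !mul1r !addr0 addrC. Qed.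

(** A skew derivation without constant terms on x_1 and x_2 preserves the ideal
    they generate, and acts on the quotient of this ideal by its square through
    the matrix of its linear coefficients. *)
Lemma linear_part (d s t : A -> A) :
  (forall c u, d (c *: u) = c *: d u) -> (forall u v, d (u + v) = d u + d v) ->
  d 1 = 0 ->
  (forall u v, d (u * v) = s u * d v + d u * t v) ->
  (forall u, qcoef (s u) 0 0 = qcoef u 0 0) -> (forall u, qcoef (t u) 0 0 = qcoef u 0 0) ->
  qcoef (d x1) 0 0 = 0 -> qcoef (d x2) 0 0 = 0 ->
  forall u, [/\ qcoef (d u) 0 0 = 0,
    qcoef (d u) 1 0 = qcoef u 1 0 * qcoef (d x1) 1 0 + qcoef u 0 1 * qcoef (d x2) 1 0 &
    qcoef (d u) 0 1 = qcoef u 1 0 * qcoef (d x1) 0 1 + qcoef u 0 1 * qcoef (d x2) 0 1].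
Proof.
move=> dZ dD d1 dM s0 t0 e1 e2; elim/qplane_ind => [|||c u [z1 z2 z3]|u v [z1 z2 z3] [w1 w2 w3]|u v [z1 z2 z3] [w1 w2 w3]].
- by rewrite d1 !qcoef0 !qcoef1 /= !mul0r !addr0.
- by rewrite e1 -qmon10 !qcoef_mon /= !mul0r !mul1r !addr0.
- by rewrite e2 -qmon01 !qcoef_mon /= !mul0r !mul1r !add0r.
- by rewrite dZ !qcoefZ z1 z2 z3 mulr0; split=> //; ring.
- by rewrite dD !qcoefD z1 z2 z3 w1 w2 w3 addr0; split=> //; ring.
- rewrite dM !qcoefD !qcoef_mul00 !qcoef_mul10 !qcoef_mul01 z1 z2 z3 w1 w2 w3 !s0 !t0.
  by split; ring.
Qed.

Let qcoefk0 u : qcoef (pi (uq_k q k) u) 0 0 = qcoef u 0 0.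
Proof. by rewrite qcoef_k !mul1r. Qed.
Let qcoefki0 u : qcoef (pi (uq_kinv q k) u) 0 0 = qcoef u 0 0.
Proof. by rewrite -{2}[u](act_kinvK pi k) qcoefk0. Qed.

(** When e and f have no constant terms they act on the span of x_1, x_2 modulo
    higher degree; weights kill the diagonal entries of e and f there, and the
    relation e f - f e compares the products of the off-diagonal entries with
    [al] and [be]. *)
Lemma node_linear :
  qcoef (pi (uq_e q k) x1) 0 0 = 0 -> qcoef (pi (uq_e q k) x2) 0 0 = 0 ->
  qcoef (pi (uq_f q k) x1) 0 0 = 0 -> qcoef (pi (uq_f q k) x2) 0 0 = 0 ->
  (al ^+ 2 = 1 /\ be ^+ 2 = 1) \/
  [/\ al = qval q, be = (qval q)^-1 & qcoef (pi (uq_e q k) x2) 1 0 != 0].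
Proof.
move=> a00 b00 c00 d00.
have eL := linear_part (actZ pi (uq_e q k)) (actD pi (uq_e q k)) (act_e1 pi k)
  (act_eM pi k) (fun u => erefl) qcoefk0 a00 b00.
have fL := linear_part (actZ pi (uq_f q k)) (actD pi (uq_f q k)) (act_f1 pi k)
  (act_fM pi k) qcoefki0 (fun u => erefl) c00 d00.
have e10 u := let: And3 _ h _ := eL u in h.
have e01 u := let: And3 _ _ h := eL u in h.
have f10 u := let: And3 _ h _ := fL u in h.
have f01 u := let: And3 _ _ h := fL u in h.
have qi (n : int) (x : F) : x != 0 -> x = qval q ^ n * x -> n = 0.
  move=> x0 e; apply: (@qexp_inj _ q); apply: (mulIf x0).
  by rewrite -e expr0z mul1r.
have ckk : cartan k k = 2 by rewrite /cartan eqxx.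
have a10 : qcoef (pi (uq_e q k) x1) 1 0 = 0.
  apply: contrapT => /eqP /(weight_e k1); rewrite mulr1 expr1 ckk => e.
  by have := qi _ _ al0 e.
have b01 : qcoef (pi (uq_e q k) x2) 0 1 = 0.
  apply: contrapT => /eqP /(weight_e k2); rewrite mul1r expr1 ckk => e.
  by have := qi _ _ be0 e.
have c10 : qcoef (pi (uq_f q k) x1) 1 0 = 0.
  apply: contrapT => /eqP /(weight_f k1); rewrite mulr1 expr1 ckk => e.
  by have := qi _ _ al0 e.
have d01 : qcoef (pi (uq_f q k) x2) 0 1 = 0.
  apply: contrapT => /eqP /(weight_f k2); rewrite mul1r expr1 ckk => e.
  by have := qi _ _ be0 e.
(* A nonzero product here would force al = q and be = q^-1 together with
   be = q^2 al. *)
have ad : qcoef (pi (uq_e q k) x1) 0 1 * qcoef (pi (uq_f q k) x2) 1 0 = 0.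
  apply: contrapT => /eqP; rewrite mulf_eq0 negb_or => /andP[a01 d10].
  have eb := edge_e1 a01; have ea := edge_f2 d10.
  have := weight_e k1 a01; rewrite mul1r expr1 ckk eb ea -exprN1 -[X in _ * X]expr1z.
  by rewrite -expfzDr // => /(@qexp_inj _ q).
have r1 := congr1 (fun u => qcoef u 1 0) (act_ef pi k k x1).
have r2 := congr1 (fun u => qcoef u 0 1) (act_ef pi k k x2).
move: r1 r2; rewrite /= eqxx k1 k2 act_kinv_x1 act_kinv_x2 !(qcoefZ, qcoefB).
rewrite (e10 (pi (uq_f q k) x1)) (f10 (pi (uq_e q k) x1)).
rewrite (e01 (pi (uq_f q k) x2)) (f01 (pi (uq_e q k) x2)) a10 b01 c10 d01 -qmon10 -qmon01 !qcoef_mon /= qmon10 qmon01.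
rewrite ?(mulr0, mul0r, addr0, add0r, mulr1) ad subr0 [qcoef _ 1 0 * qcoef _ 0 1]mulrC ad sub0r => r1 r2.
have dn0 : qval q - (qval q)^-1 != 0.
  have -> : qval q - (qval q)^-1 = (qval q ^+ 2 - 1) / qval q by field.
  by rewrite mulf_neq0 ?invr_neq0 // sqr_sub1_neq0.
have [cb|cb] := eqVneq (qcoef (pi (uq_f q k) x1) 0 1 * qcoef (pi (uq_e q k) x2) 1 0) 0.
  left; have sq (x : F) : x != 0 -> 0 = (qval q - (qval q)^-1)^-1 * (x - x^-1) -> x ^+ 2 = 1.
    move=> x0 /esym/eqP; rewrite mulf_eq0 invr_eq0 (negbTE dn0) /= subr_eq0 => /eqP e.
    by rewrite expr2 {2}e divff.
  split; apply: sq => //; first by rewrite -r1 cb.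
  by rewrite -r2 mulrC cb oppr0.
move: cb; rewrite mulf_eq0 negb_or => /andP[c01 b10]; right; split=> //.
  exact: edge_e2 b10.
exact: edge_f1 c01.
Qed.

End Weight.
End OneNode.

(** * Classification *)
Section Profiles.
Variables (F : fieldType) (q : qparam F).
Local Notation A := (qspace 2 q).
Local Notation x1 := (x1 (qval q)).
Local Notation x2 := (x2 (qval q)).
Local Notation qmon := (qmon (qval q)).
Let q0 : qval q != 0 := qval_neq0 q.
Let q2 : qval q ^+ 2 != 1.
Proof. exact: qval_not_root. Qed.

Definition has_weights (pi : uq_symmetry 2 2 q) k (a b : int) :=
  pi (uq_k q k) x1 = qval q ^ a *: x1 /\ pi (uq_k q k) x2 = qval q ^ b *: x2.

(** PE1, PE2, PF1, PF2: the value of e or f on x_1 or x_2 has a constant term.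
    PLin: no constant term, but x_1 occurs in e(x_2). PSign: the eigenvalues of k
    are signs. *)
Inductive profile := PSign | PE1 | PE2 | PF1 | PF2 | PLin.

Definition profile_weight s : int * int :=
  match s with
  PSign => (0, 0) | PE1 => (-2, -1) | PE2 => (1, -2) | PF1 => (2, -1) | PF2 => (1, 2)
  | PLin => (1, -1) end.

Definition has_profile (pi : uq_symmetry 2 2 q) k s :=
  match s with
  | PSign => exists al be, [/\ pi (uq_k q k) x1 = al *: x1, pi (uq_k q k) x2 = be *: x2,
      al ^+ 2 = 1 & be ^+ 2 = 1]
  | s => has_weights pi k (profile_weight s).1 (profile_weight s).2 /\
    match s with
    | PSign => True
    | PE1 => qcoef (pi (uq_e q k) x1) 0 0 != 0
    | PE2 => qcoef (pi (uq_e q k) x2) 0 0 != 0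
    | PF1 => qcoef (pi (uq_f q k) x1) 0 0 != 0
    | PF2 => qcoef (pi (uq_f q k) x2) 0 0 != 0
    | PLin => qcoef (pi (uq_e q k) x2) 1 0 != 0
    end
  end.

Variable pi : uq_symmetry 2 2 q.

(** A constant term fixes one eigenvalue by the edge lemmas and the other by its
    weight; without constant terms node_linear applies. *)
Lemma profile_ex k : exists s, has_profile pi k s.
Proof.
have [al [be [al0 be0 k1 k2]]] := k_diagonal pi k.
have ckk : cartan k k = 2 by rewrite /cartan eqxx.
have opp (n : int) (x : F) : 1 = qval q ^ n * x -> x = qval q ^ (- n).
  by move=> e; rewrite -invr_expz -[RHS]mulr1 e mulKf // expfz_neq0.
have [a00|a00] := eqVneq (qcoef (pi (uq_e q k) x1) 0 0) 0; last first.
  exists PE1; split=> //; split; last by rewrite k2 (edge_e1 k1 k2 a00).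
  rewrite k1; congr (_ *: _); have := weight_e k1 k2 k1 a00.
  by rewrite mulr1 ckk => /opp.
have [b00|b00] := eqVneq (qcoef (pi (uq_e q k) x2) 0 0) 0; last first.
  exists PE2; split=> //; split; first by rewrite k1 (edge_e2 k1 k2 b00).
  rewrite k2; congr (_ *: _); have := weight_e k1 k2 k2 b00.
  by rewrite mulr1 ckk => /opp.
have [c00|c00] := eqVneq (qcoef (pi (uq_f q k) x1) 0 0) 0; last first.
  exists PF1; split=> //; split; last by rewrite k2 (edge_f1 k1 k2 al0 be0 c00).
  rewrite k1; congr (_ *: _); have := weight_f k1 k2 k1 c00.
  by rewrite mulr1 ckk => /opp.
have [d00|d00] := eqVneq (qcoef (pi (uq_f q k) x2) 0 0) 0; last first.
  exists PF2; split=> //; split; first by rewrite k1 (edge_f2 k1 k2 al0 be0 d00).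
  rewrite k2; congr (_ *: _); have := weight_f k1 k2 k2 d00.
  by rewrite mulr1 ckk => /opp.
have [[e1 e2]|[e1 e2 b10]] := node_linear k1 k2 al0 be0 a00 b00 c00 d00.
  by exists PSign; exists al, be.
by exists PLin; split=> //; split; rewrite ?k1 ?k2 ?e1 ?e2.
Qed.

(** Squares, so that the signs of PSign disappear and all weights are integers. *)
Lemma profile_sq k s : has_profile pi k s -> exists al be,
  [/\ pi (uq_k q k) x1 = al *: x1, pi (uq_k q k) x2 = be *: x2,
      al ^+ 2 = qval q ^ (2 * (profile_weight s).1) & be ^+ 2 = qval q ^ (2 * (profile_weight s).2)].
Proof.
case: s => [[al [be h]]|[[h1 h2] _]|[[h1 h2] _]|[[h1 h2] _]|[[h1 h2] _]|[[h1 h2] _]];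
 first by exists al, be.
all: by eexists; eexists; split; [exact: h1 | exact: h2 | |];
  rewrite ?exprnP exprz_exp mulrC.
Qed.

Section ProfileWeights.
Variables (k l : 'I_2) (s : profile).
Hypothesis hs : has_profile pi k s.

Let wt_sq (al be w : F) (a b r c : int) m n : al ^+ 2 = qval q ^ (2 * a) ->
  be ^+ 2 = qval q ^ (2 * b) -> w ^+ 2 = qval q ^ (2 * r) ->
  al ^+ m * be ^+ n = qval q ^ c * w -> m%:Z * a + n%:Z * b = c + r.
Proof.
move=> ea eb er /(congr1 (fun x => x ^+ 2)).
rewrite !exprMn -!exprM ![(_ * 2)%N]mulnC !exprM ea eb er !exprnP !exprz_exp.
by rewrite -!expfzDr // => /(@qexp_inj _ q); lia.
Qed.

Lemma profile_e1 m n : qcoef (pi (uq_e q l) x1) m n != 0 ->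
  m%:Z * (profile_weight s).1 + n%:Z * (profile_weight s).2 = cartan k l + (profile_weight s).1.
Proof.
have [al [be [k1 k2 ea eb]]] := profile_sq hs.
by move=> /(weight_e k1 k2 k1); exact: wt_sq.
Qed.
Lemma profile_e2 m n : qcoef (pi (uq_e q l) x2) m n != 0 ->
  m%:Z * (profile_weight s).1 + n%:Z * (profile_weight s).2 = cartan k l + (profile_weight s).2.
Proof.
have [al [be [k1 k2 ea eb]]] := profile_sq hs.
by move=> /(weight_e k1 k2 k2); exact: wt_sq.
Qed.
Lemma profile_f1 m n : qcoef (pi (uq_f q l) x1) m n != 0 ->
  m%:Z * (profile_weight s).1 + n%:Z * (profile_weight s).2 = - cartan k l + (profile_weight s).1.
Proof.
have [al [be [k1 k2 ea eb]]] := profile_sq hs.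
by move=> /(weight_f k1 k2 k1); exact: wt_sq.
Qed.
Lemma profile_f2 m n : qcoef (pi (uq_f q l) x2) m n != 0 ->
  m%:Z * (profile_weight s).1 + n%:Z * (profile_weight s).2 = - cartan k l + (profile_weight s).2.
Proof.
have [al [be [k1 k2 ea eb]]] := profile_sq hs.
by move=> /(weight_f k1 k2 k2); exact: wt_sq.
Qed.
End ProfileWeights.

Definition allowed s s' :=
  match s, s' with
  | PSign, PSign | PE1, PLin | PLin, PE1 | PF2, PLin | PLin, PF2 | PE1, PF2 | PF2, PE1 => true
  | _, _ => false
  end.

(** The coefficient that defines the profile of a node has a weight for the other
    node also, which gives a linear condition on the weights of that node; both
    conditions together leave the pairs of allowed. *)
Lemma profile_pair k l s s' : k != l -> has_profile pi k s -> has_profile pi l s' ->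
  allowed s s'.
Proof.
have half (k' l' : 'I_2) t t' : k' != l' -> has_profile pi k' t -> has_profile pi l' t' ->
  match t with
  | PSign => True
  | PE1 => (profile_weight t').1 = 1 | PE2 => (profile_weight t').2 = 1 | PF1 => (profile_weight t').1 = -1
  | PF2 => (profile_weight t').2 = -1 | PLin => (profile_weight t').1 = (profile_weight t').2 - 1
  end.
  move=> kl ht ht'.
  have c : cartan l' k' = -1 by rewrite cartan2 eq_sym (negbTE kl).
  case: t ht => // -[_].
  - by move/(profile_e1 ht'); rewrite c; lia.
  - by move/(profile_e2 ht'); rewrite c; lia.
  - by move/(profile_f1 ht'); rewrite c; lia.
  - by move/(profile_f2 ht'); rewrite c; lia.
  - by move/(profile_e2 ht'); rewrite c; lia.
move=> kl hs hs'; have := half _ _ _ _ kl hs hs'.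
have lk : l != k by rewrite eq_sym.
have := half _ _ _ _ lk hs' hs.
by case: (s); case: (s') => //=; lia.
Qed.

Lemma qcoef_single (u : A) m n :
  (forall a b, qcoef u a b != 0 -> a = m /\ b = n) -> u = qcoef u m n *: qmon m n.
Proof.
move=> h; apply: qcoef_inj => a b; rewrite qcoefZ qcoef_mon.
case: (boolP (_ && _)) => [/andP[/eqP-> /eqP->]|ab]; first by rewrite mulr1.
rewrite mulr0; apply: contrapT => /eqP /h [e1 e2].
by move: ab; rewrite e1 e2 !eqxx.
Qed.
Lemma qcoef_none (u : A) : (forall a b, qcoef u a b != 0 -> False) -> u = 0.
Proof.
by move=> h; apply: qcoef_inj => a b; rewrite qcoef0; apply: contrapT => /eqP /h.
Qed.

End Profiles.

Section Rescaling.
Variables (F : fieldType) (q : F).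
Local Notation A := (qspace 2 q).
Local Notation x1 := (x1 q).
Local Notation x2 := (x2 q).

Definition scale_gen (s t : F) (i : 'I_2) : A := if val i == 0%N then s *: x1 else t *: x2.

Lemma scale_rels s t : @qspace_rels F 2 q A (scale_gen s t).
Proof.
move=> [[|[|i]] li] // [[|[|j]] lj] // _; rewrite /scale_gen /=.
rewrite -!scalerAl -!scalerAr x2x1 !scalerA; congr (_ *: _); ring.
Qed.

Definition scaling s t : {lrmorphism A -> A} :=
  @plift F (qspace_pres 2 q) A (scale_gen s t) (@scale_rels s t).

Lemma scaling_x1 s t : scaling s t x1 = s *: x1.
Proof. exact: (@lift_gen F (qspace_pres 2 q) A _ (@scale_rels s t) ord0). Qed.
Lemma scaling_x2 s t : scaling s t x2 = t *: x2.
Proof. exact: (@lift_gen F (qspace_pres 2 q) A _ (@scale_rels s t) ord_max). Qed.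

Lemma scalingP s t :
  (forall u v, scaling s t (u + v) = scaling s t u + scaling s t v) /\
  (forall c u, scaling s t (c *: u) = c *: scaling s t u) /\
  (forall u v, scaling s t (u * v) = scaling s t u * scaling s t v) /\
  scaling s t 1 = 1.
Proof.
split; first exact: raddfD.
split; first exact: (linearZZ (scaling s t)).
split; first exact: rmorphM.
exact: rmorph1.
Qed.

Lemma scaling_mon s t m n : scaling s t (qmon q m n) = (s ^+ m * t ^+ n) *: qmon q m n.
Proof.
have [_ [_ [M o]]] := scalingP s t.
have p1 : scaling s t (x1 ^+ m) = s ^+ m *: x1 ^+ m.
  elim: m => [|m IH]; first by rewrite o scale1r.
  by rewrite !exprS M IH scaling_x1 -scalerAl -scalerAr scalerA.
have p2 : scaling s t (x2 ^+ n) = t ^+ n *: x2 ^+ n.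
  elim: n => [|n IH]; first by rewrite o scale1r.
  by rewrite !exprS M IH scaling_x2 -scalerAl -scalerAr scalerA.
by rewrite /qmon M p1 p2 -scalerAl -scalerAr scalerA.
Qed.

Lemma scalingK s t : s != 0 -> t != 0 -> cancel (scaling s t) (scaling s^-1 t^-1).
Proof.
move=> s0 t0; have [D [Z [M o]]] := scalingP s t.
have [D' [Z' [M' o']]] := scalingP s^-1 t^-1.
elim/qplane_ind => [|||c u e|u v eu ev|u v eu ev].
- by rewrite o.
- by rewrite scaling_x1 Z' scaling_x1 scalerA divff // scale1r.
- by rewrite scaling_x2 Z' scaling_x2 scalerA divff // scale1r.
- by rewrite Z Z' e.
- by rewrite D D' eu ev.
- by rewrite M M' eu ev.
Qed.

End Rescaling.

Section Classification.
Variables (F : fieldType) (q : qparam F).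
Local Notation A := (qspace 2 q).
Local Notation x1 := (x1 (qval q)).
Local Notation x2 := (x2 (qval q)).
Local Notation qmon := (qmon (qval q)).
Let q0 : qval q != 0 := qval_neq0 q.
Let q2 : qval q ^+ 2 != 1.
Proof. exact: qval_not_root. Qed.

(** Conjugation by a scaling multiplies the coefficient of x_1^m x_2^n in the
    value on x_1 by s^m t^n / s, and in the value on x_2 by s^m t^n / t. *)
Lemma rescale (pi : uq_symmetry 2 2 q) s t : s != 0 -> t != 0 ->
  exists pi' : uq_symmetry 2 2 q, [/\ module_algebra_isom pi pi',
    forall h c m n, pi h x1 = c *: qmon m n ->
      pi' h x1 = (s^-1 * c * (s ^+ m * t ^+ n)) *: qmon m n &
    forall h c m n, pi h x2 = c *: qmon m n ->
      pi' h x2 = (t^-1 * c * (s ^+ m * t ^+ n)) *: qmon m n].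
Proof.
move=> s0 t0; have [D [Z [M o]]] := scalingP (qval q) s t.
have K := scalingK (q := qval q) s0 t0.
have K' : cancel (scaling (qval q) s^-1 t^-1) (scaling (qval q) s t).
  have := scalingK (q := qval q) (invr_neq0 s0) (invr_neq0 t0); by rewrite !invrK.
have lin : linear (scaling (qval q) s t) by move=> c u v; rewrite D Z.
have [pi' pi'E] := transport_sym pi lin o M K K'.
exists pi'; split.
- exists (scaling (qval q) s t); split; first by exists (scaling (qval q) s^-1 t^-1).
  by move=> h a; rewrite pi'E K.
- move=> h c m n e; rewrite pi'E scaling_x1 actZ e !Z scaling_mon !scalerA.
  by congr (_ *: _); ring.
- move=> h c m n e; rewrite pi'E scaling_x2 actZ e !Z scaling_mon !scalerA.
  by congr (_ *: _); ring.
Qed.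

Section NormalForms.
Variables (pi : uq_symmetry 2 2 q) (k : 'I_2).
Local Notation e := (pi (uq_e q k)).
Local Notation f := (pi (uq_f q k)).
Local Notation K := (pi (uq_k q k)).

Let ef x : e (f x) - f (e x) = (qval q - (qval q)^-1)^-1 *: (K x - pi (uq_kinv q k) x).
Proof. by rewrite act_ef eqxx. Qed.

Let dn0 : qval q ^+ 2 - 1 != 0.
Proof. exact: sqr_sub1_neq0. Qed.
Let q4 : qval q ^+ 2 + 1 != 0.
Proof.
have := qval_not_root q (isT : (0 < 4)%N); rewrite -subr_eq0.
have -> : qval q ^+ 4 - 1 = (qval q ^+ 2 - 1) * (qval q ^+ 2 + 1) by ring.
by rewrite mulf_eq0 negb_or => /andP[].
Qed.

(** In the three normal forms, the relation between e, f and k on x_1 and x_2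
    determines the coefficients of f (or of e) that weights leave free. *)
Lemma node_at_lin c : has_weights pi k 1 (-1) -> e x1 = 0 -> e x2 = x1 -> f x1 = c *: x2 ->
  f x2 = 0 -> node_at pi k NLin.
Proof.
move=> [k1 k2] e1 e2 f1 f2.
have k1' := act_kinv_x1 k1 (expfz_neq0 1 q0).
have := ef x1; rewrite f1 e1 act0 subr0 actZ e2 k1 k1' -scalerBl scalerA expr1z.
have -> : (qval q - (qval q)^-1)^-1 * (qval q - (qval q)^-1) = 1.
  by field; rewrite q0 dn0.
rewrite scale1r => /(congr1 (fun u => qcoef u 1 0)); rewrite qcoefZ -qmon10 qcoef_mon /= mulr1 => c1.
split; rewrite /= ?(qint0, qint1, expr0, expr1, invr1, mulr1, mul1r, scale0r, scale1r) ?qmon10 ?qmon01 //.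
by rewrite f1 c1 scale1r.
Qed.

Lemma node_at_der1 c d : has_weights pi k (-2) (-1) -> e x1 = 1 -> e x2 = 0 ->
  f x1 = c *: qmon 2 0 -> f x2 = d *: qmon 1 1 -> node_at pi k NDer1.
Proof.
move=> [k1 k2] e1 e2 f1 f2.
have {}k1 : K x1 = qval q ^- 2 *: x1 := k1; have {}k2 : K x2 = (qval q)^-1 *: x2 := k2.
have k1' : pi (uq_kinv q k) x1 = qval q ^+ 2 *: x1.
  by rewrite (act_kinv_x1 k1) ?invrK // invr_neq0 ?expf_neq0.
have k2' : pi (uq_kinv q k) x2 = qval q *: x2.
  by rewrite (act_kinv_x2 k2) ?invrK // invr_neq0.
have h1 : c = - qval q.
  have := ef x1; rewrite f1 e1 act_f1 subr0 actZ k1 k1' -scalerBl scalerA.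
  rewrite qmon20 expr2 act_eM e1 k1 mulr1 mul1r -[X in X + _ *: _]scale1r -scalerDl scalerA.
  move=> /(congr1 (fun u => qcoef u 1 0)); rewrite !qcoefZ -qmon10 qcoef_mon /= !mulr1.
  move=> E; have r0 : 1 + qval q ^- 2 != 0.
    have -> : 1 + qval q ^- 2 = (qval q ^+ 2 + 1) / qval q ^+ 2 by field.
    by rewrite mulf_neq0 ?invr_neq0 ?expf_neq0.
  by apply: (mulIf r0); rewrite E; field; by rewrite q0 dn0.
have h2 : d = - qval q.
  have := ef x2; rewrite f2 e2 act0 subr0 actZ k2 k2' -scalerBl scalerA.
  rewrite qmon11 act_eM e1 e2 k2 mulr0 mul1r add0r scalerA.
  move=> /(congr1 (fun u => qcoef u 0 1)); rewrite !qcoefZ -qmon01 qcoef_mon /= !mulr1.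
  move=> E; apply: (mulIf (invr_neq0 q0)); rewrite E; field; by rewrite q0 dn0.
split; rewrite /= ?(expr1n, addn0, add0n, qint0, qint1, expr0, expr1, invr1, mulr1, mul1r, mulr0, scale0r,
  scale1r) ?divff // ?scale1r ?qmon10 ?qmon01 ?qmon00 ?f1 ?f2 ?h1 ?h2 //.
Qed.

Lemma node_at_der2 c d : has_weights pi k 1 2 -> f x1 = 0 -> f x2 = 1 ->
  e x1 = c *: qmon 1 1 -> e x2 = d *: qmon 0 2 -> node_at pi k NDer2.
Proof.
move=> [k1 k2] f1 f2 e1 e2.
have {}k1 : K x1 = qval q *: x1 := k1; have {}k2 : K x2 = qval q ^+ 2 *: x2 := k2.
have k1' := act_kinv_x1 k1 q0; have k2' := act_kinv_x2 k2 (expf_neq0 _ q0).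
have h1 : c = - qval q.
  have := ef x1; rewrite f1 e1 act0 sub0r actZ k1 k1' -scalerBl scalerA.
  rewrite qmon11 act_fM f1 f2 k1' mul0r mulr1 addr0 scalerA -scaleNr.
  move=> /(congr1 (fun u => qcoef u 1 0)); rewrite !qcoefZ -qmon10 qcoef_mon /= !mulr1 => E.
  apply: (mulIf (invr_neq0 q0)); apply: oppr_inj; rewrite E; field; by rewrite q0 dn0.
have h2 : d = - qval q.
  have := ef x2; rewrite f2 e2 act_e1 sub0r actZ k2 k2' -scalerBl scalerA.
  rewrite qmon02 expr2 act_fM f2 k2' mulr1 mul1r -[X in _ + X]scale1r -scalerDl scalerA -scaleNr.
  move=> /(congr1 (fun u => qcoef u 0 1)); rewrite !qcoefZ -qmon01 qcoef_mon /= !mulr1 => E.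
  have r0 : qval q ^- 2 + 1 != 0.
    have -> : qval q ^- 2 + 1 = (qval q ^+ 2 + 1) / qval q ^+ 2 by field.
    by rewrite mulf_neq0 ?invr_neq0 ?expf_neq0.
  apply: (mulIf r0); apply: oppr_inj; rewrite E; field; by rewrite q0 dn0.
split; rewrite /= ?(expr1n, addn0, add0n, qint0, qint1, expr0, expr1, invr1, mulr1, mul1r, mulr0, scale0r,
  scale1r) ?divff // ?scale1r ?qmon10 ?qmon01 ?qmon00 ?e1 ?e2 ?h1 ?h2 //.
Qed.
End NormalForms.

Lemma rescale_weights (pi : uq_symmetry 2 2 q) s t : s != 0 -> t != 0 ->
  exists pi' : uq_symmetry 2 2 q, [/\ module_algebra_isom pi pi',
    forall k a b, has_weights pi k a b -> has_weights pi' k a b,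
    forall h c m n, pi h x1 = c *: qmon m n ->
      pi' h x1 = (s^-1 * c * (s ^+ m * t ^+ n)) *: qmon m n &
    forall h c m n, pi h x2 = c *: qmon m n ->
      pi' h x2 = (t^-1 * c * (s ^+ m * t ^+ n)) *: qmon m n].
Proof.
move=> s0 t0; have [pi' [iso r1 r2]] := rescale pi s0 t0.
exists pi'; split=> // k a b [k1 k2]; split.
  move: k1; rewrite -qmon10 => k1; have := r1 (uq_k q k) (qval q ^ a) 1 0.
  rewrite -{1}qmon10 k1 -qmon10 => /(_ erefl) ->; congr (_ *: _); by field.
move: k2; rewrite -qmon01 => k2; have := r2 (uq_k q k) (qval q ^ b) 0 1.
rewrite -{1}qmon01 k2 -qmon01 => /(_ erefl) ->; congr (_ *: _); by field.
Qed.

Lemma qcoef_zero (u : A) : (forall a b, qcoef u a b != 0 -> False) -> u = 0 *: qmon 0 0.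
Proof. by move/qcoef_none ->; rewrite scale0r. Qed.

(** The weights for both nodes are independent, so the two linear equations for
   the exponents of a monomial that occurs have at most one solution. *)
Ltac single hi hj cij := let a := fresh in let b := fresh in let H := fresh in
  move=> a b H;
  first [have := profile_e1 hi H; have := profile_e1 hj H | have := profile_e2 hi H; have := profile_e2 hj H
       | have := profile_f1 hi H; have := profile_f1 hj H | have := profile_f2 hi H; have := profile_f2 hj H];
  rewrite /= !cij; lia.

Section Pairs.
Variables (pi : uq_symmetry 2 2 q) (i j : 'I_2).
Hypothesis ij : i != j.

Let cE : (cartan i i = 2) * (cartan j j = 2) * (cartan i j = -1) * (cartan j i = -1).
Proof. by rewrite !cartan2 !eqxx [j == i]eq_sym (negbTE ij). Qed.

Let goal := exists c (pi' : uq_symmetry 2 2 q), of_kind c i j pi' /\ module_algebra_isom pi pi'.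

Lemma isom_refl : module_algebra_isom pi pi.
Proof. by exists idfun; split=> //; exists idfun. Qed.

Lemma classify_sign : has_profile pi i PSign -> has_profile pi j PSign -> goal.
Proof.
move=> hi hj.
have sg (x : F) : x ^+ 2 = 1 -> exists s : bool, x = (-1) ^+ s.
  by move/eqP; rewrite sqrf_eq1 => /orP[]/eqP->; [exists false | exists true].
have nd k : has_profile pi k PSign -> exists s1 s2, node_at pi k (NSign s1 s2).
  move=> h; have ckk : cartan k k = 2 by rewrite /cartan eqxx.
  have [al [be [k1 k2 /sg[s1 e1] /sg[s2 e2]]]] := h; exists s1, s2.
  split; rewrite /= ?expr0 ?expr1 ?mulr1 ?mul1r -?e1 -?e2 //.
    split; apply: qcoef_none => a b cn0; [have := profile_e1 h cn0|have := profile_e2 h cn0];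
    by rewrite ckk /= !mulr0.
  split; apply: qcoef_none => a b cn0; [have := profile_f1 h cn0|have := profile_f2 h cn0];
  by rewrite ckk /= !mulr0.
have [a [b ni]] := nd _ hi; have [c [d nj]] := nd _ hj.
exists (Kind1 a b c d), pi; split; last exact: isom_refl.
by apply/of_kindE.
Qed.

(** In this and the next two lemmas the scaling is the one that makes the defining
    coefficients of the two profiles equal to 1. *)
Lemma classify_der1_lin : has_profile pi i PE1 -> has_profile pi j PLin -> goal.
Proof.
move=> hi hj.
have ei1 : pi (uq_e q i) x1 = qcoef (pi (uq_e q i) x1) 0 0 *: qmon 0 0
  by apply: qcoef_single; single hi hj cE.
have ei2 : pi (uq_e q i) x2 = 0 *: qmon 0 0
  by apply: qcoef_zero; single hi hj cE.
have fi1 : pi (uq_f q i) x1 = qcoef (pi (uq_f q i) x1) 2 0 *: qmon 2 0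
  by apply: qcoef_single; single hi hj cE.
have fi2 : pi (uq_f q i) x2 = qcoef (pi (uq_f q i) x2) 1 1 *: qmon 1 1
  by apply: qcoef_single; single hi hj cE.
have ej1 : pi (uq_e q j) x1 = 0 *: qmon 0 0
  by apply: qcoef_zero; single hi hj cE.
have ej2 : pi (uq_e q j) x2 = qcoef (pi (uq_e q j) x2) 1 0 *: qmon 1 0
  by apply: qcoef_single; single hi hj cE.
have fj1 : pi (uq_f q j) x1 = qcoef (pi (uq_f q j) x1) 0 1 *: qmon 0 1
  by apply: qcoef_single; single hi hj cE.
have fj2 : pi (uq_f q j) x2 = 0 *: qmon 0 0
  by apply: qcoef_zero; single hi hj cE.
have [wi a0] := hi; have [wj b0] := hj.
have [pi' [iso w r1 r2]] := rescale_weights pi a0 (mulf_neq0 b0 a0).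
exists Kind2, pi'; split=> //; apply/of_kindE; split=> /=.
  apply: (@node_at_der1 _ _ _ _ (w _ _ _ wi)).
  - by rewrite (r1 _ _ _ _ ei1) qmon00 !mulr1 mulVf // scale1r.
  - by rewrite (r2 _ _ _ _ ei2) mulr0 mul0r scale0r.
  - exact: (r1 _ _ _ _ fi1).
  - exact: (r2 _ _ _ _ fi2).
apply: (@node_at_lin _ _ _ (w _ _ _ wj)).
- by rewrite (r1 _ _ _ _ ej1) mulr0 mul0r scale0r.
- rewrite (r2 _ _ _ _ ej2) qmon10 expr0 mulr1 expr1 -[RHS]scale1r; congr (_ *: _).
  by field; rewrite a0 b0.
- by rewrite (r1 _ _ _ _ fj1) qmon01.
- by rewrite (r2 _ _ _ _ fj2) mulr0 mul0r scale0r.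
Qed.

Lemma classify_der2_lin : has_profile pi i PF2 -> has_profile pi j PLin -> goal.
Proof.
move=> hi hj.
have ei1 : pi (uq_e q i) x1 = qcoef (pi (uq_e q i) x1) 1 1 *: qmon 1 1
  by apply: qcoef_single; single hi hj cE.
have ei2 : pi (uq_e q i) x2 = qcoef (pi (uq_e q i) x2) 0 2 *: qmon 0 2
  by apply: qcoef_single; single hi hj cE.
have fi1 : pi (uq_f q i) x1 = 0 *: qmon 0 0
  by apply: qcoef_zero; single hi hj cE.
have fi2 : pi (uq_f q i) x2 = qcoef (pi (uq_f q i) x2) 0 0 *: qmon 0 0
  by apply: qcoef_single; single hi hj cE.
have ej1 : pi (uq_e q j) x1 = 0 *: qmon 0 0
  by apply: qcoef_zero; single hi hj cE.
have ej2 : pi (uq_e q j) x2 = qcoef (pi (uq_e q j) x2) 1 0 *: qmon 1 0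
  by apply: qcoef_single; single hi hj cE.
have fj1 : pi (uq_f q j) x1 = qcoef (pi (uq_f q j) x1) 0 1 *: qmon 0 1
  by apply: qcoef_single; single hi hj cE.
have fj2 : pi (uq_f q j) x2 = 0 *: qmon 0 0
  by apply: qcoef_zero; single hi hj cE.
have [wi a0] := hi; have [wj b0] := hj.
have [pi' [iso w r1 r2]] := rescale_weights pi (mulf_neq0 a0 (invr_neq0 b0)) a0.
exists Kind3, pi'; split=> //; apply/of_kindE; split=> /=.
  apply: (@node_at_der2 _ _ _ _ (w _ _ _ wi)).
  - by rewrite (r1 _ _ _ _ fi1) mulr0 mul0r scale0r.
  - by rewrite (r2 _ _ _ _ fi2) qmon00 !mulr1 mulVf // scale1r.
  - exact: (r1 _ _ _ _ ei1).
  - exact: (r2 _ _ _ _ ei2).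
apply: (@node_at_lin _ _ _ (w _ _ _ wj)).
- by rewrite (r1 _ _ _ _ ej1) mulr0 mul0r scale0r.
- rewrite (r2 _ _ _ _ ej2) qmon10 expr0 mulr1 expr1 -[RHS]scale1r; congr (_ *: _).
  by field; rewrite a0 b0.
- by rewrite (r1 _ _ _ _ fj1) qmon01.
- by rewrite (r2 _ _ _ _ fj2) mulr0 mul0r scale0r.
Qed.

Lemma classify_der1_der2 : has_profile pi i PE1 -> has_profile pi j PF2 -> goal.
Proof.
move=> hi hj.
have ei1 : pi (uq_e q i) x1 = qcoef (pi (uq_e q i) x1) 0 0 *: qmon 0 0
  by apply: qcoef_single; single hi hj cE.
have ei2 : pi (uq_e q i) x2 = 0 *: qmon 0 0
  by apply: qcoef_zero; single hi hj cE.
have fi1 : pi (uq_f q i) x1 = qcoef (pi (uq_f q i) x1) 2 0 *: qmon 2 0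
  by apply: qcoef_single; single hi hj cE.
have fi2 : pi (uq_f q i) x2 = qcoef (pi (uq_f q i) x2) 1 1 *: qmon 1 1
  by apply: qcoef_single; single hi hj cE.
have ej1 : pi (uq_e q j) x1 = qcoef (pi (uq_e q j) x1) 1 1 *: qmon 1 1
  by apply: qcoef_single; single hi hj cE.
have ej2 : pi (uq_e q j) x2 = qcoef (pi (uq_e q j) x2) 0 2 *: qmon 0 2
  by apply: qcoef_single; single hi hj cE.
have fj1 : pi (uq_f q j) x1 = 0 *: qmon 0 0
  by apply: qcoef_zero; single hi hj cE.
have fj2 : pi (uq_f q j) x2 = qcoef (pi (uq_f q j) x2) 0 0 *: qmon 0 0
  by apply: qcoef_single; single hi hj cE.
have [wi a0] := hi; have [wj b0] := hj.
have [pi' [iso w r1 r2]] := rescale_weights pi a0 b0.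
exists Kind4, pi'; split=> //; apply/of_kindE; split=> /=.
  apply: (@node_at_der1 _ _ _ _ (w _ _ _ wi)).
  - by rewrite (r1 _ _ _ _ ei1) qmon00 !mulr1 mulVf // scale1r.
  - by rewrite (r2 _ _ _ _ ei2) mulr0 mul0r scale0r.
  - exact: (r1 _ _ _ _ fi1).
  - exact: (r2 _ _ _ _ fi2).
apply: (@node_at_der2 _ _ _ _ (w _ _ _ wj)).
- by rewrite (r1 _ _ _ _ fj1) mulr0 mul0r scale0r.
- by rewrite (r2 _ _ _ _ fj2) qmon00 !mulr1 mulVf // scale1r.
- exact: (r1 _ _ _ _ ej1).
- exact: (r2 _ _ _ _ ej2).
Qed.

End Pairs.

Lemma classification (pi : uq_symmetry 2 2 q) :
  exists (c : kind) (i j : 'I_2) (pi' : uq_symmetry 2 2 q),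
    [/\ i != j, of_kind c i j pi' & module_algebra_isom pi pi'].
Proof.
have ij : (ord0 : 'I_2) != ord_max by [].
have ji : (ord_max : 'I_2) != ord0 by [].
have [s hs] := profile_ex pi ord0; have [s' hs'] := profile_ex pi ord_max.
have := profile_pair ij hs hs'.
have wrap (i j : 'I_2) : i != j -> (exists c (pi' : uq_symmetry 2 2 q),
    of_kind c i j pi' /\ module_algebra_isom pi pi') ->
  exists (c : kind) (i j : 'I_2) (pi' : uq_symmetry 2 2 q),
    [/\ i != j, of_kind c i j pi' & module_algebra_isom pi pi'].
  by move=> cn0 [c [pi' [h1 h2]]]; exists c, i, j, pi'.
case: s s' hs hs' => -[] // hs hs' _.
- exact: wrap ij (classify_sign hs hs').
- exact: wrap ij (classify_der1_der2 ij hs hs').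
- exact: wrap ij (classify_der1_lin ij hs hs').
- exact: wrap ji (classify_der1_der2 ji hs' hs).
- exact: wrap ij (classify_der2_lin ij hs hs').
- exact: wrap ji (classify_der1_lin ji hs' hs).
- exact: wrap ji (classify_der2_lin ji hs' hs).
Qed.

End Classification.

(** * Limits as q tends to 1 *)
Section Limits.
Import numFieldNormedType.Exports.
Local Open Scope classical_set_scope.
Variable C : numFieldType.
Local Notation G := (within (@not_root_of_unity C) (nbhs (1 : C))).

Lemma qlim_id : q @[q --> G] --> (1 : C).
Proof. exact: cvg_within. Qed.

Lemma qlim_exp n : q ^+ n @[q --> G] --> (1 : C).
Proof.
elim: n => [|n IH]; first exact: cvg_cst.
under eq_fun do rewrite exprS.
by have := cvgM qlim_id IH; rewrite mulr1; apply.
Qed.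

Lemma qlim_expV n : (q ^+ n)^-1 @[q --> G] --> (1 : C).
Proof. by have := cvgV (oner_neq0 C) (@qlim_exp n); rewrite invr1; apply. Qed.

Lemma qlim_eq (f g : C -> C) (l : C) : (forall q, not_root_of_unity q -> f q = g q) ->
  g q @[q --> G] --> l -> f q @[q --> G] --> l.
Proof.
move=> fg; apply: cvg_trans; apply: near_eq_cvg; rewrite near_withinE.
by apply: filterE => q /fg ->.
Qed.

(** The recursion [n+1] = q [n] + q^-n, whose terms converge, avoids dividing by
    q - q^-1 in the limit. *)
Lemma qlim_qint n : qint q n @[q --> G] --> (n%:R : C).
Proof.
elim: n => [|n IH].
  by under eq_fun do rewrite qint0; exact: cvg_cst.
apply: (@qlim_eq _ (fun q => q * qint q n + (q ^+ n)^-1)).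
  move=> q [q0 q1]; have qint0 : q ^+ n != 0 by exact: expf_neq0.
  have h := sqr_sub1_neq0 (q1 2%N isT); rewrite /qint (inv_qdenom q0 (q1 2%N isT)) exprS; field.
  by rewrite q0 qint0 h.
by have := cvgD (cvgM qlim_id IH) (@qlim_expV n); rewrite mul1r natr1; apply.
Qed.

Lemma tends_to_mon (u : forall q : qparam C, qspace 2 q) (p : {mpoly C[2]})
    (s : C -> C) (l : C) a b :
  (forall q, u q = s (qval q) *: qmon (qval q) a b) ->
  p = l *: ('X_ord0 ^+ a * 'X_ord_max ^+ b) ->
  s q @[q --> G] --> l -> tends_to u p.
Proof.
move=> us pl lim; pose N := (maxn a b).+1.
have aN : (a < N)%N by rewrite ltnS leq_maxl.
have bN : (b < N)%N by rewrite ltnS leq_maxr.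
pose hit (i j : 'I_N) := (i == a :> nat) && (j == b :> nat).
have pick (V : lmodType C) (g : nat -> nat -> V) (x : C) :
    \sum_(i < N) \sum_(j < N) (if hit i j then x else 0) *: g i j = x *: g a b.
  rewrite (bigD1 (Ordinal aN)) //= [X in _ + X]big1 ?addr0; last first.
    move=> i; rewrite -val_eqE /= => /negbTE ia.
    by rewrite big1 // => j _; rewrite /hit ia scale0r.
  rewrite (bigD1 (Ordinal bN)) //= [X in _ + X]big1 ?addr0; last first.
    by move=> j; rewrite -val_eqE /= => /negbTE jb; rewrite /hit jb andbF scale0r.
  by rewrite /hit !eqxx.
exists N, (fun q i j => if hit i j then s q else 0), (fun i j => if hit i j then l else 0).
split.
- by move=> q; rewrite (pick _ (fun i j => qvar q ord0 ^+ i * qvar q ord_max ^+ j)) us.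
- by rewrite (pick _ (fun i j => 'X_ord0 ^+ i * 'X_ord_max ^+ j)).
- by move=> i j; case: (hit i j) => //; exact: cvg_cst.
Qed.

End Limits.

(** * Vector fields of the projective action of sl_3 *)
Section VectorFields.
Variable C : fieldType.
Local Notation P := {mpoly C[2]}.
Local Notation X1 := ('X_(ord0 : 'I_2) : P).
Local Notation X2 := ('X_(ord_max : 'I_2) : P).

Definition o0 : 'I_3 := Ordinal (isT : 0 < 3)%N.
Definition o1 : 'I_3 := Ordinal (isT : 1 < 3)%N.
Definition o2 : 'I_3 := Ordinal (isT : 2 < 3)%N.

Lemma sum3 (V : nmodType) (f : 'I_3 -> V) : \sum_i f i = f o0 + f o1 + f o2.
Proof.
rewrite !big_ord_recr big_ord0 /= add0r.
by congr (f _ + f _ + f _); apply: val_inj.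
Qed.

Lemma ord3_ind (Q : 'I_3 -> Prop) : Q o0 -> Q o1 -> Q o2 -> forall i, Q i.
Proof.
move=> h0 h1 h2 [[|[|[|i]]] li] //.
- by have -> : Ordinal li = o0 by exact: val_inj.
- by have -> : Ordinal li = o1 by exact: val_inj.
- by have -> : Ordinal li = o2 by exact: val_inj.
Qed.

Lemma mderiv_var (i j : 'I_2) : mderiv i ('X_j : P) = (i == j)%:R.
Proof.
rewrite mderivX mnm1E eq_sym; case: eqVneq => [->|_]; last by rewrite scale0r.
rewrite scale1r (_ : (_ - _)%MM = 0%MM) ?mpolyX0 //.
by apply/mnmP => k; rewrite mnmBE subnn mnm0E.
Qed.

Definition vf (p r u : P) : P := p * mderiv ord0 u + r * mderiv ord_max u.

Lemma vf_linear p r : linear (vf p r).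
Proof. by move=> c u v; rewrite /vf !mderivD !mderivZ -!mul_mpolyC; ring. Qed.
Lemma vfM p r u v : vf p r (u * v) = vf p r u * v + u * vf p r v.
Proof. by rewrite /vf !mderivM; ring. Qed.
Lemma vfX1 p r : vf p r X1 = p.
Proof. by rewrite /vf !mderiv_var /= mulr1 mulr0 addr0. Qed.
Lemma vfX2 p r : vf p r X2 = r.
Proof. by rewrite /vf !mderiv_var /= mulr1 mulr0 add0r. Qed.
Lemma vfC p r c : vf p r c%:MP = 0.
Proof. by rewrite /vf !mderivC !mulr0 addr0. Qed.

(** The commutator of two derivations is a derivation: the second derivatives of u
    cancel. *)
Lemma vf_bracket p r p' r' u :
  vf p r (vf p' r' u) - vf p' r' (vf p r u) =
  vf (vf p r p' - vf p' r' p) (vf p r r' - vf p' r' r) u.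
Proof.
rewrite /vf !(mderivD, mderivM) (mderiv_comm ord_max ord0 u); ring.
Qed.

(** The matrix unit with entry 1 at (a, b) stands for the vector field
    y_a d/dy_b on the homogeneous coordinates y_0, y_1, y_2, and vcoord M s x_s is
    its effect on the coordinate x_s = y_s / y_0 of the chart y_0 = 1. *)
Definition vcoord (M : 'M[C]_3) (s : 'I_3) (x : P) : P :=
  (M o0 s)%:MP + (M o1 s)%:MP * X1 + (M o2 s)%:MP * X2
  - x * ((M o0 o0)%:MP + (M o1 o0)%:MP * X1 + (M o2 o0)%:MP * X2).

Definition proj_vf (M : 'M[C]_3) : P -> P := vf (vcoord M o1 X1) (vcoord M o2 X2).

Lemma proj_vf_linearl c M N u : proj_vf (c *: M + N) u = c *: proj_vf M u + proj_vf N u.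
Proof.
rewrite /proj_vf /vf /vcoord !mxE !mpolyCD !mpolyCM -!mul_mpolyC; ring.
Qed.

Lemma vf_vcoord p r N s x : vf p r (vcoord N s x) =
  (N o1 s)%:MP * p + (N o2 s)%:MP * r
  - vf p r x * ((N o0 o0)%:MP + (N o1 o0)%:MP * X1 + (N o2 o0)%:MP * X2)
  - x * ((N o1 o0)%:MP * p + (N o2 o0)%:MP * r).
Proof.
have fD u v : vf p r (u + v) = vf p r u + vf p r v.
  by rewrite /vf !mderivD; ring.
have fN u : vf p r (- u) = - vf p r u by rewrite /vf !mderivN; ring.
rewrite /vcoord !(fD, fN, vfM, vfC, vfX1, vfX2); ring.
Qed.

Lemma lie_bracketE (M N : 'M[C]_3) a b : (lie_bracket M N a b)%:MP =
  (M a o0)%:MP * (N o0 b)%:MP + (M a o1)%:MP * (N o1 b)%:MP + (M a o2)%:MP * (N o2 b)%:MP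
  - ((N a o0)%:MP * (M o0 b)%:MP + (N a o1)%:MP * (M o1 b)%:MP
     + (N a o2)%:MP * (M o2 b)%:MP) :> P.
Proof. by rewrite /lie_bracket !mxE !sum3 !(mpolyCB, mpolyCD, mpolyCM). Qed.

(** Commutators of linear vector fields on the homogeneous coordinates are linear
    fields of commutators, and this passes to functions of degree 0. *)
Lemma proj_vf_bracket M N u :
  proj_vf (lie_bracket M N) u = proj_vf M (proj_vf N u) - proj_vf N (proj_vf M u).
Proof.
rewrite /proj_vf vf_bracket !vf_vcoord !vfX1 !vfX2; congr (vf _ _ u).
  by rewrite /vcoord !lie_bracketE; ring.
by rewrite /vcoord !lie_bracketE; ring.
Qed.

Lemma proj_vf_X1 M : proj_vf M X1 = vcoord M o1 X1.
Proof. exact: vfX1. Qed.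
Lemma proj_vf_X2 M : proj_vf M X2 = vcoord M o2 X2.
Proof. exact: vfX2. Qed.

(** The homogeneous coordinates may be permuted and change signs, and the standard
    representation may be replaced by its dual. *)
Record chart := Chart { dual : bool; pos : 'I_3 * 'I_3 * 'I_3; sgn : bool * bool * bool }.
Definition pick3 (T : Type) (x : T * T * T) (i : 'I_3) : T :=
  match val i with 0%N => x.1.1 | 1%N => x.1.2 | _ => x.2 end.

Definition twist (c : chart) (M : 'M[C]_3) : 'M[C]_3 := \matrix_(a, b)
  ((-1) ^+ (dual c + pick3 (sgn c) a + pick3 (sgn c) b) *
   (if dual c then M (pick3 (pos c) b) (pick3 (pos c) a)
    else M (pick3 (pos c) a) (pick3 (pos c) b))).

Lemma twist_linear c x M N : twist c (x *: M + N) = x *: twist c M + twist c N.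
Proof.
apply/matrixP => a b; rewrite !mxE; case: (dual c); ring.
Qed.

(** Conjugation by a signed permutation is an automorphism for the commutator, and
    so is minus the transpose. *)
Lemma twist_bracket c M N : injective (pick3 (pos c)) ->
  twist c (lie_bracket M N) = lie_bracket (twist c M) (twist c N).
Proof.
move=> inj; apply/matrixP => a b; rewrite /lie_bracket.
have mm (M' N' : 'M[C]_3) i k : (M' *m N') (pick3 (pos c) i) (pick3 (pos c) k) =
    \sum_l M' (pick3 (pos c) i) (pick3 (pos c) l) * N' (pick3 (pos c) l) (pick3 (pos c) k).
  by rewrite mxE (reindex_inj inj).
have BE (M' N' : 'M[C]_3) i k : (M' - N') i k = M' i k - N' i k by rewrite !mxE.
have ss (x : bool) : (-1) ^+ x * (-1) ^+ x = 1 :> C by rewrite -expr2 sqrr_sign.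
have step (x y z : bool) (m n : C) : (-1) ^+ x * (-1) ^+ z * (m * n) =
    (-1) ^+ x * (-1) ^+ y * m * ((-1) ^+ y * (-1) ^+ z * n).
  have -> : (-1) ^+ x * (-1) ^+ y * m * ((-1) ^+ y * (-1) ^+ z * n) =
    ((-1) ^+ y * (-1) ^+ y) * ((-1) ^+ x * (-1) ^+ z * (m * n)) by ring.
  by rewrite ss mul1r.
have tE (M' : 'M[C]_3) i k : twist c M' i k = (-1) ^+ dual c * ((-1) ^+ pick3 (sgn c) i *
    (-1) ^+ pick3 (sgn c) k * (if dual c then M' (pick3 (pos c) k) (pick3 (pos c) i)
    else M' (pick3 (pos c) i) (pick3 (pos c) k))) by rewrite mxE !exprD !mulrA.
have mt (M' N' : 'M[C]_3) i k : (twist c M' *m twist c N') i k =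
    \sum_l twist c M' i l * twist c N' l k by rewrite mxE.
rewrite BE !mt; under eq_bigr do rewrite !tE; under [X in _ = _ - X]eq_bigr do rewrite !tE.
rewrite tE !BE !mm; case: (dual c) => /=; rewrite ?expr1 ?expr0.
- rewrite mulN1r -mulrN opprB mulrBr !mulr_sumr; congr (_ - _); apply: eq_bigr => l _;
  by rewrite [X in _ * X = _]mulrC (step _ (pick3 (sgn c) l)); ring.
- rewrite mul1r mulrBr !mulr_sumr; congr (_ - _); apply: eq_bigr => l _;
  by rewrite (step _ (pick3 (sgn c) l)) !mul1r.
Qed.

End VectorFields.

Section ClassicalKinds.
Variable C : fieldType.
Local Notation P := {mpoly C[2]}.
Local Notation X1 := ('X_(ord0 : 'I_2) : P).
Local Notation X2 := ('X_(ord_max : 'I_2) : P).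

Lemma sl3_eE k a b : sl3_e C k a b = ((val a == val k) && (val b == (val k).+1))%:R.
Proof. by rewrite mxE -!val_eqE /= /bump /= add1n. Qed.
Lemma sl3_fE k a b : sl3_f C k a b = ((val b == val k) && (val a == (val k).+1))%:R.
Proof. by rewrite mxE -!val_eqE /= /bump /= add1n andbC. Qed.
Lemma sl3_hE k a b : sl3_h C k a b = ((val a == val k) && (val b == val k))%:R
  - ((val a == (val k).+1) && (val b == (val k).+1))%:R.
Proof. by rewrite !mxE -!val_eqE /= /bump /= add1n. Qed.

(** The chart in which the Chevalley generators act as the classical limit of the
    kind prescribes. For instance Kind2 with i the first node is the chart
    x_1 = y_1 / y_0, x_2 = y_2 / y_0 of the standard representation, where the
    first generator y_0 d/dy_1 sends x_1 to 1 and the second y_1 d/dy_2 sends x_2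
    to x_1; exchanging the nodes dualizes the representation. *)
Definition kind_chart (c : kind) (i : 'I_2) : chart :=
  let first := val i == 0%N in
  match c with
  | Kind1 _ _ _ _ => Chart false (o0, o1, o2) (false, false, false)
  | Kind2 => if first then Chart false (o0, o1, o2) (false, false, false)
             else Chart true (o2, o1, o0) (false, true, false)
  | Kind3 => if first then Chart true (o0, o2, o1) (false, false, true)
             else Chart false (o2, o0, o1) (false, false, false)
  | Kind4 => if first then Chart true (o1, o0, o2) (false, true, true)
             else Chart false (o1, o2, o0) (false, false, false)
  end.

Definition kind_field (c : kind) (i : 'I_2) (M : 'M[C]_3) (u : P) : P :=
  if c is Kind1 _ _ _ _ then 0 else proj_vf (twist (kind_chart c i) M) u.

Lemma kind_chart_inj c i : injective (pick3 (pos (kind_chart c i))).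
Proof.
rewrite /kind_chart; case: (val i == 0%N); case: c => [? ? ? ?|||] /=;
by elim/ord3_ind; elim/ord3_ind.
Qed.

Lemma kind_field_action c i : sl3_derivation_action (kind_field c i).
Proof.
have [[s1 [s2 [s3 [s4 cE]]]]|cE] : (exists s1 s2 s3 s4, c = Kind1 s1 s2 s3 s4) \/
    kind_field c i = fun M u => proj_vf (twist (kind_chart c i) M) u.
  by case: c => [s1 s2 s3 s4|||]; [left; exists s1, s2, s3, s4|right|right|right].
  rewrite cE; split=> *; rewrite /kind_field ?mul0r ?mulr0 ?scaler0 ?addr0 ?subr0 //.
  by move=> ? ? ?; rewrite scaler0 addr0.
rewrite cE; split=> [M _|M _ u v|x M N _ _ u|M N _ _ u].
- exact: vf_linear.
- exact: vfM.
- by rewrite twist_linear proj_vf_linearl.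
- by rewrite twist_bracket ?proj_vf_bracket //; exact: kind_chart_inj.
Qed.

Lemma twistE c (M : 'M[C]_3) a b : twist c M a b =
  (-1) ^+ (dual c + pick3 (sgn c) a + pick3 (sgn c) b) *
   (if dual c then M (pick3 (pos c) b) (pick3 (pos c) a)
    else M (pick3 (pos c) a) (pick3 (pos c) b)).
Proof. by rewrite mxE. Qed.

Lemma kind_field_values c i j : i != j -> classical_of_kind c i j (kind_field c i).
Proof.
case: i j => [[|[|?]] ?] [[|[|?]] ?] // _; case: c => [? ? ? ?|||] //; split; split;
  rewrite /kind_field ?proj_vf_X1 ?proj_vf_X2 /vcoord !twistE /=
    ?sl3_eE ?sl3_fE ?sl3_hE /= -?mul_mpolyC; ring.
Qed.

End ClassicalKinds.

(** * Classical limits *)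
Section NodeLimits.
Import numFieldNormedType.Exports.
Local Open Scope classical_set_scope.
Variable C : numFieldType.
Local Notation P := {mpoly C[2]}.
Local Notation X1 := ('X_(ord0 : 'I_2) : P).
Local Notation X2 := ('X_(ord_max : 'I_2) : P).
Local Notation G := (within (@not_root_of_unity C) (nbhs (1 : C))).

Definition limit_h (t : node) : P * P :=
  match t with
  | NSign _ _ => (0, 0) | NDer1 => (- 2 *: X1, - X2) | NDer2 => (X1, 2 *: X2) | NLin => (X1, - X2)
  end.
Definition limit_e (t : node) : P * P :=
  match t with
  | NSign _ _ => (0, 0) | NDer1 => (1, 0) | NDer2 => (- (X1 * X2), - X2 ^+ 2) | NLin => (0, X1)
  end.
Definition limit_f (t : node) : P * P :=
  match t with
  | NSign _ _ => (0, 0) | NDer1 => (- X1 ^+ 2, - (X1 * X2)) | NDer2 => (0, 1) | NLin => (X2, 0)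
  end.

Section Derivation.
Variable D : P -> P.
Hypothesis DM : forall u v, D (u * v) = D u * v + u * D v.

Lemma der_exp x n : D (x ^+ n) = (n%:R * x ^+ n.-1) * D x.
Proof.
have D1 : D 1 = 0.
  by have := DM 1 1; rewrite !mulr1 mul1r => e; apply: (addrI (D 1)); rewrite addr0 -e.
elim: n => [|n IH]; first by rewrite D1 !mul0r.
rewrite exprS DM IH; case: n {IH} => [|n]; first by rewrite !expr0 !mul0r mulr0 addr0 mul1r mulr1 mul1r.
by rewrite -[n.+1.-1]/n -[n.+2.-1]/n.+1 !exprS -[n.+2%:R]natr1; ring.
Qed.

Lemma der_mon a b : D (X1 ^+ a * X2 ^+ b) =
  a%:R * (X1 ^+ a.-1 * X2 ^+ b) * D X1 + b%:R * (X1 ^+ a * X2 ^+ b.-1) * D X2.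
Proof. by rewrite DM !der_exp; ring. Qed.

Lemma natZ (n : nat) (u : P) : n%:R * u = (n%:R : C) *: u.
Proof. by rewrite -mul_mpolyC mpolyC_nat. Qed.

Lemma e_limit t a b : D X1 = (limit_e t).1 -> D X2 = (limit_e t).2 ->
  tends_to (fun q => node_e (qval q) t a b) (D (X1 ^+ a * X2 ^+ b)).
Proof.
move=> d1 d2; rewrite der_mon d1 d2; case: t {d1 d2} => [s1 s2|||] /=.
- apply: (@tends_to_mon _ _ _ (fun=> 0) 0 0 0) => [q||]; last exact: cvg_cst.
    by rewrite scale0r.
  by rewrite scale0r !mulr0 addr0.
- apply: (@tends_to_mon _ _ _ (fun q => q / q ^+ (a + b) * qint q a) a%:R a.-1 b) => [//||].
    by rewrite mulr1 mulr0 addr0 natZ.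
  by have := cvgM (cvgM (@qlim_id C) (@qlim_expV C (a + b))) (@qlim_qint C a); rewrite !mul1r; apply.
- apply: (@tends_to_mon _ _ _ (fun q => - (q ^+ (a + b) * qint q (a + b))) (- (a + b)%:R) a b.+1) => [//||].
    by rewrite scaleNr -natZ natrD; case: a b => [|a] [|b] /=; rewrite ?exprS ?expr0; ring.
  by have := cvgN (cvgM (@qlim_exp C (a + b)) (@qlim_qint C (a + b))); rewrite mul1r; apply.
- apply: (@tends_to_mon _ _ _ (fun q => qint q b) b%:R a.+1 b.-1) => [//||].
    by rewrite mulr0 add0r -natZ exprS; ring.
  exact: qlim_qint.
Qed.

Lemma f_limit t a b : D X1 = (limit_f t).1 -> D X2 = (limit_f t).2 ->
  tends_to (fun q => node_f (qval q) t a b) (D (X1 ^+ a * X2 ^+ b)).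
Proof.
move=> d1 d2; rewrite der_mon d1 d2; case: t {d1 d2} => [s1 s2|||] /=.
- apply: (@tends_to_mon _ _ _ (fun=> 0) 0 0 0) => [q||]; last exact: cvg_cst.
    by rewrite scale0r.
  by rewrite scale0r !mulr0 addr0.
- apply: (@tends_to_mon _ _ _ (fun q => - (q ^+ (a + b) * qint q (a + b))) (- (a + b)%:R) a.+1 b) => [//||].
    by rewrite scaleNr -natZ natrD; case: a b => [|a] [|b] /=; rewrite ?exprS ?expr0; ring.
  by have := cvgN (cvgM (@qlim_exp C (a + b)) (@qlim_qint C (a + b))); rewrite mul1r; apply.
- apply: (@tends_to_mon _ _ _ (fun q => q / q ^+ (a + b) * qint q b) b%:R a b.-1) => [//||].
    by rewrite mulr1 mulr0 add0r natZ.
  by have := cvgM (cvgM (@qlim_id C) (@qlim_expV C (a + b))) (@qlim_qint C b); rewrite !mul1r; apply.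
- apply: (@tends_to_mon _ _ _ (fun q => qint q a) a%:R a.-1 b.+1) => [//||].
    by rewrite mulr0 addr0 -natZ exprS; ring.
  exact: qlim_qint.
Qed.

(** The eigenvalue of (k - k^-1) / (q - q^-1) on a monomial is the q-analogue of
    an integral linear form in the exponents, with that form as limit. *)
Lemma h_limit t a b : D X1 = (limit_h t).1 -> D X2 = (limit_h t).2 ->
  tends_to (fun q : qparam C => ((qval q - (qval q)^-1)^-1 *
    (node_k (qval q) t a b - (node_k (qval q) t a b)^-1)) *: qmon (qval q) a b)
    (D (X1 ^+ a * X2 ^+ b)).
Proof.
have pX (x : P) n : n%:R * x ^+ n.-1 * x = n%:R * x ^+ n.
  by case: n => [|n]; rewrite ?mul0r //= exprSr mulrA.
have pD (w1 w2 : P) : a%:R * (X1 ^+ a.-1 * X2 ^+ b) * (w1 * X1) +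
     b%:R * (X1 ^+ a * X2 ^+ b.-1) * (w2 * X2) =
    (a%:R * w1 + b%:R * w2) * (X1 ^+ a * X2 ^+ b).
  have -> : a%:R * (X1 ^+ a.-1 * X2 ^+ b) * (w1 * X1) =
    (a%:R * X1 ^+ a.-1 * X1) * w1 * X2 ^+ b by ring.
  have -> : b%:R * (X1 ^+ a * X2 ^+ b.-1) * (w2 * X2) =
    (b%:R * X2 ^+ b.-1 * X2) * w2 * X1 ^+ a by ring.
  by rewrite !pX; ring.
have q2' (q : C) : not_root_of_unity q -> (q != 0) * (q ^+ 2 - 1 != 0).
  by move=> [q0 q1]; split=> //; rewrite subr_eq0 q1.
pose h t (q : C) : C := (q - q^-1)^-1 * (node_k q t a b - (node_k q t a b)^-1).
move=> d1 d2; rewrite der_mon d1 d2; case: t {d1 d2} => [s1 s2|||] /=.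
- apply: (@tends_to_mon _ _ _ (fun=> 0) 0 a b) => [q||]; last exact: cvg_cst.
    have sgn (s : bool) k : (((-1) ^+ s) ^+ k)^-1 = ((-1) ^+ s) ^+ k :> C.
      by rewrite -exprVn invr_sign.
    by rewrite invfM !sgn subrr mulr0.
  by rewrite scale0r !mulr0 addr0.
- apply: (@tends_to_mon _ _ _ (h NDer1) (- (2 * a + b)%:R) a b) => //.
    rewrite -[- 2 *: X1]mul_mpolyC -[- X2]mulN1r pD scaleNr -natZ natrD natrM mpolyCN mpolyC_nat.
    by ring.
  apply: (qlim_eq (g := fun q => - qint q (2 * a + b))) => [q nq|].
    have [q0 q1] := q2' q nq; rewrite /h /= /qint exprD mulnC exprM invrK.
    by field; rewrite q0 q1 !expf_neq0.
  exact: cvgN (@qlim_qint C _).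
- apply: (@tends_to_mon _ _ _ (h NDer2) (a + 2 * b)%:R a b) => //.
    rewrite -[X in _ * X + _]mul1r -[2 *: X2]mul_mpolyC pD -natZ natrD natrM mpolyC_nat.
    by ring.
  apply: (qlim_eq (g := fun q => qint q (a + 2 * b))) => [q nq|].
    have [q0 q1] := q2' q nq; rewrite /h /= /qint exprD [(2 * b)%N]mulnC exprM.
    by field; rewrite q0 q1 !expf_neq0.
  exact: qlim_qint.
- apply: (@tends_to_mon _ _ _ (h NLin) (1 * a%:R - 1 * b%:R) a b) => //.
    rewrite -[X in _ * X + _]mul1r -[- X2]mulN1r pD !mul1r scalerBl -!natZ.
    by ring.
  apply: (qlim_eq (g := fun q => (q ^+ b)^-1 * qint q a - (q ^+ a)^-1 * qint q b)) => [q nq|].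
    have [q0 q1] := q2' q nq; rewrite /h /= /qint.
    by field; rewrite q0 q1 !expf_neq0.
  exact: cvgB (cvgM (@qlim_expV C b) (@qlim_qint C a)) (cvgM (@qlim_expV C a) (@qlim_qint C b)).
Qed.

End Derivation.
End NodeLimits.

Section ClassicalLimits.
Variable C : numFieldType.

Lemma tends_to_ext (u v : forall q : qparam C, qspace 2 q) p :
  (forall q, u q = v q) -> tends_to v p -> tends_to u p.
Proof. by move=> uv [N [c [l [h1 h2 h3]]]]; exists N, c, l; split=> // q; rewrite uv. Qed.

Lemma classical_nodes c (i j k : 'I_2) (rho : 'M[C]_3 -> {mpoly C[2]} -> {mpoly C[2]}) :
  i != j -> classical_of_kind c i j rho ->
  let t := if k == i then (kind_nodes c).1 else (kind_nodes c).2 in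
  [/\ rho (sl3_h C k) 'X_ord0 = (limit_h C t).1 /\ rho (sl3_h C k) 'X_ord_max = (limit_h C t).2,
      rho (sl3_e C k) 'X_ord0 = (limit_e C t).1 /\ rho (sl3_e C k) 'X_ord_max = (limit_e C t).2 &
      rho (sl3_f C k) 'X_ord0 = (limit_f C t).1 /\ rho (sl3_f C k) 'X_ord_max = (limit_f C t).2].
Proof.
move=> ij cl; have [->|ki] := eqVneq k i.
  by case: c cl => [s1 s2 s3 s4|||] /= [[? ? ? ?] [? ? ? ?] [? ? ? ?]].
have -> : k = j by apply/eqP; rewrite (ord2_neq k ij).
by case: c cl => [s1 s2 s3 s4|||] /= [[? ? ? ?] [? ? ? ?] [? ? ? ?]].
Qed.

Lemma sl3_tr k : [/\ \tr (sl3_h C k) = 0, \tr (sl3_e C k) = 0 & \tr (sl3_f C k) = 0].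
Proof.
split; rewrite /mxtrace sum3 ?sl3_hE ?sl3_eE ?sl3_fE;
case: k => [[|[|?]] ?] //=; by rewrite ?subr0 ?sub0r ?addr0 ?add0r ?subrr // addrC subrr.
Qed.

Lemma kind_limit c (i j : 'I_2) (pi : forall p : qparam C, uq_symmetry 2 2 p) rho :
  i != j -> (forall p, of_kind c i j (pi p)) ->
  sl3_derivation_action rho -> classical_of_kind c i j rho -> classical_limit pi rho.
Proof.
move=> ij ofk [lin leib _ _] cl k a b.
have [[h1 h2] [e1 e2] [f1 f2]] := classical_nodes k ij cl.
have [trh tre trf] := sl3_tr k.
move: h1 h2 e1 e2 f1 f2; set t := if _ then _ else _ => h1 h2 e1 e2 f1 f2; split.
- apply: (tends_to_ext (v := fun q => node_e (qval q) t a b)); last first.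
    exact: (e_limit (leib _ tre) a b e1 e2).
  by move=> q; have [] := kind_mon ij (ofk q) k a b.
- apply: (tends_to_ext (v := fun q => node_f (qval q) t a b)); last first.
    exact: (f_limit (leib _ trf) a b f1 f2).
  by move=> q; have [] := kind_mon ij (ofk q) k a b.
- apply: tends_to_ext; last exact: (h_limit (leib _ trh) a b h1 h2).
  move=> q; have [_ _ ke kie] := kind_mon ij (ofk q) k a b.
  by rewrite /uq_h actZl actBl [pi q (uq_k q k) _]ke [pi q (uq_kinv q k) _]kie -scalerBl scalerA.
Qed.

End ClassicalLimits.

Theorem theorem3p1 (R : realType) (q : qparam R[i]) :
  [/\
      forall (c : kind) (i j : 'I_2), i != j ->
        exists pi : uq_symmetry 2 2 q,
          of_kind c i j pi /\
          forall pi' : uq_symmetry 2 2 q, of_kind c i j pi' -> pi' =2 pi,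

      forall pi : uq_symmetry 2 2 q,
        exists (c : kind) (i j : 'I_2) (pi' : uq_symmetry 2 2 q),
          [/\ i != j, of_kind c i j pi' & module_algebra_isom pi pi'],

      forall (c c' : kind) (i j i' j' : 'I_2) (pi pi' : uq_symmetry 2 2 q),
        i != j -> i' != j' -> kind_number c != kind_number c' ->
        of_kind c i j pi -> of_kind c' i' j' pi' ->
        ~ module_algebra_isom pi pi' &

      forall (c : kind) (i j : 'I_2)
             (pi : forall p : qparam R[i], uq_symmetry 2 2 p),
        i != j -> (forall p : qparam R[i], of_kind c i j (pi p)) ->
        exists rho : 'M[R[i]]_3 -> {mpoly R[i][2]} -> {mpoly R[i][2]},
          [/\ sl3_derivation_action rho, classical_of_kind c i j rho &
              classical_limit pi rho]].
Proof.
split.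
- move=> c i j ij; have [pi [ofk _]] := kind_exists q c ij.
  by exists pi; split=> // pi' ofk'; exact: (kind_unique ij ofk' ofk).
- exact: classification.
- move=> c c' i j i' j' pi pi'; exact: kinds_not_isom.
- move=> c i j pi ij ofk; exists (kind_field c i).
  have act := kind_field_action (R[i])%C c i; have val := kind_field_values (R[i])%C c ij.
  by split=> //; exact: kind_limit ij ofk act val.
Qed.
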